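(* Let $E\to X$ be an $\mathrm{SO}(3)$-bundle over a 4-manifold and let $A$ be a definite connection in $E$. Let $V_A\subset\Lambda^1\otimes E$ be the rank 8 sub-bundle orthogonal (with respect to $g_A$ and the metric of $E$) to the image of $S_A\colon TX\to\Lambda^1\otimes E$, $S_A(u)=\iota_uF_A$, and let $W=S^2_0E\oplus E$. Then the operator $$D_A=\delta_AQ\oplus \mathrm{d}_A^*\colon \Omega^0(X,V_A)\to\Omega^0(X,W)$$ is elliptic, where $\delta_AQ$ is the linearisation at $A$ of the map $A\mapsto Q(A)$ and $\mathrm{d}_A^*$ is the $L^2$-adjoint of $\mathrm{d}_A$ defined via the Riemannian metric $g_A$.
   Context: $E\to X$ is an $\mathrm{SO}(3)$-bundle (an oriented rank-3 real vector bundle with fibrewise inner product) over a 4-manifold. $\mathfrak{so}(E)$ carries the inner product given by (minus) the Killing form. The fibrewise orientation gives (via a suitably rescaled cross product) an isometry $E\cong\mathfrak{so}(E)$, and one freely identifies $E\cong\mathfrak{so}(E)\cong\mathfrak{so}(E)^*\cong E^*$. A metric connection $A$ in $E$ is definite if its curvature $F_A$ satisfies $F_A(u,v)\neq 0$ for all linearly independent tangent vectors $u,v$. Write locally $F_A=\sum_i F_i\otimes e_i$ with $e_i$ an orthonormal frame of $E$. Then $A$ is definite if and only if the $F_i$ span at each point a 3-dimensional subspace of $\Lambda^2$ on which the wedge product is definite. $X$ is oriented so that this form is positive. The metric $g_A$ is the Riemannian metric whose bundle of self-dual 2-forms $\Lambda^+_A$ is the span of the $F_i$ and whose volume form is $\mu(A)=\frac13\sum_iF_i\wedge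 F_i$. $Q(A)$ is the section of $S^2E$ (symmetric bilinear forms, equivalently self-adjoint endomorphisms, of $E$) with matrix $Q(A)_{ij}=F_i\wedge F_j/\mu(A)$. The definite connections form an open set $\mathcal D$ in the space of metric connections, with tangent space $T_A\mathcal D=\Omega^1(X,\mathfrak{so}(E))\cong\Omega^1(X,E)$. Since $\operatorname{tr}Q(A)=3$ for all $A$, the linearisation is a map $\delta_AQ\colon\Omega^1(X,E)\to\Omega^0(X,S^2_0E)$, where $S^2_0E$ denotes the trace-free part. In $D_A$, both $\delta_AQ$ and $\mathrm{d}_A^*\colon\Omega^1(X,E)\to\Omega^0(X,E)$ are restricted to sections of $V_A$. *)

(* Defs.v *)
From HB Require Import structures.
From mathcomp Require Import all_boot all_order all_algebra.
From mathcomp Require Import all_classical all_reals all_analysis.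

Set Implicit Arguments.
Unset Strict Implicit.
Unset Printing Implicit Defensive.

Import Order.TTheory GRing.Theory Num.Theory.
Import numFieldNormedType.Exports.

Local Open Scope classical_set_scope.
Local Open Scope ring_scope.

Definition partial (R : realType) (i : 'I_4) (f : 'rV[R]_4 -> R) :
  'rV[R]_4 -> R := fun y => 'D_(delta_mx 0 i) f y.

Definition partials (R : realType) (s : seq 'I_4) (f : 'rV[R]_4 -> R) :
  'rV[R]_4 -> R := foldr (@partial R) f s.

(* C^oo on an open set: all iterated partial derivatives exist and are
   continuous at every point of the set. *)
Definition smooth_on (R : realType) (U : set 'rV[R]_4) (f : 'rV[R]_4 -> R) :=
  forall (s : seq 'I_4) (y : 'rV[R]_4), U y ->
    {for y, continuous (partials s f)} /\
    forall i, derivable (partials s f) y (delta_mx 0 i).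

Definition jacobian4 (R : realType) (f : 'rV[R]_4 -> 'rV[R]_4)
    (y : 'rV[R]_4) : 'M[R]_4 :=
  \matrix_(k, i) partial i (fun z => f z 0 k) y.

(* Smooth 4-manifolds, possibly non-compact, without boundary.  Each point
   carries a preferred chart [chart_at x]; it serves only to represent the
   tangent space at x concretely (see below). *)
Record manifold4 (R : realType) := Manifold4 {
  pt :> topologicalType;
  atlas : Type;
  dom : atlas -> set pt;
  chart : atlas -> pt -> 'rV[R]_4;
  unchart : atlas -> 'rV[R]_4 -> pt;
  chart_at : pt -> atlas;
  pt_hausdorff : hausdorff_space pt;
  pt_second_countable : @second_countable pt;
  dom_open : forall c, open (dom c);
  dom_at : forall x, dom (chart_at x) x;
  chart_open : forall c, open (chart c @` dom c);
  chartK : forall c x, dom c x -> unchart c (chart c x) = x;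
  chart_continuous : forall c x, dom c x -> {for x, continuous (chart c)};
  unchart_continuous : forall c y, (chart c @` dom c) y ->
    {for y, continuous (unchart c)};
  chart_smooth : forall c d (k : 'I_4),
    smooth_on (chart c @` (dom c `&` dom d))
              (fun y => chart d (unchart c y) 0 k)
}.

Section Manifold.
Variables (R : realType) (X : manifold4 R).
Implicit Types (c d : atlas X) (x : X) (f : X -> R).

Definition smooth_in c (D : set X) f :=
  smooth_on (chart c @` (dom c `&` D)) (f \o unchart c).

Definition smooth f := forall c, smooth_in c setT f.

(* The i-th coordinate derivative of f in the chart c. *)
Definition pder c (i : 'I_4) f x : R := partial i (f \o unchart c) (chart c x).

Definition pder_mx m n c (i : 'I_4) (M : X -> 'M[R]_(m, n)) x : 'M[R]_(m, n) :=
  \matrix_(k, l) pder c i (fun z => M z k l) x.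

(* The tangent space T_xX is 'cV[R]_4, a tangent vector being given by its
   coordinates in the preferred chart at x; covectors are row vectors.
   If u has coordinates u_c in the chart c then u_d = jac c d x *m u_c. *)
Definition jac c d x : 'M[R]_4 := jacobian4 (chart d \o unchart c) (chart c x).

Definition differential f x : 'rV[R]_4 := \row_i pder (chart_at x) i f x.

(* First order linear differential operators D between (sub)bundles with
   fibres V x and W x, acting on the spaces GV and GW of their smooth sections.
   The rule D (f s) = f D s + sigma (df) s says that D is a differential
   operator of order at most one whose principal symbol (without the
   conventional factor of the imaginary unit) is sigma. *)
Section Elliptic.
Variables (U U' : lmodType R).
Variables (GV : set (X -> U)) (V : X -> set U).
Variables (GW : set (X -> U')) (W : X -> set U').
Variable D : (X -> U) -> (X -> U').

Definition is_linear_operator :=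
  (forall s, GV s -> GW (D s)) /\
  forall (k : R) s t, GV s -> GV t ->
    forall x, D (fun z => k *: s z + t z) x = k *: D s x + D t x.

Definition is_symbol (sigma : X -> 'rV[R]_4 -> U -> U') :=
  [/\ (forall x xi (k : R) v w, V x v -> V x w ->
     sigma x xi (k *: v + w) = k *: sigma x xi v + sigma x xi w),
    (forall x xi eta (k : R) v, V x v ->
     sigma x (k *: xi + eta) v = k *: sigma x xi v + sigma x eta v) &
    forall f s, smooth f -> GV s -> forall x,
    D (fun z => f z *: s z) x = f x *: D s x + sigma x (differential f x) (s x)].

Definition elliptic :=
  is_linear_operator /\
  exists sigma, is_symbol sigma /\
    forall x (xi : 'rV[R]_4), xi != 0 -> set_bij (V x) (W x) (sigma x xi).
End Elliptic.

(* A field of bilinear forms on TX, given in the preferred charts. *)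
Implicit Type G : X -> 'M[R]_4.

Definition metric_loc G c x : 'M[R]_4 :=
  (jac c (chart_at x) x)^T *m G x *m jac c (chart_at x) x.

Definition riemannian G :=
  [/\ forall x, (G x)^T = G x,
      forall x (u : 'cV[R]_4), u != 0 -> 0 < (u^T *m G x *m u) 0 0 &
      forall c i j, smooth_in c setT (fun x => metric_loc G c x i j)].

Definition row4 (a b c d : R) : 'rV[R]_4 := \row_i nth 0 [:: a; b; c; d] i.

Definition integral4 (h : 'rV[R]_4 -> R) : R :=
  \int[lebesgue_measure]_a \int[lebesgue_measure]_b
  \int[lebesgue_measure]_c \int[lebesgue_measure]_d h (row4 a b c d).

(* Integral, against the Riemannian volume of G, of a function supported in
   the domain of the chart c. *)
Definition vol_integral G c f : R :=
  integral4 ((fun y => f (unchart c y) *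
                       Num.sqrt (\det (metric_loc G c (unchart c y))))
             \_ (chart c @` dom c)).

End Manifold.

(* 2-forms at a point are skew matrices (b i j), for
   1/2 sum_ij b i j dx^i /\ dx^j; [wedge a b] is the coefficient of
   dx^0 /\ dx^1 /\ dx^2 /\ dx^3 in a /\ b. *)
Section TwoForms.
Variable R : realType.
Implicit Types a b G : 'M[R]_4.

Definition skew n (b : 'M[R]_n) := b^T = - b.

Definition wedge a b : R :=
  a 0 1 * b 2 3 - a 0 2 * b 1 3 + a 0 3 * b 1 2
  + a 1 2 * b 0 3 - a 1 3 * b 0 2 + a 2 3 * b 0 1.

(* The inner product on 2-forms induced by the inner product G, normalised so
   that the dx^i /\ dx^j with i < j are orthonormal when G = 1. *)
Definition ip2 G a b : R :=
  2^-1 * \tr (invmx G *m a *m invmx G *m b^T).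

(* b is equal to its Hodge dual; v is the coefficient of the volume form. *)
Definition self_dual G (v : R) b :=
  forall a, skew a -> wedge a b = v * ip2 G a b.

End TwoForms.

(* The isometry between so(3), with minus the Killing form, and R^3.  On so(3)
   the Killing form is K(M, N) = tr (M N), so the matrix [u]_x of v |-> u x v
   has norm sqrt 2 * |u|; hence hat u = [u]_x / sqrt 2, and vee is its inverse.
   Indices are in Z/3: [u]_x (k + 2) (k + 1) = u k. *)
Section So3.
Variable R : realType.

Definition vee (M : 'M[R]_3) : 'cV[R]_3 :=
  \col_k (Num.sqrt 2 * M (k + 2) (k + 1)).

Definition hat (u : 'cV[R]_3) : 'M[R]_3 :=
  (Num.sqrt 2)^-1 *: \matrix_(i, j)
    (if j == i + 2 then u (i + 1) 0
     else if j == i + 1 then - u (i + 2) 0 else 0).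

End So3.

(* SO(3)-bundles, given by local trivialisations and their transition
   functions: trans t s x maps coordinates in the frame s to coordinates in the
   frame t.  The fibre E_x is 'cV[R]_3 with its standard inner product and
   orientation, a vector being given by its coordinates in the preferred
   frame at x. *)
Record so3_bundle (R : realType) (X : manifold4 R) := So3Bundle {
  trivs : Type;
  tdom : trivs -> set X;
  triv_at : X -> trivs;
  trans : trivs -> trivs -> X -> 'M[R]_3;
  tdom_open : forall t, open (tdom t);
  tdom_at : forall x, tdom (triv_at x) x;
  trans_orthogonal : forall t s x, tdom t x -> tdom s x ->
    (trans t s x)^T *m trans t s x = 1%:M;
  trans_det : forall t s x, tdom t x -> tdom s x -> \det (trans t s x) = 1;
  trans_cocycle : forall r t s x, tdom r x -> tdom t x -> tdom s x ->
    trans r t x *m trans t s x = trans r s x;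
  trans_smooth : forall t s c k l,
    smooth_in c (tdom t `&` tdom s) (fun x => trans t s x k l)
}.

Section Bundle.
Variables (R : realType) (X : manifold4 R) (E : so3_bundle X).

(* A chart of X together with a local frame of E. *)
Definition lpatch : Type := (atlas X * trivs E)%type.
Implicit Types (p q : lpatch) (x : X) (i j : 'I_4).

Definition pdom p : set X := dom p.1 `&` tdom p.2.
Definition lpatch_at x : lpatch := (chart_at x, triv_at E x).

(* Sections of E and of T^*X (x) E = Hom(TX, E), and their local expressions. *)
Implicit Types (s : X -> 'cV[R]_3) (a : X -> 'M[R]_(3, 4)).

Definition loc0 p s x : 'cV[R]_3 := trans p.2 (triv_at E x) x *m s x.

Definition loc1 p a x : 'M[R]_(3, 4) :=
  trans p.2 (triv_at E x) x *m a x *m jac p.1 (chart_at x) x.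

(* Sections of E (x) E, i.e. of bilinear forms on E. *)
Definition loc2 p (q : X -> 'M[R]_3) x : 'M[R]_3 :=
  trans p.2 (triv_at E x) x *m q x *m (trans p.2 (triv_at E x) x)^T.

Definition smooth0 s :=
  forall p k, smooth_in p.1 (tdom p.2) (fun x => loc0 p s x k 0).
Definition smooth1 a :=
  forall p k i, smooth_in p.1 (tdom p.2) (fun x => loc1 p a x k i).
Definition smooth2 (q : X -> 'M[R]_3) :=
  forall p k l, smooth_in p.1 (tdom p.2) (fun x => loc2 p q x k l).

(* Local connection matrices: in the patch p, the covariant derivative is
   nabla_i s = d_i s + A p x i *m s.  The metric connections are those with
   values in so(3). *)
Definition cform := lpatch -> X -> 'I_4 -> 'M[R]_3.

Definition is_connection (A : cform) :=
  [/\ forall p x i, pdom p x -> skew (A p x i),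
      forall p i k l, smooth_in p.1 (tdom p.2) (fun x => A p x i k l) &
      forall p q x j, pdom p x -> pdom q x ->
        let g := trans q.2 p.2 in
        A q x j = \sum_i jac q.1 p.1 x i j *:
          (g x *m A p x i *m (g x)^T - pder_mx p.1 i g x *m (g x)^T)].

Record connection := Connection {
  cform_of :> cform;
  connectionP : is_connection cform_of
}.

Implicit Type A : cform.

(* The connection A + t a, for a in Omega^1(X, E) = Omega^1(X, so(E)). *)
Definition cshift A a (t : R) : cform :=
  fun p x i => A p x i + t *: hat (col i (loc1 p a x)).

(* F = dA + A /\ A, as so(3)-matrices F_ij, in the patch p. *)
Definition curvature A p x i j : 'M[R]_3 :=
  pder_mx p.1 i (fun z => A p z j) x - pder_mx p.1 j (fun z => A p z i) x
  + (A p x i *m A p x j - A p x j *m A p x i).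

(* The 2-forms F_k with F_A = sum_k F_k (x) e_k at x, in the preferred patch. *)
Definition Fcomp A x (k : 'I_3) : 'M[R]_4 :=
  \matrix_(i, j) vee (curvature A (lpatch_at x) x i j) k 0.

(* S_A(u) = iota_u F_A; also F_A(u, v) = iotaF A x u *m v. *)
Definition iotaF A x (u : 'cV[R]_4) : 'M[R]_(3, 4) :=
  \matrix_(k, j) (u^T *m Fcomp A x k) 0 j.

Definition definite A :=
  forall x (u v : 'cV[R]_4), \rank (row_mx u v) = 2%N -> iotaF A x u *m v != 0.

(* mu(A) in the coordinates of the preferred chart.  X is oriented so that
   mu(A) is positive; the coefficient below is thus negative when the
   preferred chart at x is not compatible with that orientation. *)
Definition mu A x : R := 3^-1 * \sum_k wedge (Fcomp A x k) (Fcomp A x k).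

Definition Q A x : 'M[R]_3 :=
  \matrix_(k, l) (wedge (Fcomp A x k) (Fcomp A x l) / mu A x).

Definition deltaQ A a x : 'M[R]_3 :=
  \matrix_(k, l) derive1 (fun t : R => Q (cshift A a t) x k l) 0.

(* G is the metric g_A. *)
Definition is_metric_of A (G : X -> 'M[R]_4) :=
  riemannian G /\
  forall x, let vol := Num.sg (mu A x) * Num.sqrt (\det (G x)) in
    vol = mu A x /\
    forall b : 'M[R]_4, skew b ->
      (self_dual (G x) vol b <->
       exists lambda : 'I_3 -> R, b = \sum_k lambda k *: Fcomp A x k).

(* The exterior covariant derivative d_A : Omega^0(X, E) -> Omega^1(X, E). *)
Definition dA A s x : 'M[R]_(3, 4) :=
  let p := lpatch_at x in
  \matrix_(k, i) (pder_mx p.1 i (loc0 p s) x + A p x i *m loc0 p s x) k 0.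

Definition ip0 (v w : 'cV[R]_3) : R := (v^T *m w) 0 0.

(* The inner product on T^*_xX (x) E_x. *)
Definition ip1 (G : 'M[R]_4) (v w : 'M[R]_(3, 4)) : R :=
  \tr (v *m invmx G *m w^T).

Definition compactly_supported_in s (D : set X) :=
  compact (closure [set x | s x != 0]) /\ closure [set x | s x != 0] `<=` D.

(* dstar is the L^2-adjoint of d_A on smooth sections.  By partitions of unity
   it suffices to test against sections compactly supported in one chart
   domain, so that integrals can be computed in that chart. *)
Definition is_L2_adjoint A (G : X -> 'M[R]_4)
    (dstar : (X -> 'M[R]_(3, 4)) -> X -> 'cV[R]_3) :=
  forall a, smooth1 a -> smooth0 (dstar a) /\
    forall c s, smooth0 s -> compactly_supported_in s (dom c) ->
      vol_integral G c (fun x => ip1 (G x) (dA A s x) (a x)) =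
      vol_integral G c (fun x => ip0 (s x) (dstar a x)).

(* V_A, the orthogonal complement of the image of S_A. *)
Definition V A (G : X -> 'M[R]_4) x : set 'M[R]_(3, 4) :=
  [set v | forall u : 'cV[R]_4, ip1 (G x) v (iotaF A x u) = 0].

(* W = S^2_0 E (+) E. *)
Definition W (x : X) : set ('M[R]_3 * 'cV[R]_3)%type :=
  [set w | w.1^T = w.1 /\ \tr w.1 = 0].

Definition V_sections A G : set (X -> 'M[R]_(3, 4)) :=
  [set a | smooth1 a /\ forall x, V A G x (a x)].

Definition W_sections : set (X -> ('M[R]_3 * 'cV[R]_3)%type) :=
  [set w | [/\ smooth2 (fun x => (w x).1), smooth0 (fun x => (w x).2) &
               forall x, W x (w x)]].

Definition D_op A (dstar : (X -> 'M[R]_(3, 4)) -> X -> 'cV[R]_3) :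
  (X -> 'M[R]_(3, 4)) -> X -> ('M[R]_3 * 'cV[R]_3)%type :=
  fun a x => (deltaQ A a x, dstar a x).

End Bundle.

(* Main.v *)
(* Fix a covector xi, let n be the metrically dual vector, K the inverse metric
   and e = iota_n F.  Up to sign and trace part, the symbol of D_A at xi sends w
   to the symmetrisation of w K e^T, paired with w n.  Self-duality of the
   curvature components is equivalent to the Clifford relations
   F_k K F_l + F_l K F_k = - Q_kl G, which give e K e^T = |n|^2/2 Q with Q
   positive definite.  If w in V_A is in the kernel, then w n = 0 forces
   w = B e.  Orthogonality of w to the image of S_A makes n annihilate a
   combination of the F_l K F_k with skew coefficients B - B^T; such a
   combination is a multiple of F_a K F_b with F_a, F_b injective and
   anticommuting through K, so B is symmetric.  Then B Q + Q B = 0 gives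
   tr (B Q B) = 0, hence B = 0.  Bijectivity follows by counting dimensions.

   The symbol of delta_A Q comes from the Leibniz rule for the linearised
   curvature, which is tensorial because the curvature is.  The symbol of d_A^*
   comes from the Leibniz rule for d_A and the adjunction, tested on sections
   cut off by bump functions. *)
Require Import Defs.
From HB Require Import structures.
From mathcomp Require Import all_boot all_order all_algebra.
From mathcomp Require Import all_classical all_reals all_analysis.
From mathcomp Require Import ring lra.
Require Import Defs.

Set Implicit Arguments.
Unset Strict Implicit.
Unset Printing Implicit Defensive.

Import Order.TTheory GRing.Theory Num.Theory.
Import numFieldNormedType.Exports.

Local Open Scope classical_set_scope.
Local Open Scope ring_scope.

(** * Smooth functions on open subsets of R^4 *)

Section Differentiability.
Variable R : realType.

(** Tangent spaces and fibres of [E] are represented through preferred charts and frames that need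
    not vary continuously with the point. Pointwise formulas are therefore evaluated in the
    preferred patch, smoothness is proved in a fixed patch, and the transition laws carry one to the
    other.

    Since [smooth_on] speaks only of iterated partial derivatives, differentiability, the chain rule
    and the symmetry of second derivatives are derived from it; that symmetry is what makes the
    curvature tensorial.

    Nonvanishing of [mu A] has to be extracted from definiteness: with a zero volume coefficient
    every self-dual form would vanish. It is what allows division by [mu A] in the Clifford
    relations and in the derivative of [Q].

    The operator [dstar] is given only by its integrals against test sections. Its linearity and its
    Leibniz rule are both obtained from uniqueness of the adjoint, which requires linearity and
    strict positivity of the iterated integrals for continuous integrands of compact support. *)

Lemma is_derive_line (V : normedModType R) (f : V -> R) (a v : V) (s : R) :
  derivable f (a + s *: v) v ->
  is_derive s (1 : R) (fun t : R => f (a + t *: v)) ('D_v f (a + s *: v)).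
Proof.
have E : (fun h : R => h^-1 *: (((fun t => f (a + t *: v)) \o shift s) (h *: 1)
                           - f (a + s *: v)))
       = (fun h => h^-1 *: ((f \o shift (a + s *: v)) (h *: v) - f (a + s *: v))).
  apply/funext => h /=; congr (_ *: (f _ - _)).
  by rewrite scalerDl [h%:A]mulr1 addrCA.
by move=> df; split; rewrite /derivable /derive /= E.
Qed.

(** Increments of either sign occur below, so the intermediate point is located only by
    [|s| <= |t|]; the segment is [[0, t]] or [[t, 0]]. *)
Lemma line_MVT (V : normedModType R) (f : V -> R) (a v : V) (t : R) :
  (forall s : R, `|s| <= `|t| -> derivable f (a + s *: v) v) ->
  exists2 s : R, `|s| <= `|t| &
    f (a + t *: v) - f a = t * 'D_v f (a + s *: v).
Proof.
move=> df; pose g s := f (a + s *: v).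
have dg (s : R) : `|s| <= `|t| -> is_derive s (1 : R) g ('D_v f (a + s *: v)).
  by move=> st; apply: is_derive_line; exact: df.
have cg (s : R) : `|s| <= `|t| -> {for s, continuous g}.
  move=> st; have ? := dg _ st.
  by apply: differentiable_continuous; apply/derivable1_diffP.
have [t0|t0] := leP 0 t.
  have [||s] := @MVT_segment R g (fun s => 'D_v f (a + s *: v)) 0 t t0.
  - move=> x /[!in_itv]/= /andP[x0 xt]; apply: dg.
    by rewrite (gtr0_norm x0) (ger0_norm t0) ltW.
  - apply: continuous_in_subspaceT => x /[!inE]/= /[!in_itv]/= /andP[x0 xt].
    by apply: cg; rewrite !ger0_norm.
  rewrite in_itv/= => /andP[s0 st] gE; exists s; first by rewrite !ger0_norm.
  by move: gE; rewrite /g scale0r addr0 subr0 mulrC.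
have [||s] := @MVT_segment R g (fun s => 'D_v f (a + s *: v)) t 0 (ltW t0).
- move=> x /[!in_itv]/= /andP[x0 xt]; apply: dg.
  by rewrite !ltr0_norm ?lerN2 1?ltW.
- apply: continuous_in_subspaceT => x /[!inE]/= /[!in_itv]/= /andP[x0 xt].
  by apply: cg; rewrite !ler0_norm ?lerN2// ltW.
rewrite in_itv/= => /andP[s0 st] gE; exists s.
  by rewrite !ler0_norm ?lerN2// ltW.
by move: gE; rewrite /g scale0r addr0 sub0r => gE; rewrite -opprB gE mulrN opprK mulrC.
Qed.

Lemma ler_mx_norm_coord m n (M : 'M[R]_(m, n)) i j : `|M i j| <= `|M|.
Proof.
by rewrite [leRHS]/Num.Def.normr/= mx_normrE; exact: (le_bigmax _ _ (i, j)).
Qed.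

Lemma mx_norm_le m n (M : 'M[R]_(m, n)) e : 0 <= e ->
  (forall i j, `|M i j| <= e) -> `|M| <= e.
Proof.
move=> e0 Me; rewrite [leLHS]/Num.Def.normr/= mx_normrE.
by apply: bigmax_le => // -[i j] _; exact: Me.
Qed.

Lemma norm_delta_mx n (i : 'I_n) : `|delta_mx 0 i : 'rV[R]_n| <= 1.
Proof.
by apply: mx_norm_le => // j k; rewrite mxE; case: (_ && _); rewrite ?normr1 ?normr0.
Qed.

Lemma row_sum_coord n (h : 'rV[R]_n) : h = \sum_i h 0 i *: delta_mx 0 i.
Proof.
apply/rowP => j; rewrite summxE (bigD1 j)//= big1 => [|i ij].
  by rewrite !mxE !eqxx mulr1 addr0.
by rewrite !mxE eq_sym (negbTE ij) andbF mulr0.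
Qed.

Section C1.
Variables (n : nat) (f : 'rV[R]_n -> R) (y : 'rV[R]_n).
Hypothesis df : forall i, \forall z \near y, derivable f z (delta_mx 0 i).
Hypothesis cdf : forall i, {for y, continuous (fun z => 'D_(delta_mx 0 i) f z)}.

(** The truncations [hyb h 0], ..., [hyb h n] lead from [0] to [h] by steps parallel to the axes,
    one coordinate at a time. *)
Let hyb (h : 'rV[R]_n) k : 'rV[R]_n := \row_j (if (j < k)%N then h 0 j else 0).

Let hybS h (k : 'I_n) : hyb h k.+1 = hyb h k + h 0 k *: delta_mx 0 k.
Proof.
apply/rowP => j; rewrite !mxE ltnS eqxx/=.
have [->|jk] := eqVneq j k; first by rewrite leqnn ltnn add0r mulr1.
by rewrite leq_eqVlt -val_eqE in jk *; rewrite (negbTE jk) mulr0 addr0.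
Qed.

Let hyb_le h k (i : 'I_n) (s : R) : `|s| <= `|h| -> i = k :> nat ->
  `|hyb h k + s *: delta_mx 0 i| <= `|h|.
Proof.
move=> sh ik; apply: mx_norm_le => // a j; rewrite !mxE ord1 eqxx/=.
have [->|ji] := eqVneq j i; first by rewrite ik ltnn add0r mulr1.
by rewrite mulr0 addr0; case: ifP; rewrite ?normr0// => _; exact: ler_mx_norm_coord.
Qed.

(** Along each axis-parallel leg the mean value theorem replaces the increment by a partial
    derivative at a point within [|h|] of [y], where it is close to its value at [y]. Summing the
    legs gives the linear approximation. *)
Lemma C1_differentiable : differentiable f y.
Proof.
pose d (h : 'rV[R]_n) : R := \sum_i h 0 i * 'D_(delta_mx 0 i) f y.
have dlin : linear d.
  move=> k u v; rewrite /d scaler_sumr -big_split/=; apply: eq_bigr => i _.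
  by rewrite !mxE mulrDl scalerAl.
pose dM := GRing.isLinear.Build _ _ _ _ _ dlin.
pose dL : {linear _ -> _} := HB.pack d dM.
have dc : continuous dL.
  have dci i : continuous (fun h : 'rV[R]_n => h 0 i * 'D_(delta_mx 0 i) f y).
    by move=> h; apply: (@cvgMr_tmp _ _ (nbhs h)); exact: coord_continuous.
  exact: (@continuous_big R 'I_n +%R 0 xpredT (@add_continuous _) 'rV[R]_n _ _ (fun i _ => dci i)).
suff E : f \o shift y = cst (f y) + (dL : 'rV[R]_n -> R) +o_ (0 : 'rV[R]_n) id.
  have E' := @diff_unique R 'rV[R]_n R f dL y dc E.
  by apply/diff_locallyP; rewrite E'.
apply/eqaddoP => _/posnumP[e].
(* Each of the [n] legs may contribute [e' * |h|]; dividing by [n + 1] keeps the denominator nonzero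
   when [n = 0]. *)
pose e' := e%:num / n.+1%:R.
have e'0 : 0 < e' by rewrite divr_gt0.
have : \forall z \near y, forall i, derivable f z (delta_mx 0 i) /\
    `|'D_(delta_mx 0 i) f y - 'D_(delta_mx 0 i) f z| <= e'.
  apply: (@filter_forall _ _ _ (nbhs y)) => i; near=> z; split; first by near: z; exact: df.
  by near: z; move/cvgrPdist_le : (cdf (i:=i)) => /(_ _ e'0).
move=> /nbhs_normP[r /= r0 H].
have hr0 : \forall h \near (0 : 'rV[R]_n), `|h| < r by exact: nbhs0_lt.
near=> h.
have hr : `|h| < r by near: h; exact: hr0.
have {}H k (i : 'I_n) s : `|s| <= `|h| -> i = k :> nat ->
    derivable f (y + hyb h k + s *: delta_mx 0 i) (delta_mx 0 i) /\
    `|'D_(delta_mx 0 i) f y -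
      'D_(delta_mx 0 i) f (y + hyb h k + s *: delta_mx 0 i)| <= e'.
  move=> sh ik; apply: H => /=; rewrite -addrA opprD addNKr normrN.
  exact: le_lt_trans (hyb_le sh ik) hr.
have hn : y + hyb h n = h + y.
  by rewrite addrC; congr (_ + _); apply/rowP => j; rewrite mxE ltn_ord.
have h0 : y + hyb h 0%N = y.
  by rewrite -[RHS]addr0; congr (_ + _); apply/rowP => j; rewrite !mxE.
rewrite [X in `|X| <= _](_ : _ =
   \sum_(i < n) (f (y + hyb h i.+1) - f (y + hyb h i)
                 - h 0 i * 'D_(delta_mx 0 i) f y)); last first.
  rewrite sumrB -(big_mkord xpredT (fun i => f (y + hyb h i.+1) - f (y + hyb h i))).
  by rewrite telescope_sumr// hn h0 -[LHS]/(f (h + y) - (f y + d h)) opprD addrA.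
apply: (@le_trans _ _ (\sum_(i < n) e' * `|h|)).
  apply: (le_trans (ler_norm_sum _ _ _)); apply: ler_sum => i _.
  have hi := ler_mx_norm_coord h 0 i.
  have [s sh] := @line_MVT _ f (y + hyb h i) (delta_mx 0 i) (h 0 i)
    (fun s sh => (H i i s (le_trans sh hi) erefl).1).
  rewrite hybS addrA => ->; rewrite -mulrBr normrM mulrC distrC.
  by apply: ler_pM => //; exact: (H i i s (le_trans sh hi) erefl).2.
rewrite sumr_const card_ord -mulrnAl ler_wpM2r// /e' -mulr_natr -mulrA.
by rewrite ler_piMr// mulrC ler_pdivrMr// mul1r ler_nat.
Unshelve. all: by end_near. Qed.

End C1.

End Differentiability.

Section SmoothOn.
Variable R : realType.
Implicit Types (f g : 'rV[R]_4 -> R) (U : set 'rV[R]_4) (y : 'rV[R]_4).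

Lemma eq_partial f g y i : (\forall z \near y, f z = g z) ->
  partial i f y = partial i g y.
Proof. exact: near_eq_derive. Qed.

Lemma near_eq_continuous (T : topologicalType) (f g : T -> R) (x : T) :
  (\forall z \near x, f z = g z) -> {for x, continuous g} -> {for x, continuous f}.
Proof.
move=> fg cg; rewrite /prop_for /continuous_at (nbhs_singleton fg).
by apply: cvg_trans cg; apply: near_eq_cvg; apply: filterS fg => z ->.
Qed.

Lemma eq_on_near U f g y : open U -> U y -> (forall z, U z -> f z = g z) ->
  \forall z \near y, f z = g z.
Proof. by move=> oU Uy fg; have := open_nbhs_nbhs (conj oU Uy); exact: filterS. Qed.

Lemma smooth_on_sub U V f : V `<=` U -> smooth_on U f -> smooth_on V f.
Proof. by move=> VU fs s y /VU; exact: fs. Qed.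

(** Induction on the list of derivatives keeps each iterated partial equal on [U] to a member of
    [P]; equality on the open set [U] is enough because derivatives are local. This is the
    coinduction principle behind the later smoothness proofs. *)
Lemma smooth_on_coind U (P : ('rV[R]_4 -> R) -> Prop) f : open U ->
  (forall f, P f -> forall y, U y ->
     {for y, continuous f} /\ forall i, derivable f y (delta_mx 0 i)) ->
  (forall f, P f -> forall i,
     exists2 g, P g & forall y, U y -> partial i f y = g y) ->
  P f -> smooth_on U f.
Proof.
move=> oU cP dP Pf s.
have [g Pg fg] : exists2 g, P g & forall y, U y -> partials s f y = g y.
  elim: s => [|i s [g Pg IH]]; first by exists f.
  have [h Ph gh] := dP _ Pg i; exists h => // y Uy.
  by rewrite -gh//=; apply: eq_partial; exact: eq_on_near oU Uy IH.
move=> y Uy; have [cg dg] := cP _ Pg _ Uy.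
have E := eq_on_near oU Uy fg; have E' : \forall z \near y, g z = partials s f z.
  by apply: filterS E => z ->.
split; last by move=> i; exact: near_eq_derivable (dg i).
exact: near_eq_continuous cg.
Qed.

Lemma smooth_on_ext U f g : open U -> (forall z, U z -> f z = g z) ->
  smooth_on U f -> smooth_on U g.
Proof.
move=> oU fg fs; apply: (@smooth_on_coind _
  (fun h => exists s, forall z, U z -> h z = partials s f z)) => //.
- move=> h [s hs] y Uy; have [cf df] := fs s y Uy.
  have E : \forall z \near y, partials s f z = h z.
    by apply: (eq_on_near oU Uy) => z /hs.
  split; last by move=> i; exact: near_eq_derivable (df i).
  by apply: near_eq_continuous cf; exact: eq_on_near oU Uy hs.
- move=> h [s hs] i; exists (partials (i :: s) f); first by exists (i :: s).
  by move=> y Uy; apply: eq_partial; exact: eq_on_near oU Uy hs.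
- by exists [::] => z Uz /=; rewrite fg.
Qed.

Lemma smooth_on_continuous U f y : smooth_on U f -> U y -> {for y, continuous f}.
Proof. by move=> fs Uy; exact: (fs [::] y Uy).1. Qed.

Lemma partial_rcons i s f : partials (rcons s i) f = partials s (partial i f).
Proof. by rewrite /partials foldr_rcons. Qed.

Lemma smooth_on_partial U f i : smooth_on U f -> smooth_on U (partial i f).
Proof. by move=> fs s y Uy; rewrite -partial_rcons; exact: fs. Qed.

Lemma smooth_on_differentiable U f y : open U -> smooth_on U f -> U y ->
  differentiable f y.
Proof.
move=> oU fs Uy; apply: C1_differentiable => i.
  have := open_nbhs_nbhs (conj oU Uy); apply: filterS => z Uz.
  exact: (fs [::] z Uz).2.
exact: (fs [:: i] y Uy).1.
Qed.

Lemma smooth_on_cst U (k : R) : smooth_on U (fun=> k).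
Proof.
have E (k' : R) i : partial i (fun=> k') = fun=> 0.
  by apply/funext => z; exact: derive_cst.
have {}E s : exists k', partials s (fun=> k) = fun=> k'.
  by elim: s => [|i s [k' IH]]; [exists k|exists 0; rewrite /= IH; apply: E].
move=> s y Uy; have [k' ->] := E s; split=> [|i]; first exact: cst_continuous.
exact: derivable_cst.
Qed.

Lemma differentiable_row n m (phi : 'rV[R]_n -> 'rV[R]_m) (y : 'rV[R]_n) :
  (forall k, differentiable (fun z => phi z 0 k) y) -> differentiable phi y.
Proof.
move=> dphi.
have -> : phi = \sum_k (fun z => phi z 0 k *: (delta_mx 0 k : 'rV[R]_m)).
  apply/funext => z; rewrite [LHS]row_sum_coord fct_sumE.
  by apply: eq_bigr.
by apply: differentiable_sum => k; exact: differentiableZl.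
Qed.

(** The chain rule holds for differentials but not for bare partial derivatives, hence the
    differentiability hypotheses and the passage through [diff_comp]. *)
Lemma partial_comp f (phi : 'rV[R]_4 -> 'rV[R]_4) y i :
  differentiable f (phi y) -> (forall k, differentiable (fun z => phi z 0 k) y) ->
  partial i (fun z => f (phi z)) y =
  \sum_k partial k f (phi y) * partial i (fun z => phi z 0 k) y.
Proof.
move=> df dphi; have dp := differentiable_row dphi.
have dphiE : 'D_(delta_mx 0 i) phi y =
    \sum_k partial i (fun z => phi z 0 k) y *: delta_mx 0 k.
  rewrite derive_mx; last exact: diff_derivable.
  by rewrite [LHS]row_sum_coord; apply: eq_bigr => k _; rewrite mxE.
rewrite /partial deriveE; last exact: differentiable_comp.
rewrite (_ : (fun z => f (phi z)) = f \o phi)// diff_comp//=.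
rewrite -(deriveE _ dp) dphiE linear_sum/=; apply: eq_bigr => k _.
by rewrite linearZ/= mulrC -deriveE.
Qed.

(** The class fed to the coinduction principle. The derivative of a composite is a sum of products
    with composites, so gathering all constructors in one inductive class makes it stable under
    differentiation, and closure of smooth functions under all these operations follows at once. *)
Inductive smooth_closure U : ('rV[R]_4 -> R) -> Prop :=
| SmoothClosureBase f of smooth_on U f : smooth_closure U f
| SmoothClosureD f g of smooth_closure U f & smooth_closure U g :
    smooth_closure U (fun y => f y + g y)
| SmoothClosureM f g of smooth_closure U f & smooth_closure U g :
    smooth_closure U (fun y => f y * g y)
| SmoothClosureV f of smooth_closure U f & (forall y, U y -> f y != 0) :
    smooth_closure U (fun y => (f y)^-1)
| SmoothClosureComp V f (phi : 'rV[R]_4 -> 'rV[R]_4) of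
    open V & smooth_on V f & (forall k, smooth_closure U (fun y => phi y 0 k)) &
    (forall y, U y -> V (phi y)) : smooth_closure U (fun y => f (phi y)).

Lemma smooth_closure_differentiable U f y : open U -> smooth_closure U f ->
  U y -> differentiable f y.
Proof.
move=> oU fs Uy; elim: fs => {f}.
- by move=> f fs; exact: smooth_on_differentiable fs Uy.
- by move=> f g _ df _ dg; exact: differentiableD.
- by move=> f g _ df _ dg; exact: differentiableM.
- by move=> f _ df f0; apply: differentiableV => //; exact: f0.
- move=> V f phi oV fs _ dphi UV; apply: (@differentiable_comp _ _ _ _ phi f).
    exact: differentiable_row.
  exact: smooth_on_differentiable fs (UV _ Uy).
Qed.

Lemma smooth_closure_sum U n (F : 'I_n -> 'rV[R]_4 -> R) :
  (forall k, smooth_closure U (F k)) -> smooth_closure U (fun y => \sum_k F k y).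
Proof.
move=> Fs; suff H (r : seq 'I_n) : smooth_closure U (fun y => \sum_(k <- r) F k y) by exact: H.
elim: r => [|k r IH].
  rewrite (_ : (fun _ => _) = fun=> 0); last by apply/funext => y; rewrite big_nil.
  exact/SmoothClosureBase/smooth_on_cst.
rewrite (_ : (fun _ => _) = fun y => F k y + \sum_(j <- r) F j y).
  exact: SmoothClosureD.
by apply/funext => y; rewrite big_cons.
Qed.

Lemma smooth_closure_partial U f i : open U -> smooth_closure U f ->
  exists2 g, smooth_closure U g & forall y, U y -> partial i f y = g y.
Proof.
move=> oU fs; elim: fs => {f}.
- move=> f fs; exists (partial i f) => //.
  exact/SmoothClosureBase/smooth_on_partial.
- move=> f g fs [f' f's fE] gs [g' g's gE].
  exists (fun y => f' y + g' y) => [|y Uy]; first exact: SmoothClosureD.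
  rewrite -fE// -gE//; apply: (@deriveD _ _ _ f g); apply: diff_derivable.
    exact: smooth_closure_differentiable fs Uy.
  exact: smooth_closure_differentiable gs Uy.
- move=> f g fs [f' f's fE] gs [g' g's gE].
  exists (fun y => f y * g' y + g y * f' y) => [|y Uy].
    by apply: SmoothClosureD; exact: SmoothClosureM.
  rewrite -fE// -gE//; apply: (@deriveM _ _ f g); apply: diff_derivable.
    exact: smooth_closure_differentiable fs Uy.
  exact: smooth_closure_differentiable gs Uy.
- move=> f fs [f' f's fE] f0.
  exists (fun y => (fun=> -1) y * ((f y)^-1 * (f y)^-1) * f' y) => [|y Uy].
    apply: SmoothClosureM => //; apply: SmoothClosureM.
      exact/SmoothClosureBase/smooth_on_cst.
    by apply: SmoothClosureM; exact: SmoothClosureV.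
  rewrite -fE// /partial (@deriveV _ _ f) ?f0//; last first.
    exact/diff_derivable/(smooth_closure_differentiable _ fs Uy).
  by rewrite mulN1r -invfM -expr2.
- move=> V f phi oV fs phis IH UV.
  have /choice[phi' phi'E] : forall k, exists g, smooth_closure U g /\
      forall y, U y -> partial i (fun z => phi z 0 k) y = g y.
    by move=> k; have [g gs gE] := IH k; exists g.
  exists (fun y => \sum_k partial k f (phi y) * phi' k y) => [|y Uy].
    apply: smooth_closure_sum => k; apply: SmoothClosureM; last by have [] := phi'E k.
    by apply: SmoothClosureComp oV _ phis UV; exact: smooth_on_partial.
  rewrite partial_comp; last 2 first.
    exact: smooth_on_differentiable fs (UV _ Uy).
    by move=> k; exact: smooth_closure_differentiable (phis k) Uy.
  by apply: eq_bigr => k _; rewrite (phi'E k).2.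
Qed.

Lemma smooth_closureP U f : open U -> smooth_closure U f -> smooth_on U f.
Proof.
move=> oU; apply: smooth_on_coind => // {}f fs.
  move=> y Uy; have df := smooth_closure_differentiable oU fs Uy.
  split=> [|i]; [exact: differentiable_continuous|exact: diff_derivable].
by move=> i; exact: smooth_closure_partial.
Qed.

(** The second difference of [f] over a square of side [t] is symmetric in the two directions. Two
    applications of the mean value theorem write it as [t ^ 2] times a mixed derivative at a nearby
    point, for either order of differentiation; continuity of both mixed derivatives then identifies
    them at [y]. *)
Lemma partialC U f i j y : open U -> smooth_on U f -> U y ->
  partial i (partial j f) y = partial j (partial i f) y.
Proof.
move=> oU fs Uy.
have dbl (k l : 'I_4) (e : R) : 0 < e -> \forall t \near (0 : R), t != 0 ->
    exists2 z, `|partial l (partial k f) y - z| < e &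
     t * t * z = f (y + t *: delta_mx 0 k + t *: delta_mx 0 l)
      - f (y + t *: delta_mx 0 k) - (f (y + t *: delta_mx 0 l) - f y).
  move=> e0.
  have : \forall z \near y, U z /\
      `|partial l (partial k f) y - partial l (partial k f) z| < e.
    near=> z; split; first by near: z; exact: open_nbhs_nbhs.
    near: z; have := (fs [:: l; k] y Uy).1.
    by move/cvgrPdist_lt => /(_ _ e0).
  move=> /nbhs_normP[r /= r0 H].
  have r20 : 0 < r / 2 by rewrite divr_gt0.
  have tr0 : \forall t \near (0 : R), `|t| < r / 2 by exact: nbhs0_lt.
  near=> t; have tr : `|t| < r / 2 by near: t; exact: tr0.
  have {}H (s s' : R) : `|s| <= `|t| -> `|s'| <= `|t| ->
      U (y + s *: delta_mx 0 k + s' *: delta_mx 0 l) /\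
      `|partial l (partial k f) y -
        partial l (partial k f) (y + s *: delta_mx 0 k + s' *: delta_mx 0 l)| < e.
    move=> st s't; apply: H => /=; rewrite -addrA opprD addNKr normrN.
    apply: (le_lt_trans (ler_normD _ _)); rewrite (splitr r) ltrD// normrZ.
      by apply: le_lt_trans tr; rewrite -[leRHS]mulr1 ler_pM// norm_delta_mx.
    by apply: le_lt_trans tr; rewrite -[leRHS]mulr1 ler_pM// norm_delta_mx.
  move=> t0.
  pose g z := f (z + t *: delta_mx 0 l) - f z.
  have U1 (s : R) : `|s| <= `|t| -> U (y + s *: delta_mx 0 k).
    move=> st; have [] := H s 0 st _; first by rewrite normr0.
    by rewrite scale0r addr0.
  have dshift (s : R) : `|s| <= `|t| ->
      is_derive (y + s *: delta_mx 0 k) (delta_mx 0 k) (fun z => f (z + t *: delta_mx 0 l))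
       (partial k f (y + s *: delta_mx 0 k + t *: delta_mx 0 l)).
    move=> st.
    have := (fs [::] _ (H s t st (lexx _)).1).2 k.
    set a := y + _; set b := t *: _.
    rewrite /derivable => df.
    have E : (fun h : R => h^-1 *: (((fun z => f (z + b)) \o shift a) (h *: delta_mx 0 k)
                           - f (a + b)))
       = (fun h => h^-1 *: ((f \o shift (a + b)) (h *: delta_mx 0 k) - f (a + b))).
      by apply/funext => h /=; rewrite -[in LHS](addrA _ a b).
    by split; rewrite /derivable /partial /derive /= E.
  have dg (s : R) : `|s| <= `|t| -> derivable g (y + s *: delta_mx 0 k) (delta_mx 0 k).
    move=> st; apply: (@derivableB _ _ _ (fun z => f (z + t *: delta_mx 0 l)) f).
      by have [] := dshift s st.
    exact: (fs [::] _ (U1 s st)).2.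
  have [s st gE] := line_MVT dg.
  have [s' s't hE] := @line_MVT _ _ (partial k f) (y + s *: delta_mx 0 k) (delta_mx 0 l) t
     (fun s' s't => (fs [:: k] _ (H s s' st s't).1).2 l).
  exists (partial l (partial k f) (y + s *: delta_mx 0 k + s' *: delta_mx 0 l)).
    exact: (H s s' st s't).2.
  rewrite -mulrA -hE.
  have -> : f (y + t *: delta_mx 0 k + t *: delta_mx 0 l) - f (y + t *: delta_mx 0 k)
     - (f (y + t *: delta_mx 0 l) - f y) = g (y + t *: delta_mx 0 k) - g y by [].
  rewrite gE; congr (_ * _).
  rewrite (@deriveB _ _ _ (fun z => f (z + t *: delta_mx 0 l)) f).
  - by have [_ ->] := dshift s st.
  - by have [] := dshift s st.
  - exact: (fs [::] _ (U1 s st)).2.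
apply/eqP; rewrite -subr_eq0 -normr_le0; apply/ler_addgt0Pl => e e0.
rewrite addr0; have e20 : 0 < e / 2 by rewrite divr_gt0.
have : \forall t \near (0 : R)^', `|partial i (partial j f) y - partial j (partial i f) y| <= e.
  near=> t.
  have t0 : t != 0 by near: t; exact: nbhs_dnbhs_neq.
  have [z zl zE] : exists2 z, `|partial i (partial j f) y - z| < e / 2 &
     t * t * z = f (y + t *: delta_mx 0 j + t *: delta_mx 0 i)
      - f (y + t *: delta_mx 0 j) - (f (y + t *: delta_mx 0 i) - f y).
    by move: (t0); near: t; apply: nbhs_dnbhs; exact: dbl.
  have [w wl wE] : exists2 z, `|partial j (partial i f) y - z| < e / 2 &
     t * t * z = f (y + t *: delta_mx 0 i + t *: delta_mx 0 j)
      - f (y + t *: delta_mx 0 i) - (f (y + t *: delta_mx 0 j) - f y).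
    by move: (t0); near: t; apply: nbhs_dnbhs; exact: dbl.
  have zw : z = w.
    apply: (mulfI (mulf_neq0 t0 t0)); rewrite zE wE (addrAC y).
    by rewrite !opprB !addrA; ring.
  rewrite -(subrKA z); apply: (le_trans (ler_normD _ _)).
  by rewrite (splitr e); apply: lerD; apply: ltW => //; rewrite distrC zw.
by move=> /filter_ex[].
Unshelve. all: by end_near. Qed.

End SmoothOn.

(** * Bump functions *)

Section Bump.
Variable R : realType.

(* The derivatives of exp(-1/t), extended by 0, are all of this form. *)
Definition flat (p : {poly R}) (t : R) : R :=
  if 0 < t then p.[t^-1] * expR (- t^-1) else 0.

(** With [u = 1 / t], the inequality [u ^ (i + 1) / (i + 1)! <= exp u] gives
    [u ^ i * exp (- u) <= (i + 1)! * t], whence the constant. The factor [t] is what makes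
    difference quotients at [0] tend to [0]. *)
Lemma flat_bound (p : {poly R}) :
  exists2 C, 0 <= C & forall t, 0 < t -> `|flat p t| <= C * t.
Proof.
exists (\sum_(i < size p) `|p`_i| * (i.+1)`!%:R).
  by apply: sumr_ge0 => i _; rewrite mulr_ge0.
move=> t t0; rewrite /flat t0 horner_coef mulr_suml mulr_suml.
apply: (le_trans (ler_norm_sum _ _ _)); apply: ler_sum => i _.
set u := t^-1; have u0 : 0 < u by rewrite invr_gt0.
rewrite !normrM -!mulrA ler_wpM2l// normrX (gtr0_norm u0) (gtr0_norm (expR_gt0 _)).
have := @expR_ge1Dxn R u i (ltW u0) => H.
have {}H : u ^+ i.+1 / i.+1`!%:R <= expR u by apply: le_trans H; rewrite lerDr.
have tu : t = u^-1 by rewrite invrK.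
rewrite expRN tu ler_pdivrMr ?expR_gt0// mulrAC ler_pdivlMr// -exprSr.
by rewrite mulrC -ler_pdivrMr// ltr0n fact_gt0.
Qed.

(** The derivative of [p (1/t) exp (- 1/t)] is [t ^ -2 (p - p') (1/t) exp (- 1/t)], and [t ^ -2] is
    [X ^ 2] evaluated at [1/t]. *)
Definition flat_deriv (p : {poly R}) := 'X^2 * (p - p^`()).

Lemma is_derive_flat p (t : R) : is_derive t (1 : R) (flat p) (flat (flat_deriv p) t).
Proof.
have [t0|t0|->] := ltgtP t 0.
- rewrite {2}/flat ltNge (ltW t0)/=.
  have tn : \forall s \near t, s < 0 by apply: (@cvgr_lt _ _ (nbhs t) _ id t) => //; exact: cvg_id.
  have := is_derive_cst (0 : R) t (1 : R); apply: near_eq_is_derive.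
  by apply: filterS tn => s s0; rewrite /flat ltNge (ltW s0).
- rewrite {2}/flat t0.
  have dh (u : R) : is_derive u (1 : R) (fun v => p.[v] * expR (- v))
      ((p^`() - p).[u] * expR (- u)).
    have de : is_derive u (1:R) (fun v => expR (- v)) (- expR (- u)).
      have := @is_derive1_comp R expR (-%R) u (expR (- u)) (-1) _ _.
      by rewrite mulrN1; apply; exact: is_deriveNid.
    have := @is_deriveM _ _ _ _ _ _ _ _ (is_derive_poly p u) de.
    by move=> H; apply: (is_derive_eq H); rewrite !hornerE /GRing.scale/=; ring.
  have di : is_derive t (1 : R) (fun s => s^-1) (- t ^- 2).
    have := @is_deriveV R id t 1 1 (lt0r_neq0 t0) (is_derive_id _ _).
    by move=> H; apply: (is_derive_eq H); rewrite /GRing.scale/= mulr1.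
  have tp : \forall s \near t, 0 < s by apply: (@cvgr_gt _ _ (nbhs t) _ id t) => //; exact: cvg_id.
  have : is_derive t (1 : R) ((fun v => p.[v] * expR (- v)) \o (fun s => s^-1))
      ((flat_deriv p).[t^-1] * expR (- t^-1)).
    apply: (is_derive_eq (is_derive1_comp (dh t^-1) di)).
    rewrite /flat_deriv !hornerE/= exprVn; ring.
  apply: near_eq_is_derive.
  by apply: filterS tp => s s0; rewrite /flat s0.
- rewrite {2}/flat ltxx.
  (* For [h > 0] the difference quotient of [flat p] at [0] is [flat (p * 'X) h], which is at most
     [C * h]. *)
  have [C C0 CP] := flat_bound (p * 'X).
  have H : h^-1 *: ((flat p \o shift 0) (h *: 1) - flat p 0) @[h --> 0^'] --> (0 : R).
    apply/cvgrPdist_le => e e0; near=> h.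
    have h0 : h != 0 by near: h; exact: nbhs_dnbhs_neq.
    rewrite sub0r normrN /= addr0 [h%:A]mulr1 {2}/flat ltxx subr0.
    have [hn|hp] := leP h 0; first by rewrite /flat ltNge hn/= scaler0 normr0 ltW.
    have -> : h^-1 *: flat p h = flat (p * 'X) h.
      by rewrite /flat hp /GRing.scale/= hornerMX; ring.
    apply: (le_trans (CP _ hp)).
    have : `|h| < e / (C + 1).
      by near: h; apply: dnbhs0_lt; rewrite divr_gt0// ltr_wpDl.
    rewrite gtr0_norm// ltr_pdivlMr ?ltr_wpDl// => /ltW; apply: le_trans.
    by rewrite mulrDr mulr1 [C * h]mulrC lerDl ltW.
  split; first by apply/cvg_ex; exists 0.
  exact/cvg_lim.
Unshelve. all: by end_near. Qed.

Lemma differentiable_flat p (t : R) : differentiable (flat p) t.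
Proof. by apply/derivable1_diffP; have [] := is_derive_flat p t. Qed.

(** A partial derivative only changes the constant factor and replaces [p] by [flat_deriv p], so the
    multiples of such functions form a class stable under differentiation. *)
Lemma smooth_on_flat p (j : 'I_4) (s b : R) :
  smooth_on setT (fun y : 'rV[R]_4 => flat p (s * y 0 j + b)).
Proof.
apply: (@smooth_on_coind _ _ (fun f => exists k p,
    f = fun y => k * flat p (s * y 0 j + b))) => [|f [k [{}p ->]]|f [k [{}p ->]] i|].
- exact: openT.
- move=> y _.
  have d : differentiable (fun y : 'rV[R]_4 => k * flat p (s * y 0 j + b)) y.
    apply: (@differentiableZ R 'rV[R]_4 R (fun y => flat p (s * y 0 j + b))).
    apply: (@differentiable_comp R 'rV[R]_4 R R (fun y => s * y 0 j + b) (flat p)).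
      apply: (@differentiableD R 'rV[R]_4 R (fun y => s * y 0 j) (cst b)).
        apply: (@differentiableZ R 'rV[R]_4 R (fun y => y 0 j)).
        exact: differentiable_coord.
      exact: differentiable_cst.
    exact: differentiable_flat.
  by split=> [|i]; [exact: differentiable_continuous|exact: diff_derivable].
- exists (fun y => (k * (s * (i == j)%:R)) * flat (flat_deriv p) (s * y 0 j + b)).
    by exists (k * (s * (i == j)%:R)), (flat_deriv p).
  move=> y _; set c := s * (i == j)%:R.
  have E : 'D_(delta_mx 0 i) (fun y : 'rV[R]_4 => k * flat p (s * y 0 j + b)) y =
      'D_c (fun t => k * flat p t) (s * y 0 j + b).
    pose G (z : 'rV[R]_4) := k * flat p (s * z 0 j + b).
    have Eh : (fun h : R => h^-1 *: ((G \o shift y) (h *: delta_mx 0 i) - G y)) =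
        (fun h => h^-1 *: (((fun t => k * flat p t) \o shift (s * y 0 j + b)) (h *: c)
                          - k * flat p (s * y 0 j + b))).
      apply/funext => h; rewrite /G /=; congr (_ *: (k * flat p _ - _)).
      by rewrite !mxE eqxx/= /c /GRing.scale/= [j == i]eq_sym; ring.
    by rewrite -/G /derive Eh.
  rewrite /partial E deriveE; last by apply: (@differentiableZ R R R (flat p)); exact: differentiable_flat.
  rewrite (@diffZ R R R (flat p))/=; last exact: differentiable_flat.
  rewrite -[c]mulr1 [X in _ *: X]linearZ/= -deriveE; last exact: differentiable_flat.
  by have [_ ->] := is_derive_flat p (s * y 0 j + b); rewrite /GRing.scale/=; ring.
- by exists 1, p; apply/funext => y; rewrite mul1r.
Qed.

(** The two factors for [j] are positive exactly when [a j - r < y j < a j + r], so the product is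
    positive exactly on the open ball of radius [r] for the sup norm. The coefficients [1] and [-1]
    fit the affine form in [smooth_on_flat]. *)
Definition bump4 (a : 'rV[R]_4) (r : R) (y : 'rV[R]_4) : R :=
  \prod_(j < 4) (flat 1 (1 * y 0 j + (r - a 0 j)) * flat 1 (-1 * y 0 j + (r + a 0 j))).

Lemma smooth_on_prod U n (F : 'I_n -> 'rV[R]_4 -> R) : open U ->
  (forall k, smooth_on U (F k)) -> smooth_on U (fun y => \prod_k F k y).
Proof.
move=> oU Fs; apply: smooth_closureP => //.
suff H (r : seq 'I_n) : smooth_closure U (fun y => \prod_(k <- r) F k y) by exact: H.
elim: r => [|k r IH].
  rewrite (_ : (fun _ => _) = fun=> 1); last by apply/funext => y; rewrite big_nil.
  exact/SmoothClosureBase/smooth_on_cst.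
rewrite (_ : (fun _ => _) = fun y => F k y * \prod_(j <- r) F j y).
  exact/SmoothClosureM/IH/SmoothClosureBase.
by apply/funext => y; rewrite big_cons.
Qed.

Lemma smooth_on_bump4 a r : smooth_on setT (bump4 a r).
Proof.
apply: smooth_on_prod => [|k]; first exact: openT.
apply: smooth_closureP; first exact: openT.
by apply: SmoothClosureM; apply: SmoothClosureBase; exact: smooth_on_flat.
Qed.

Lemma flat1_ge0 t : 0 <= flat 1 t.
Proof. by rewrite /flat; case: ifP => // _; rewrite hornerE mul1r expR_ge0. Qed.

Lemma flat1_gt0 t : (0 < flat 1 t) = (0 < t).
Proof. by rewrite /flat; case: ifP => t0; rewrite ?ltxx// hornerE mul1r expR_gt0. Qed.

Lemma bump4_ge0 a r y : 0 <= bump4 a r y.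
Proof. by apply: prodr_ge0 => j _; rewrite mulr_ge0 ?flat1_ge0. Qed.

Lemma bump4_gt0 a r : 0 < r -> 0 < bump4 a r a.
Proof.
move=> r0; apply: prodr_gt0 => j _; rewrite mulr_gt0// flat1_gt0.
  by rewrite mul1r addrC subrK.
by rewrite mulN1r addrC addrK.
Qed.

Lemma bump4_eq0 a r y : 0 < r -> r <= `|a - y| -> bump4 a r y = 0.
Proof.
move=> r0 ray; have /existsP[j jr] : [exists j, r <= `|a 0 j - y 0 j|].
  apply: contraLR ray; rewrite negb_exists => /forallP H.
  rewrite -ltNge [ltLHS]/Num.Def.normr/= mx_normrE.
  apply: bigmax_lt => // -[i j] _; rewrite !mxE (ord1 i) ltNge; exact: H.
rewrite /bump4 (bigD1 j)//=; apply/eqP; rewrite !mulf_eq0 -!orbA; apply/or3P.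
move: jr; rewrite ler_normr => /orP[jr|jr]; [apply: Or31|apply: Or32].
  by rewrite /flat ltNge (_ : _ <= 0)//; lra.
by rewrite /flat ltNge (_ : _ <= 0)//; lra.
Qed.

End Bump.

(** * Iterated integrals of continuous functions with compact support *)

Section IteratedIntegral.
Variable R : realType.
Notation mu := (@lebesgue_measure R).

Let seg (N : R) : set R := `[- N, N]%classic.

Let nseg N t : (~ seg N t) -> N < `|t|.
Proof. by rewrite /seg /= in_itv/= => /negP; rewrite -ler_norml -ltNge. Qed.

Let supp_restrict N (f : R -> R) : (forall t, N < `|t| -> f t = 0) -> f = f \_ (seg N).
Proof.
move=> f0; apply/funext => t; rewrite patchE; case: ifPn => // /negP.
by rewrite inE => /nseg; exact: f0.
Qed.

Lemma continuous_supp_integrable N (f : R -> R) : continuous f ->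
  (forall t, N < `|t| -> f t = 0) -> mu.-integrable setT (EFin \o f).
Proof.
move=> cf f0; rewrite (supp_restrict f0) -restrict_EFin.
have [+ _] := @integrable_mkcond _ _ _ mu (seg N) (EFin \o f) (measurable_itv _); apply.
apply: continuous_compact_integrable; first exact: segment_compact.
exact: continuous_subspaceT.
Qed.

(** Compactness of the segment makes continuity at [z0] uniform in [t]. The parameter space is left
    general because it will be a product of one, two or three lines. *)
Lemma Rintegral_param_continuous (T : topologicalType) N (h : T * R -> R) :
  continuous h -> (forall z t, N < `|t| -> h (z, t) = 0) ->
  continuous (fun z => \int[mu]_t h (z, t)).
Proof.
move=> ch h0 z0; pose M := `|N| + 1.
have M0 : 0 < M by rewrite ltr_wpDl.
have NM : N < M by apply: (le_lt_trans (ler_norm N)); rewrite ltrDl.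
have cz z : continuous (fun t => h (z, t)).
  move=> t; have cp : (fun s : R => (z, s)) @ t --> (z, t).
    apply: (@cvg_pair _ _ _ (nbhs t) (nbhs z) (nbhs t)); first exact: cvg_cst.
    exact: cvg_id.
  exact: (cvg_comp _ h cp (ch (z, t))).
have IE z : \int[mu]_t h (z, t) = \int[mu]_(t in seg M) h (z, t).
  rewrite [RHS]Rintegral_mkcond; congr (Rintegral mu setT _).
  by apply: supp_restrict => t Mt; apply: h0; exact: lt_trans Mt.
have iz z : mu.-integrable (seg M) (EFin \o (fun t => h (z, t))).
  apply: continuous_compact_integrable; first exact: segment_compact.
  by apply: continuous_subspaceT; exact: cz.
(* The segment has length [2 * M], so an error [e'] in the integrand costs at most [e] in the
   integral. *)
apply/cvgrPdist_le => e e0; pose e' := e / (2 * M).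
have e'0 : 0 < e' by rewrite divr_gt0// mulr_gt0.
have : \forall z \near z0, seg M `<=` (fun t => `|h (z0, t) - h (z, t)| <= e').
  have /compact_near_coveringP := @segment_compact R (- M) M; apply => t _.
  have e2 : 0 < e' / 2 by rewrite divr_gt0.
  have A : \forall t' \near t, `|h (z0, t) - h (z0, t')| < e' / 2.
    by move/cvgrPdist_lt : (cz z0 t) => /(_ _ e2).
  have B : \forall p \near (z0, t), `|h (z0, t) - h p| < e' / 2.
    by move/cvgrPdist_lt : (ch (z0, t)) => /(_ _ e2).
  case: B => -[B1 B2] /= [B1n B2n] B12.
  exists (B2 `&` (fun t' => `|h (z0, t) - h (z0, t')| < e' / 2), B1) => /=.
    by split=> //; exact: filterI.
  move=> [t' z] /= [[B2t At] B1z].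
  rewrite -(subrKA (h (z0, t))); apply: (le_trans (ler_normD _ _)).
  rewrite (splitr e'); apply: lerD; apply: ltW; first by rewrite distrC.
  exact: (B12 (z, t')).
have mM : measurable (seg M) by exact: measurable_itv.
apply: filterS => z zP; rewrite !IE -RintegralB//.
apply: (le_trans (le_normr_Rintegral _ _)) => //.
  apply: continuous_compact_integrable; first exact: segment_compact.
  by apply: continuous_subspaceT => t; apply: cvgB; exact: cz.
have -> : e = \int[mu]_(t in seg M) e'.
  rewrite Rintegral_cst//= lebesgue_measure_itv/= lte_fin ifT; last by lra.
  by rewrite /e' /=; field; exact: lt0r_neq0.
have ic : continuous (fun t => `|h (z0, t) - h (z, t)|).
  by move=> t; apply: cvg_norm; apply: cvgB; exact: cz.
apply: le_Rintegral => //.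
  apply: continuous_compact_integrable; first exact: segment_compact.
  exact: continuous_subspaceT.
apply: continuous_compact_integrable; first exact: segment_compact.
by apply: continuous_subspaceT => t; exact: cvg_cst.
Qed.

Lemma Rintegral_linear N (k : R) (f g : R -> R) : continuous f -> continuous g ->
  (forall t, N < `|t| -> f t = 0) -> (forall t, N < `|t| -> g t = 0) ->
  \int[mu]_t (k * f t + g t) = k * \int[mu]_t f t + \int[mu]_t g t.
Proof.
move=> cf cg f0 g0.
have If := continuous_supp_integrable cf f0.
have Ig := continuous_supp_integrable cg g0.
rewrite RintegralD//; last first.
  apply: (@continuous_supp_integrable N) => [t|t /f0 ->]; last by rewrite mulr0.
  by apply: cvgMl_tmp; exact: cf.
by congr (_ + _); rewrite RintegralZl.
Qed.

Lemma Rintegral_continuous_gt0 N (f : R -> R) t0 : continuous f ->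
  (forall t, N < `|t| -> f t = 0) -> (forall t, 0 <= f t) -> 0 < f t0 ->
  0 < \int[mu]_t f t.
Proof.
move=> cf fN f0 ft0; pose e := f t0 / 2.
have e0 : 0 < e by rewrite divr_gt0.
have : \forall t \near t0, `|f t0 - f t| < e.
  by move/cvgrPdist_lt : (cf t0) => /(_ _ e0).
move=> /nbhs_normP[r /= r0 H].
pose D : set R := `[t0 - r / 2, t0 + r / 2]%classic.
have mD : measurable D by exact: measurable_itv.
have If := continuous_supp_integrable cf fN.
have Dsub : mu.-integrable D (EFin \o f).
  apply: continuous_compact_integrable; first exact: segment_compact.
  exact: continuous_subspaceT.
have Ie : mu.-integrable D (EFin \o fun=> e).
  apply: continuous_compact_integrable; first exact: segment_compact.
  by apply: continuous_subspaceT => t; exact: cvg_cst.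
apply: (@lt_le_trans _ _ (\int[mu]_(t in D) e)).
  rewrite Rintegral_cst//= lebesgue_measure_itv/= lte_fin ifT; last by lra.
  by rewrite mulr_gt0//=; lra.
apply: (@le_trans _ _ (\int[mu]_(t in D) f t)).
  apply: le_Rintegral => // t; rewrite /D /= in_itv/= => /andP[t1 t2].
  have /H : `|t0 - t| < r by rewrite ltr_norml; lra.
  by rewrite ltr_norml /e; lra.
rewrite Rintegral_mkcond; apply: le_Rintegral => //.
  by rewrite -restrict_EFin; have [+ _] := @integrable_mkcond _ _ _ mu D (EFin \o f) mD; apply.
by move=> t _; rewrite patchE; case: ifP.
Qed.

Lemma cvg_mx (T : Type) (F : set_system T) m n (f : T -> 'M[R]_(m, n)) (l : 'M[R]_(m, n)) :
  Filter F -> (forall i j, f x i j @[x --> F] --> l i j) -> f x @[x --> F] --> l.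
Proof.
move=> FF fl; apply/cvgrPdist_le => e e0.
have : \forall x \near F, forall ij : 'I_m * 'I_n, `|l ij.1 ij.2 - f x ij.1 ij.2| <= e.
  apply: filter_forall => -[i j] /=.
  by move/cvgrPdist_le : (fl i j) => /(_ _ e0).
apply: filterS => x H; apply: mx_norm_le; first exact: ltW.
by move=> i j; rewrite !mxE; exact: (H (i, j)).
Qed.

Lemma row4_continuous :
  continuous (fun q : R * R * R * R => row4 q.1.1.1 q.1.1.2 q.1.2 q.2).
Proof.
move=> q.
have c1 : (fun q : R * R * R * R => q.1) @ q --> q.1 by exact: cvg_fst.
have c2 : (fun q : R * R * R * R => q.2) @ q --> q.2 by exact: cvg_snd.
have c11 : (fun q : R * R * R * R => q.1.1) @ q --> q.1.1.
  by apply: (cvg_comp _ (fun p : R * R * R => p.1) c1); exact: cvg_fst.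
have c12 : (fun q : R * R * R * R => q.1.2) @ q --> q.1.2.
  by apply: (cvg_comp _ (fun p : R * R * R => p.2) c1); exact: cvg_snd.
have c111 : (fun q : R * R * R * R => q.1.1.1) @ q --> q.1.1.1.
  by apply: (cvg_comp _ (fun p : R * R => p.1) c11); exact: cvg_fst.
have c112 : (fun q : R * R * R * R => q.1.1.2) @ q --> q.1.1.2.
  by apply: (cvg_comp _ (fun p : R * R => p.2) c11); exact: cvg_snd.
apply: (@cvg_mx _ (nbhs q)) => i j; rewrite /row4.
under eq_cvg do rewrite mxE; rewrite mxE.
by case: j => -[|[|[|[|]]]] //= _.
Qed.

Section Integral4.
Variable N : R.

Definition cont_supp (h : 'rV[R]_4 -> R) :=
  continuous h /\ forall (y : 'rV[R]_4) (j : 'I_4), N < `|y 0 j| -> h y = 0.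

(** The partial integrals of [h], as functions of the coordinates not yet integrated. Each remains
    continuous with bounded support, so each of the four integrations is that of an integrable
    function. *)
Let H4 (h : 'rV[R]_4 -> R) (q : R * R * R * R) : R :=
  h (row4 q.1.1.1 q.1.1.2 q.1.2 q.2).
Let H3 h (p : R * R * R) : R := \int[mu]_d H4 h (p, d).
Let H2 h (p : R * R) : R := \int[mu]_c H3 h (p, c).
Let H1 h (a : R) : R := \int[mu]_b H2 h (a, b).

Let H4c h : cont_supp h -> continuous (H4 h).
Proof.
move=> [ch _] q.
exact: (cvg_comp _ h (row4_continuous (x:=q)) (ch (row4 q.1.1.1 q.1.1.2 q.1.2 q.2))).
Qed.

Let H4s h p t : cont_supp h -> N < `|t| -> H4 h (p, t) = 0.
Proof. by move=> [_ hs] Nt; apply: (hs _ (inord 3)); rewrite mxE inordK. Qed.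

Let H3c h : cont_supp h -> continuous (H3 h).
Proof.
move=> hc; apply: (@Rintegral_param_continuous _ N (H4 h)); first exact: H4c.
by move=> z t; exact: H4s.
Qed.

Let H3s h p t : cont_supp h -> N < `|t| -> H3 h (p, t) = 0.
Proof.
move=> [_ hs] Nt; rewrite /H3 [X in Rintegral _ _ X](_ : _ = fun=> 0).
  by rewrite Rintegral_cst// mul0r.
by apply/funext => d; apply: (hs _ (inord 2)); rewrite mxE inordK.
Qed.

Let H2c h : cont_supp h -> continuous (H2 h).
Proof.
move=> hc; apply: (@Rintegral_param_continuous _ N (H3 h)); first exact: H3c.
by move=> z t; exact: H3s.
Qed.

Let H2s h p t : cont_supp h -> N < `|t| -> H2 h (p, t) = 0.
Proof.
move=> [_ hs] Nt; rewrite /H2 [X in Rintegral _ _ X](_ : _ = fun=> 0).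
  by rewrite Rintegral_cst// mul0r.
apply/funext => c; rewrite /H3 [X in Rintegral _ _ X](_ : _ = fun=> 0).
  by rewrite Rintegral_cst// mul0r.
by apply/funext => d; apply: (hs _ (inord 1)); rewrite mxE inordK.
Qed.

Let H1c h : cont_supp h -> continuous (H1 h).
Proof.
move=> hc; apply: (@Rintegral_param_continuous _ N (H2 h)); first exact: H2c.
by move=> z t; exact: H2s.
Qed.

Let H1s h t : cont_supp h -> N < `|t| -> H1 h t = 0.
Proof.
move=> [_ hs] Nt; rewrite /H1 [X in Rintegral _ _ X](_ : _ = fun=> 0).
  by rewrite Rintegral_cst// mul0r.
apply/funext => b; rewrite /H2 [X in Rintegral _ _ X](_ : _ = fun=> 0).
  by rewrite Rintegral_cst// mul0r.
apply/funext => c; rewrite /H3 [X in Rintegral _ _ X](_ : _ = fun=> 0).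
  by rewrite Rintegral_cst// mul0r.
by apply/funext => d; apply: (hs _ (inord 0)); rewrite mxE inordK.
Qed.

Let slice (T : topologicalType) (h : T * R -> R) z :
  continuous h -> continuous (fun t => h (z, t)).
Proof.
move=> ch t; have cp : (fun s : R => (z, s)) @ t --> (z, t).
  apply: (@cvg_pair _ _ _ (nbhs t) (nbhs z) (nbhs t)); first exact: cvg_cst.
  exact: cvg_id.
exact: (cvg_comp _ h cp (ch (z, t))).
Qed.

Lemma integral4_linear (k : R) (f g : 'rV[R]_4 -> R) : cont_supp f -> cont_supp g ->
  integral4 (fun y => k * f y + g y) = k * integral4 f + integral4 g.
Proof.
move=> cf cg.
have E3 : H3 (fun y => k * f y + g y) = fun p => k * H3 f p + H3 g p.
  apply/funext => p; apply: (@Rintegral_linear N k (fun d => H4 f (p, d)) (fun d => H4 g (p, d))).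
  - exact/slice/H4c.
  - exact/slice/H4c.
  - by move=> t; exact: H4s.
  - by move=> t; exact: H4s.
have E2 : H2 (fun y => k * f y + g y) = fun p => k * H2 f p + H2 g p.
  apply/funext => p; rewrite /H2 E3.
  apply: (@Rintegral_linear N k (fun d => H3 f (p, d)) (fun d => H3 g (p, d))).
  - exact/slice/H3c.
  - exact/slice/H3c.
  - by move=> t; exact: H3s.
  - by move=> t; exact: H3s.
have E1 : H1 (fun y => k * f y + g y) = fun p => k * H1 f p + H1 g p.
  apply/funext => p; rewrite /H1 E2.
  apply: (@Rintegral_linear N k (fun d => H2 f (p, d)) (fun d => H2 g (p, d))).
  - exact/slice/H2c.
  - exact/slice/H2c.
  - by move=> t; exact: H2s.
  - by move=> t; exact: H2s.
have -> : integral4 (fun y => k * f y + g y) = \int[mu]_a H1 (fun y => k * f y + g y) a by [].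
rewrite E1; apply: (@Rintegral_linear N k (H1 f) (H1 g)).
- exact: H1c.
- exact: H1c.
- by move=> t; exact: H1s.
- by move=> t; exact: H1s.
Qed.

(** Strict positivity survives each integration: every partial integral is positive at the remaining
    coordinates of [y]. *)
Lemma integral4_gt0 (f : 'rV[R]_4 -> R) y : cont_supp f ->
  (forall z, 0 <= f z) -> 0 < f y -> 0 < integral4 f.
Proof.
move=> cf f0 fy.
have yE : y = row4 (y 0 0) (y 0 1) (y 0 2) (y 0 3).
  apply/rowP => j; rewrite mxE.
  by case: j => -[|[|[|[|]]]] //= j4; congr (y 0 _); apply: val_inj.
have P3 : 0 < H3 f (y 0 0, y 0 1, y 0 2).
  apply: (@Rintegral_continuous_gt0 N (fun d => H4 f (y 0 0, y 0 1, y 0 2, d)) (y 0 3)).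
  - exact/slice/H4c.
  - by move=> t; exact: H4s.
  - by move=> t; exact: f0.
  - by rewrite /H4 /= -yE.
have P2 : 0 < H2 f (y 0 0, y 0 1).
  apply: (@Rintegral_continuous_gt0 N (fun c => H3 f (y 0 0, y 0 1, c)) (y 0 2)); last exact: P3.
  - exact/slice/H3c.
  - by move=> t; exact: H3s.
  - by move=> t; apply: Rintegral_ge0 => ? _; exact: f0.
have P1 : 0 < H1 f (y 0 0).
  apply: (@Rintegral_continuous_gt0 N (fun b => H2 f (y 0 0, b)) (y 0 1)); last exact: P2.
  - exact/slice/H2c.
  - by move=> t; exact: H2s.
  - by move=> t; apply: Rintegral_ge0 => ? _; apply: Rintegral_ge0 => ? _; exact: f0.
have -> : integral4 f = \int[mu]_a H1 f a by [].
apply: (@Rintegral_continuous_gt0 N (H1 f) (y 0 0)).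
- exact: H1c.
- by move=> t; exact: H1s.
- move=> t; apply: Rintegral_ge0 => ? _; apply: Rintegral_ge0 => ? _.
  by apply: Rintegral_ge0 => ? _; exact: f0.
- exact: P1.
Qed.

End Integral4.
End IteratedIntegral.

(** * The pointwise symbol *)

Section DualTwoForm.
Variable R : realType.
Implicit Types a b G : 'M[R]_4.

(* [wedge a b] is the sum of the [a i j * dual2 b i j] with [i < j]. *)
Definition dual2 b : 'M[R]_4 := \matrix_(i, j)
  nth 0 (nth [::] [:: [:: 0; b 2 3; - b 1 3; b 1 2];
                      [:: - b 2 3; 0; b 0 3; - b 0 2];
                      [:: b 1 3; - b 0 3; 0; b 0 1];
                      [:: - b 1 2; b 0 2; - b 0 1; 0]] i) j.

Lemma skewE n (b : 'M[R]_n) i j : skew b -> b i j = - b j i.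
Proof. by move=> sb; move/matrixP/(_ j i) : sb; rewrite !mxE. Qed.

Lemma skew_diag n (b : 'M[R]_n) i : skew b -> b i i = 0.
Proof. by move=> /(@skewE _ b i i)/eqP; rewrite -addr_eq0 -mulr2n mulrn_eq0/= => /eqP. Qed.

Lemma ord4 (i : 'I_4) : [\/ i = 0, i = 1, i = 2 | i = 3].
Proof.
case: i => -[|[|[|[|]]]] // i4; [apply: Or41|apply: Or42|apply: Or43|apply: Or44];
exact: val_inj.
Qed.

Lemma ord3 (i : 'I_3) : [\/ i = 0, i = 1 | i = 2].
Proof.
by case: i => -[|[|[|]]] // i3; [apply: Or31|apply: Or32|apply: Or33]; exact: val_inj.
Qed.

Lemma sum4 (f : 'I_4 -> R) : \sum_i f i = f 0 + f 1 + f 2 + f 3.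
Proof.
rewrite !big_ord_recr big_ord0 /= add0r.
by congr (f _ + f _ + f _ + f _); exact: val_inj.
Qed.

Lemma sum3 (f : 'I_3 -> R) : \sum_i f i = f 0 + f 1 + f 2.
Proof.
rewrite !big_ord_recr big_ord0 /= add0r.
by congr (f _ + f _ + f _); exact: val_inj.
Qed.

Lemma wedge_delta i j b : skew b ->
  wedge (delta_mx i j - delta_mx j i) b = dual2 b i j.
Proof.
by move=> sb; case: (ord4 i) => ->; case: (ord4 j) => ->;
  rewrite /wedge !mxE /=; ring.
Qed.

Lemma wedgeC a b : wedge a b = wedge b a.
Proof. rewrite /wedge; ring. Qed.

(** Polarisation of [a (dual2 a) = - Pf(a) 1], since [wedge a a] is twice the Pfaffian of [a]. *)
Lemma mul_dual2 a b : skew a -> skew b ->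
  a *m dual2 b + b *m dual2 a = - wedge a b *: 1%:M.
Proof.
move=> sa sb; apply/matrixP => i j; rewrite !mxE !sum4 !mxE /wedge.
by case: (ord4 i) => ->; case: (ord4 j) => ->; rewrite /= ?(skew_diag _ sa) ?(skew_diag _ sb)
  ?(skewE 1 0 sa) ?(skewE 2 0 sa) ?(skewE 3 0 sa) ?(skewE 2 1 sa) ?(skewE 3 1 sa) ?(skewE 3 2 sa)
  ?(skewE 1 0 sb) ?(skewE 2 0 sb) ?(skewE 3 0 sb) ?(skewE 2 1 sb) ?(skewE 3 1 sb) ?(skewE 3 2 sb);
  ring.
Qed.

(** Testing self-duality against the forms dx^i /\ dx^j reads off [dual2 b] entry by entry. The two
    halves of the skew test form contribute equally, which absorbs the factor [2^-1] of [ip2]. *)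
Lemma self_dual_dual2 G v b : G^T = G -> skew b -> self_dual G v b ->
  dual2 b = v *: (invmx G *m b *m invmx G).
Proof.
move=> sG sb sd; have sK : (invmx G)^T = invmx G by rewrite trmx_inv sG.
apply/matrixP => i j; rewrite -wedge_delta// sd; last first.
  by rewrite /skew linearB/= !trmx_delta opprB.
rewrite /ip2 [RHS]mxE; congr (_ * _).
set M := invmx G *m b *m invmx G.
have sM : skew M by rewrite /skew /M !trmx_mul sK sb mulNmx mulmxN mulmxA.
have MT : invmx G *m b^T *m invmx G = - M by rewrite sb mulmxN mulNmx.
rewrite mulmxBr !mulmxBl linearB/=.
have E k l : \tr (invmx G *m delta_mx k l *m invmx G *m b^T) = M k l.
  rewrite -!mulmxA mxtrace_mulC -!mulmxA [invmx G *m (b^T *m _)]mulmxA MT mulmxN linearN/=.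
  rewrite /mxtrace (bigD1 k)//= big1 ?addr0; last first.
    move=> m mk; rewrite mxE big1// => p _; rewrite mxE.
    by rewrite (negbTE mk) mul0r.
  rewrite mxE (bigD1 l)//= big1 ?addr0; last by move=> m ml; rewrite mxE (negbTE ml) andbF mul0r.
  by rewrite mxE !eqxx mul1r -(skewE _ _ sM).
by rewrite !E (skewE j i sM) opprK; field.
Qed.

(** Substitute [dual2 b = v K b K], with [K = invmx G], into [mul_dual2], divide by [v] and multiply
    by [G] on the right. *)
Lemma clifford G v a b : G^T = G -> G \in unitmx -> v != 0 -> skew a -> skew b ->
  self_dual G v a -> self_dual G v b ->
  a *m invmx G *m b + b *m invmx G *m a = - (wedge a b / v) *: G.
Proof.
move=> sG uG v0 sa sb da db.
have := mul_dual2 sa sb.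
rewrite (self_dual_dual2 sG sa da) (self_dual_dual2 sG sb db) -!scalemxAr -scalerDr.
move=> /(congr1 (fun M => v^-1 *: M *m G)); rewrite scalerA mulVf// scale1r.
rewrite mulmxDl -!mulmxA mulVmx// !mulmx1 => ->.
by rewrite scalerA -scalemxAl mul1mx mulrC mulNr.
Qed.

End DualTwoForm.

Section Skew3.
Variable R : realType.

(** If [C] is the matrix of the cross product with [c], this is the identity (c x w) x (c x q) = (c
    . (w x q)) c. It exhibits a skew matrix of size 3 as decomposable. *)
Lemma skew3_rank1 (C : 'M[R]_3) (w q : 'cV[R]_3) : skew C ->
  (C *m w) *m (C *m q)^T - (C *m q) *m (C *m w)^T = - (q^T *m (C *m w)) 0 0 *: C.
Proof.
move=> sC; apply/matrixP => i j; rewrite !mxE !big_ord1 !sum3 !mxE !sum3.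
by case: (ord3 i) => ->; case: (ord3 j) => ->; rewrite ?(skew_diag _ sC)
  ?(skewE 1 0 sC) ?(skewE 2 0 sC) ?(skewE 2 1 sC); ring.
Qed.

End Skew3.

Lemma posdef_unitmx (R : realType) n (G : 'M[R]_n) :
  (forall u : 'cV[R]_n, u != 0 -> 0 < (u^T *m G *m u) 0 0) -> G \in unitmx.
Proof.
move=> G_pos; rewrite -row_free_unit -kermx_eq0; apply/eqP/row_matrixP => i; rewrite row0.
apply/eqP/negPn/negP => r0; set r := row i _ in r0.
have rG : r *m G = 0 by rewrite /r -row_mul mulmx_ker row0.
have := G_pos r^T; rewrite trmxK rG mul0mx mxE ltxx.
by rewrite -trmx0 (inj_eq trmx_inj) => /(_ r0).
Qed.

(** * Bijectivity of the symbol at one point *)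

Section SymbolAlgebra.
Variable R : realType.
Variables (F : 'I_3 -> 'M[R]_4) (G : 'M[R]_4) (v : R).
Hypothesis F_skew : forall k, skew (F k).
Hypothesis G_sym : G^T = G.
Hypothesis G_pos : forall u : 'cV[R]_4, u != 0 -> 0 < (u^T *m G *m u) 0 0.
Hypothesis v_neq0 : v != 0.
Hypothesis v_def : v = 3^-1 * \sum_k wedge (F k) (F k).
Hypothesis F_sd : forall k, self_dual G v (F k).

Let K := invmx G.
(** With [F] the forms [Fcomp A x] and [v] equal to [mu A x], [iotaW] and [gramW] are convertible to
    [iotaF] and [Q]; this isolates the algebra at one point from the geometry. *)
Definition iotaW (u : 'cV[R]_4) : 'M[R]_(3, 4) := \matrix_(k, j) (u^T *m F k) 0 j.
Definition gramW : 'M[R]_3 := \matrix_(k, l) (wedge (F k) (F l) / v).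
Hypothesis F_def : forall u w : 'cV[R]_4, \rank (row_mx u w) = 2%N -> iotaW u *m w != 0.
Let Q := gramW.

Let G_unit : G \in unitmx. Proof. exact: posdef_unitmx. Qed.

Let K_sym : K^T = K. Proof. by rewrite /K trmx_inv G_sym. Qed.

Let K_pos (y : 'rV[R]_4) : y != 0 -> 0 < (y *m K *m y^T) 0 0.
Proof.
move=> y0; have := G_pos (u := K *m y^T).
rewrite trmx_mul trmxK K_sym -!mulmxA (mulmxA G) mulmxV// mul1mx !mulmxA; apply.
apply: contraNneq y0 => /(congr1 (mulmx G)); rewrite mulmxA mulmxV// mul1mx mulmx0.
by rewrite -trmx0 => /trmx_inj ->.
Qed.

Let Q_sym : Q^T = Q.
Proof. by apply/matrixP => i j; rewrite !mxE wedgeC. Qed.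

Let trQ : \tr Q = 3.
Proof.
rewrite /mxtrace (eq_bigr (fun k => v^-1 * wedge (F k) (F k))); last first.
  by move=> k _; rewrite mxE mulrC.
rewrite -mulr_sumr (_ : \sum_k _ = 3 * v); first by rewrite mulrCA mulVf ?mulr1.
by rewrite v_def mulrA mulfV// mul1r.
Qed.

Let cliff k l : F k *m K *m F l + F l *m K *m F k = - Q k l *: G.
Proof. by rewrite (clifford G_sym G_unit v_neq0 (F_skew k) (F_skew l) (F_sd k) (F_sd l)) /Q mxE. Qed.

Let iotaW_row u k : row k (iotaW u) = u^T *m F k.
Proof. by apply/rowP => j; rewrite !mxE; apply: eq_bigr => i _; rewrite !mxE. Qed.

Let iotaW_self u : iotaW u *m u = 0.
Proof.
apply/row_matrixP => k; rewrite row_mul iotaW_row row0; set M := _ *m u.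
have : M^T = - M by rewrite /M !trmx_mul trmxK F_skew mulNmx mulmxN mulmxA.
move=> /skew_diag M0; apply/rowP => j; rewrite (ord1 j) [RHS]mxE; exact: M0.
Qed.

(** Definiteness forbids a vector independent of [u] in the kernel of this 3 x 4 matrix; the kernel
    is at most a line, so the rank is 3. *)
Let iotaW_free u : u != 0 -> row_free (iotaW u).
Proof.
move=> u0; set e := iotaW u.
have ker : (kermx e^T <= u^T)%MS.
  apply/rV_subP => x; rewrite sub_kermx => /eqP xe; apply/negPn/negP => xu.
  have ex : e *m x^T = 0 by rewrite -[e]trmxK -trmx_mul xe trmx0.
  have := F_def (u := u) (w := x^T); rewrite -/e ex eqxx => H; suff /H : \rank (row_mx u x^T) = 2%N by [].
  rewrite -mxrank_tr tr_row_mx trmxK; apply/eqP; rewrite eqn_leq rank_leq_row/=.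
  have ru : \rank u^T = 1%N by rewrite rank_rV (_ : u^T != 0)// -trmx0 (inj_eq trmx_inj).
  have sub : (u^T <= col_mx u^T x)%MS by rewrite -addsmxE addsmxSl.
  have := mxrank_leqif_sup sub; rewrite ru => -[le1 eq1].
  rewrite ltn_neqAle le1 andbT eq1; apply: contra xu => /(submx_trans _); apply.
  by rewrite -addsmxE addsmxSr.
have := mxrankS ker; rewrite mxrank_ker mxrank_tr rank_rV => H.
rewrite /row_free eqn_leq rank_leq_row/=.
by move: H; case: (u^T != 0) => /=; rewrite leq_subLR ?addn1 ?addn0 //; exact: ltnW.
Qed.

Section Covector.
Variable n : 'cV[R]_4.
Hypothesis n_neq0 : n != 0.
Let e := iotaW n.
Let g := (n^T *m G *m n) 0 0.

Let g_gt0 : 0 < g. Proof. exact: G_pos. Qed.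

(** By skewness of the forms the entries are [- n^T F_i K F_j n], whose symmetrisation is given by
    the Clifford relation. The matrix is symmetric, so each entry is half of its symmetrisation. *)
Let eKe : e *m K *m e^T = (g / 2) *: Q.
Proof.
apply/matrixP => l m.
have M_ij i j : (e *m K *m e^T) i j = - (n^T *m (F i *m K *m F j) *m n) 0 0.
  have -> : (e *m K *m e^T) i j = (row i e *m K *m (row j e)^T) 0 0.
    by rewrite -row_mul [LHS]mxE [RHS]mxE; apply: eq_bigr => k _; rewrite !mxE.
  by rewrite /e !iotaW_row trmx_mul trmxK F_skew mulNmx mulmxN [LHS]mxE !mulmxA.
have sM : (e *m K *m e^T)^T = e *m K *m e^T by rewrite !trmx_mul trmxK K_sym mulmxA.
have E : (e *m K *m e^T) l m + (e *m K *m e^T) m l = g * Q l m.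
  rewrite !M_ij -opprD.
  have -> : (n^T *m (F l *m K *m F m) *m n) 0 0 + (n^T *m (F m *m K *m F l) *m n) 0 0 =
            (n^T *m (F l *m K *m F m + F m *m K *m F l) *m n) 0 0.
    by rewrite mulmxDr mulmxDl [RHS]mxE.
  by rewrite cliff -scalemxAr -scalemxAl mxE mulNr opprK mulrC.
have E2 : (e *m K *m e^T) m l = (e *m K *m e^T) l m by rewrite -[in LHS]sM mxE.
rewrite E2 in E; rewrite [RHS]mxE; lra.
Qed.

(** [Q] is a positive multiple of [e K e^T]; positivity of the inverse metric passes to it because
    [e] has rank 3. *)
Let Q_pos (x : 'rV[R]_3) : x != 0 -> 0 < (x *m Q *m x^T) 0 0.
Proof.
move=> x0; have xe : x *m e != 0.
  by apply: contraNneq x0 => /eqP; rewrite mulmx_free_eq0 ?iotaW_free// => /eqP ->.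
have := K_pos xe; rewrite trmx_mul -!mulmxA (mulmxA K) (mulmxA e) (mulmxA e) eKe.
by rewrite -scalemxAl -scalemxAr mxE pmulr_rgt0 ?divr_gt0 ?g_gt0// mulmxA.
Qed.

Let Fcomb (a : 'cV[R]_3) : 'M[R]_4 := \sum_k a k 0 *: F k.

Let FcombE a b : Fcomb a *m K *m Fcomb b = \sum_k \sum_l (a k 0 * b l 0) *: (F k *m K *m F l).
Proof.
rewrite /Fcomb !mulmx_suml; apply: eq_bigr => k _; rewrite mulmx_sumr.
by apply: eq_bigr => l _; rewrite -!scalemxAl -scalemxAr scalerA.
Qed.

Let Fcomb_cliff a b : Fcomb a *m K *m Fcomb b + Fcomb b *m K *m Fcomb a = - (a^T *m Q *m b) 0 0 *: G.
Proof.
rewrite !FcombE [X in _ + X]exchange_big/= -big_split/=.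
have -> : (a^T *m Q *m b) 0 0 = \sum_k \sum_l a k 0 * b l 0 * Q k l.
  rewrite mxE exchange_big/=; apply: eq_bigr => l _; rewrite mxE mulr_suml.
  by apply: eq_bigr => k _; rewrite !mxE; ring.
rewrite -sumrN scaler_suml; apply: eq_bigr => k _.
rewrite -big_split/= -sumrN scaler_suml; apply: eq_bigr => l _.
by rewrite [b l 0 * _]mulrC -scalerDr cliff scalerA mulrN.
Qed.

(** [F_a K F_a] is [- Q(a, a) / 2] times the invertible matrix [G], so [F_a] has no left kernel. *)
Let Fcomb_inj a (y : 'rV[R]_4) : a != 0 -> y *m Fcomb a = 0 -> y = 0.
Proof.
move=> a0 ya; have := Fcomb_cliff a a => /(congr1 (mulmx y)).
rewrite mulmxDr !mulmxA ya !mul0mx addr0 -scalemxAr => /esym/eqP.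
rewrite scaler_eq0 oppr_eq0 => /orP[|/eqP yG].
  have := Q_pos (x := a^T); rewrite trmxK => /(_ _)/lt0r_neq0/negbTE -> //.
  by rewrite -trmx0 (inj_eq trmx_inj).
by rewrite -[y]mulmx1 -(mulmxV G_unit) mulmxA yG mul0mx.
Qed.

(* A nonzero skew [C] is, up to a scalar, [a b^T - b a^T] with [a], [b]
   orthogonal for [Q]; then [F_a] and [F_b] anticommute and are injective. *)
Let skew_ann (C : 'M[R]_3) : skew C ->
  n^T *m (\sum_k \sum_l C k l *: (F l *m K *m F k)) = 0 -> C = 0.
Proof.
move=> sC nC; apply/eqP/negPn/negP => C0.
have /existsP[w w0] : [exists j : 'I_3, C *m (delta_mx j 0 : 'cV[R]_3) != 0].
  apply: contraR C0; rewrite negb_exists => /forallP H; apply/eqP/matrixP => i j.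
  have := H j; rewrite negbK => /eqP/matrixP/(_ i 0); rewrite -colE !mxE.
  by [].
(* [a] is a nonzero column of [C]. Taking [b = C Q a] makes the two [Q]-orthogonal, since
   [(Q a)^T C (Q a) = 0] by skewness, and [skew3_rank1] gives [a b^T - b a^T = - s C] with
   [s = a^T Q a > 0]. *)
set a := C *m _ in w0; pose q := Q *m a; pose b := C *m q.
have := skew3_rank1 (delta_mx w 0) q sC; rewrite -/a -/b => E.
pose s := (q^T *m a) 0 0.
have qT : q^T = a^T *m Q by rewrite /q trmx_mul Q_sym.
have bE : b = C *m q by [].
clearbody b q; clearbody a; have s_gt0 : 0 < s.
  have := Q_pos (x := a^T); rewrite trmxK /s qT; apply.
  by rewrite -trmx0 (inj_eq trmx_inj).
have ab : (a^T *m Q *m b) 0 0 = 0.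
  rewrite -qT bE mulmxA; apply: (@skew_diag _ _ (q^T *m C *m q) 0).
  by rewrite /skew !trmx_mul trmxK sC mulNmx mulmxN mulmxA.
have b0 : b != 0.
  apply: contraNneq C0 => b0; move: E; rewrite b0 trmx0 mulmx0 mul0mx subr0 => /esym/eqP.
  by rewrite scaler_eq0 oppr_eq0 -/s (gt_eqF s_gt0).
have FE : \sum_k \sum_l (- s *: C) k l *: (F l *m K *m F k) =
    Fcomb b *m K *m Fcomb a - Fcomb a *m K *m Fcomb b.
  have FcombE' c d : Fcomb c *m K *m Fcomb d = \sum_k \sum_l (c l 0 * d k 0) *: (F l *m K *m F k).
    by rewrite FcombE exchange_big.
  rewrite -E !FcombE'.
  rewrite -sumrB; apply: eq_bigr => k _.
  rewrite -sumrB; apply: eq_bigr => l _.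
  by rewrite -scalerBl; congr (_ *: _); rewrite !mxE !big_ord1 !mxE; ring.
(* By anticommutation [F_b K F_a - F_a K F_b] is twice [F_b K F_a]. Cancelling [F_a], [K] and [F_b]
   in turn then forces [n = 0]. *)
have : n^T *m (Fcomb b *m K *m Fcomb a) = 0.
  have := Fcomb_cliff a b; rewrite ab oppr0 scale0r => /eqP; rewrite addr_eq0 => /eqP anti.
  move: FE; rewrite anti opprK -mulr2n => /(congr1 (mulmx n^T)).
  under eq_bigr do (under eq_bigr do rewrite mxE -scalerA; rewrite -scaler_sumr).
  rewrite -scaler_sumr -scalemxAr nC scaler0 => /esym/eqP.
  by rewrite mulr2n mulmxDr -mulr2n -scaler_nat scaler_eq0 pnatr_eq0/= => /eqP.
rewrite !mulmxA => /(Fcomb_inj w0)/(congr1 (mulmx^~ G)).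
rewrite -mulmxA mulVmx// mulmx1 mul0mx => /(Fcomb_inj b0)/eqP.
by rewrite -trmx0 (inj_eq trmx_inj) (negbTE n_neq0).
Qed.

Definition symP (w : 'M[R]_(3, 4)) : 'M[R]_3 := w *m K *m e^T.

(** Differentiating [W / (tr W / 3)] in the direction [P + P^T], up to the common factor [mu],
    subtracts [tr (P + P^T) / 3] times [Q], and [tr (P + P^T) = 2 tr P]; hence [2 / 3]. As
    [tr Q = 3], the result is trace-free for every [w], which the dimension count on all of Hom
    (R^4, R^3) uses. *)
Definition symQ (w : 'M[R]_(3, 4)) : 'M[R]_3 :=
  symP w + (symP w)^T - (2 / 3 * \tr (symP w)) *: Q.

(** The rows of [e] annihilate [n] and have rank 3, so they span all covectors annihilating [n]. *)
Let sub_e (w : 'M[R]_(3, 4)) : w *m n = 0 -> exists B, w = B *m e.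
Proof.
move=> wn; apply/submxP.
have ee : (e <= kermx n)%MS by rewrite sub_kermx; apply/eqP; exact: iotaW_self.
have := mxrank_leqif_sup ee; rewrite mxrank_ker (eqP (iotaW_free n_neq0)).
have -> : \rank n = 1%N.
  by rewrite -mxrank_tr rank_rV (_ : n^T != 0)// -trmx0 (inj_eq trmx_inj).
move=> [_ /=]; rewrite eqxx => /esym ke; apply: submx_trans ke.
by rewrite sub_kermx wn.
Qed.

Lemma symbol_inj (w : 'M[R]_(3, 4)) :
  (forall u, \tr (w *m K *m (iotaW u)^T) = 0) -> w *m n = 0 -> symQ w = 0 -> w = 0.
Proof.
move=> wV wn; have [B wB] := sub_e wn.
have PB : symP w = (g / 2) *: (B *m Q).
  by rewrite /symP wB -!mulmxA (mulmxA e) eKe -scalemxAr.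
(* This trace is the inner product of [w] with [S(n)], so the trace part of the symbol disappears on
   [V_A]. *)
have tr0 : \tr (symP w) = 0 by exact: wV.
have g20 : g / 2 != 0 by rewrite gt_eqF// divr_gt0.
have trBQ : \tr (B *m Q) = 0.
  move: tr0; rewrite PB linearZ/= => /eqP.
  by rewrite mulf_eq0 (negbTE g20) => /eqP.
(* Orthogonality to [S] of each basis vector, read as a single covector equation. *)
have Y0 : n^T *m (\sum_k \sum_l B k l *: (F l *m K *m F k)) = 0.
  apply/rowP => j; rewrite [RHS]mxE.
  have := wV (delta_mx j 0); rewrite wB => /eqP; rewrite -oppr_eq0 => /eqP <-.
  rewrite mulmx_sumr summxE /mxtrace -sumrN; apply: eq_bigr => k _.
  have -> : (B *m e *m K *m (iotaW (delta_mx j 0))^T) k k =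
      (row k B *m e *m K *m (row k (iotaW (delta_mx j 0)))^T) 0 0.
    by rewrite -!row_mul [LHS]mxE 2![RHS]mxE; apply: eq_bigr => i _; rewrite !mxE.
  rewrite iotaW_row trmx_mul trmxK F_skew mulNmx mulmxN.
  rewrite [X in - X]mxE opprK mulmx_sumr.
  have -> : row k B *m e = \sum_l B k l *: (n^T *m F l).
    by rewrite mulmx_sum_row; apply: eq_bigr => l _; rewrite iotaW_row mxE.
  rewrite !mulmx_suml !summxE; apply: eq_bigr => l _.
  by rewrite -!scalemxAl -scalemxAr [LHS]mxE [RHS]mxE !mulmxA -colE [in RHS]mxE.
have BB : B^T = B.
  apply/esym/eqP; rewrite -subr_eq0; apply/eqP; apply: skew_ann.
    by rewrite /skew linearB/= trmxK opprB.
  (* The Clifford relations give [Y1 + Y2 = - tr (B Q) G = 0]. The skew coefficients [B - B^T] thus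
     produce [Y1 - Y2 = 2 Y1], which [n] annihilates by [Y0]. *)
  pose Y1 := \sum_k \sum_l B k l *: (F l *m K *m F k).
  pose Y2 := \sum_k \sum_l B k l *: (F k *m K *m F l).
  have Y12 : Y1 + Y2 = 0.
    rewrite /Y1 /Y2 -big_split/=.
    under eq_bigr => k _.
      rewrite -big_split/=.
      under eq_bigr do rewrite -scalerDr cliff scalerA.
      rewrite -scaler_suml; over.
    rewrite -scaler_suml.
    have -> : \sum_k \sum_l B k l * - Q l k = - \tr (B *m Q).
      rewrite /mxtrace -sumrN; apply: eq_bigr => k _; rewrite [in RHS]mxE -sumrN.
      by apply: eq_bigr => l _; rewrite mulrN.
    by rewrite trBQ oppr0 scale0r.
  have -> : \sum_k \sum_l (B - B^T) k l *: (F l *m K *m F k) = Y1 - Y2.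
    have -> : Y2 = \sum_k \sum_l B l k *: (F l *m K *m F k) by rewrite /Y2 exchange_big.
    rewrite -sumrB; apply: eq_bigr => k _; rewrite -sumrB.
    by apply: eq_bigr => l _; rewrite !mxE scalerBl.
  have -> : Y2 = - Y1 by apply/eqP; rewrite -addr_eq0 addrC Y12.
  by rewrite opprK mulmxDr Y0 addr0.
rewrite /symQ tr0 mulr0 scale0r subr0 PB => /eqP.
rewrite linearZ/= -scalerDr scaler_eq0 (negbTE g20)/= trmx_mul BB Q_sym => /eqP BQ.
have trBQB : \tr (B *m Q *m B) = 0.
  have := congr1 (fun M => \tr (M *m B)) BQ; rewrite /= mulmxDl mul0mx linearD/= raddf0.
  rewrite [X in _ + X]mxtrace_mulC mulmxA -mulr2n => /eqP.
  by rewrite mulrn_eq0/= => /eqP.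
suff B0 : B = 0 by rewrite wB B0 mul0mx.
apply/row_matrixP => k; rewrite row0; apply/eqP/negPn/negP => rk.
have pos (r : 'rV[R]_3) : 0 <= (r *m Q *m r^T) 0 0.
  by have [->|/Q_pos/ltW//] := eqVneq r 0; rewrite !mul0mx mxE.
have E : \tr (B *m Q *m B) = \sum_i (row i B *m Q *m (row i B)^T) 0 0.
  apply: eq_bigr => i _; rewrite -{2}BB -row_mul [LHS]mxE [RHS]mxE.
  by apply: eq_bigr => j _; rewrite !mxE.
have := Q_pos rk; rewrite lt_neqAle => /andP[/eqP + _]; apply; apply/esym.
by move: trBQB; rewrite E => /psumr_eq0P -> //.
Qed.

End Covector.

Lemma linear_inj_surj m k (T : 'M[R]_(m, k) -> 'M[R]_(m, k)) : linear T ->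
  (forall w, T w = 0 -> w = 0) -> forall t, exists w, T w = t.
Proof.
move=> Tlin Tinj t; pose TM := GRing.isLinear.Build _ _ _ _ _ Tlin.
pose L : {linear _ -> _} := HB.pack T TM.
have Tu : lin_mx L \in unitmx.
  rewrite -row_free_unit -kermx_eq0; apply/eqP/row_matrixP => i; rewrite row0.
  set r := row i _; have rL : r *m lin_mx L = 0 by rewrite /r -row_mul mulmx_ker row0.
  have : mxvec (T (vec_mx r)) = 0 by rewrite -[T]/(L : _ -> _) -mul_vec_lin vec_mxK.
  move=> /(congr1 vec_mx); rewrite mxvecK linear0 => /Tinj/(congr1 mxvec).
  by rewrite vec_mxK linear0.
exists (vec_mx (mxvec t *m invmx (lin_mx L))).
apply: (can_inj mxvecK); rewrite -[T]/(L : _ -> _) -mul_vec_lin vec_mxK.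
by rewrite -mulmxA mulVmx// mulmx1.
Qed.

Lemma symP_linear n : linear (symP n).
Proof. by move=> k x y; rewrite /symP !mulmxDl -!scalemxAl. Qed.

Lemma symQ_linear n : linear (symQ n).
Proof.
move=> k x y; rewrite /symQ symP_linear !linearD !linearZ/=.
by apply/matrixP => i j; rewrite !mxE; ring.
Qed.

Lemma symQ_sym n w : (symQ n w)^T = symQ n w.
Proof. by rewrite /symQ linearB linearD linearZ/= trmxK Q_sym [X in X - _]addrC. Qed.

Lemma tr_symQ n w : \tr (symQ n w) = 0.
Proof. rewrite /symQ linearB linearD linearZ/= mxtrace_tr trQ; lra. Qed.

Let vcoord (w : 'M[R]_(3, 4)) (j : 'I_4) : R :=
  \tr (w *m K *m (iotaW (delta_mx j 0))^T).

Let vcoordP w : (forall j, vcoord w j = 0) -> forall u, \tr (w *m K *m (iotaW u)^T) = 0.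
Proof.
move=> w0 u.
have -> : iotaW u = \sum_j u j 0 *: iotaW (delta_mx j 0).
  apply/matrixP => k j; rewrite !mxE summxE; apply: eq_bigr => i _.
  rewrite !mxE; congr (_ * _); rewrite (bigD1 i)//= big1 ?addr0 => [|l li].
    by rewrite !mxE !eqxx mul1r.
  by rewrite !mxE (negbTE li) mul0r.
rewrite linear_sum mulmx_sumr linear_sum big1// => j _.
by rewrite linearZ/= -scalemxAr linearZ/= -/(vcoord w j) w0 mulr0.
Qed.

(* The four equations defining [V_A], packed with the symbol into an
   endomorphism of the 12-dimensional space [Hom (R^4, R^3)]. *)
Let pack (c : 'I_4 -> R) : 'M[R]_3 := \matrix_(i, j)
  nth 0 (nth [::] [:: [:: c 0; c 1; c 2]; [:: - c 1; c 0; c 3]; [:: - c 2; - c 3; c 0]] i) j.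

Let packed n (w : 'M[R]_(3, 4)) : 'M[R]_(3, 3 + 1) :=
  row_mx (symQ n w + pack (vcoord w)) (w *m n).

Let packed_linear n : linear (packed n).
Proof.
move=> k x y; rewrite /packed symQ_linear mulmxDl -scalemxAl scale_row_mx add_row_mx.
have -> : pack (vcoord (k *: x + y)) = k *: pack (vcoord x) + pack (vcoord y).
  have vl j : vcoord (k *: x + y) j = k * vcoord x j + vcoord y j.
    by rewrite /vcoord !mulmxDl -!scalemxAl linearD linearZ.
  apply/matrixP => i j; rewrite !mxE.
  by case: (ord3 i) => ->; case: (ord3 j) => ->; rewrite /= !vl; ring.
by rewrite (scalerDr k (symQ n x)) addrACA.
Qed.

(** [pack c] is [c 0] times the identity plus a skew matrix with entries [c 1], [c 2], [c 3]. These
    are complementary to the symmetric trace-free matrices, so an equation in the packed block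
    splits into its two parts. *)
Let packed_eq n w S t : S^T = S -> \tr S = 0 -> packed n w = row_mx S t ->
  [/\ forall j, vcoord w j = 0, symQ n w = S & w *m n = t].
Proof.
move=> sS trS /eq_row_mx[E ->].
have sP : (pack (vcoord w))^T = pack (vcoord w).
  have -> : pack (vcoord w) = S - symQ n w by rewrite -E addrC addKr.
  by rewrite linearB/= sS symQ_sym.
have c0 : vcoord w 0 = 0.
  have := congr1 mxtrace E; rewrite linearD/= tr_symQ add0r trS /mxtrace sum3 !mxE/=.
  by lra.
have c1 : vcoord w 1 = 0 by move/matrixP/(_ 0 1): sP; rewrite !mxE /=; lra.
have c2 : vcoord w 2 = 0 by move/matrixP/(_ 0 2): sP; rewrite !mxE /=; lra.
have c3 : vcoord w 3 = 0 by move/matrixP/(_ 1 2): sP; rewrite !mxE /=; lra.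
have cw j : vcoord w j = 0 by case: (ord4 j) => ->.
split=> //; rewrite -E; have -> : pack (vcoord w) = 0; last by rewrite addr0.
apply/matrixP => i j; rewrite !mxE.
by case: (ord3 i) => ->; case: (ord3 j) => ->; rewrite /= cw ?oppr0.
Qed.

Lemma symbol_bij (xi : 'rV[R]_4) : xi != 0 ->
  set_bij [set w | forall u, ip1 G w (iotaW u) = 0]
    [set q : ('M[R]_3 * 'cV[R]_3)%type | q.1^T = q.1 /\ \tr q.1 = 0]
    (fun w => (symQ (invmx G *m xi^T) w, - (w *m (invmx G *m xi^T)))).
Proof.
move=> xi0; set n := invmx G *m xi^T.
have n0 : n != 0.
  apply: contraNneq xi0 => /(congr1 (mulmx G)); rewrite mulmxA mulmxV// mul1mx mulmx0.
  by rewrite -trmx0 => /trmx_inj ->.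
have inj w : (forall u, ip1 G w (iotaW u) = 0) -> symQ n w = 0 -> w *m n = 0 -> w = 0.
  by move=> wV Qw wn; exact: symbol_inj wV wn Qw.
split.
- by move=> w _ /=; rewrite symQ_sym tr_symQ.
- move=> w w' /[!inE]/= wV w'V [] Qww' /oppr_inj nww'.
  apply/eqP; rewrite -subr_eq0; apply/eqP.
  have E : w - w' = (-1) *: w' + w by rewrite scaleN1r addrC.
  apply: inj => [u||].
  + by rewrite /ip1 !mulmxBl linearB/= -/(ip1 _ _ _) wV -/(ip1 _ _ _) w'V subrr.
  + by rewrite E symQ_linear Qww' scaleN1r addNr.
  + by rewrite mulmxBl nww' subrr.
- move=> [S t] /= [sS trS].
  have [w w0|w wE] := @linear_inj_surj 3 4 (packed n) (@packed_linear n) _ (row_mx S (- t)).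
    have [|||cw Qw nw] := @packed_eq n w 0 0; rewrite ?trmx0 ?raddf0 ?row_mx0//.
    by apply: inj => //; exact: vcoordP.
  have [cw Qw nw] := packed_eq sS trS wE.
  exists w; first exact: vcoordP.
  by rewrite Qw nw opprK.
Qed.

End SymbolAlgebra.

(** * Calculus in charts *)

Section ManifoldCalculus.
Variables (R : realType) (X : manifold4 R).
Implicit Types (c d e : atlas X) (x : X) (f g : X -> R) (D : set X).

Lemma near_unchart c x (P : set X) : dom c x -> (\forall z \near x, P z) ->
  \forall y \near chart c x, P (unchart c y).
Proof.
move=> cx nP; have : {for chart c x, continuous (unchart c)}.
  by apply: unchart_continuous; exists x.
by rewrite /prop_for /continuous_at chartK// => /(_ _ nP).
Qed.

Lemma near_open D x : open D -> D x -> \forall z \near x, D z.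
Proof. by move=> oD Dx; exact: open_nbhs_nbhs. Qed.

Lemma chart_image_open c D : open D -> open (chart c @` (dom c `&` D)).
Proof.
move=> oD; rewrite openE => _ [x [cx Dx] <-]; rewrite /interior.
have A := near_unchart cx (near_open oD Dx).
have B : \forall y \near chart c x, (chart c @` dom c) y.
  by apply: open_nbhs_nbhs; split; [exact: chart_open|exists x].
apply: filterS2 A B => y Dy [z cz zy]; exists z => //; split=> //.
by move: Dy; rewrite -zy chartK.
Qed.

Lemma near_dom c x : dom c x -> \forall z \near x, dom c z.
Proof. by move=> cx; apply: near_open => //; exact: dom_open. Qed.

Section SmoothIn.
Variables (c : atlas X) (D : set X).
Hypothesis oD : open D.
Let U := chart c @` (dom c `&` D).
Let oU : open U. Proof. exact: chart_image_open. Qed.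

Lemma smooth_in_closure f : smooth_closure U (f \o unchart c) -> smooth_in c D f.
Proof. by move=> fs; exact: smooth_closureP. Qed.

Lemma smooth_in_ext f g : (forall x, dom c x -> D x -> f x = g x) ->
  smooth_in c D f -> smooth_in c D g.
Proof.
move=> fg; apply: smooth_on_ext => // _ [x [cx Dx] <-].
by rewrite /= chartK// fg.
Qed.

Lemma smooth_in_cst (r : R) : smooth_in c D (fun=> r).
Proof. exact: smooth_on_cst. Qed.

Lemma smooth_inD f g : smooth_in c D f -> smooth_in c D g ->
  smooth_in c D (fun x => f x + g x).
Proof.
move=> fs gs; apply: (@smooth_in_closure (fun x => f x + g x)).
exact: (SmoothClosureD (SmoothClosureBase fs) (SmoothClosureBase gs)).
Qed.

Lemma smooth_inM f g : smooth_in c D f -> smooth_in c D g ->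
  smooth_in c D (fun x => f x * g x).
Proof.
move=> fs gs; apply: (@smooth_in_closure (fun x => f x * g x)).
exact: (SmoothClosureM (SmoothClosureBase fs) (SmoothClosureBase gs)).
Qed.

Lemma smooth_inV f : (forall x, dom c x -> D x -> f x != 0) -> smooth_in c D f ->
  smooth_in c D (fun x => (f x)^-1).
Proof.
move=> f0 fs; apply: smooth_in_closure.
apply: (@SmoothClosureV _ _ (f \o unchart c)); first exact: SmoothClosureBase.
by move=> _ [x [cx Dx] <-]; rewrite /= chartK//; exact: f0.
Qed.

Lemma smooth_inN f : smooth_in c D f -> smooth_in c D (fun x => - f x).
Proof.
move=> fs; apply: (smooth_in_ext (f := fun x => -1 * f x)).
  by move=> x _ _; rewrite mulN1r.
by apply: smooth_inM; first exact: smooth_in_cst.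
Qed.

Lemma smooth_inB f g : smooth_in c D f -> smooth_in c D g ->
  smooth_in c D (fun x => f x - g x).
Proof. by move=> fs gs; apply: smooth_inD => //; exact: smooth_inN. Qed.

Lemma smooth_in_sum (I : Type) (r : seq I) (P : pred I) (F : I -> X -> R) :
  (forall i, smooth_in c D (F i)) -> smooth_in c D (fun x => \sum_(i <- r | P i) F i x).
Proof.
move=> Fs; elim: r => [|i r IH].
  by apply: (smooth_in_ext _ (smooth_in_cst 0)) => x _ _; rewrite big_nil.
apply: (smooth_in_ext (f := fun x => (if P i then F i x else 0) + \sum_(j <- r | P j) F j x)).
  by move=> x _ _; rewrite big_cons; case: ifP => // _; rewrite add0r.
by apply: smooth_inD; last exact: IH; case: (P i); [exact: Fs|exact: smooth_in_cst].
Qed.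

Lemma smooth_in_prod (I : Type) (r : seq I) (P : pred I) (F : I -> X -> R) :
  (forall i, smooth_in c D (F i)) -> smooth_in c D (fun x => \prod_(i <- r | P i) F i x).
Proof.
move=> Fs; elim: r => [|i r IH].
  by apply: (smooth_in_ext _ (smooth_in_cst 1)) => x _ _; rewrite big_nil.
apply: (smooth_in_ext (f := fun x => (if P i then F i x else 1) * \prod_(j <- r | P j) F j x)).
  by move=> x _ _; rewrite big_cons; case: ifP => // _; rewrite mul1r.
by apply: smooth_inM; last exact: IH; case: (P i); [exact: Fs|exact: smooth_in_cst].
Qed.

Lemma smooth_in_differentiable f x : smooth_in c D f -> dom c x -> D x ->
  differentiable (f \o unchart c) (chart c x).
Proof. by move=> fs cx Dx; apply: (smooth_on_differentiable oU fs); exists x. Qed.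

Lemma smooth_in_continuous f x : smooth_in c D f -> dom c x -> D x ->
  {for x, continuous f}.
Proof.
move=> fs cx Dx.
have cf : {for chart c x, continuous (f \o unchart c)}.
  by apply: (smooth_on_continuous fs); exists x.
apply: (@near_eq_continuous _ _ _ ((f \o unchart c) \o chart c)).
  by apply: filterS (near_dom cx) => z cz; rewrite /= chartK.
by apply: continuous_comp => //; exact: chart_continuous.
Qed.

Lemma smooth_in_pder i f : smooth_in c D f -> smooth_in c D (pder c i f).
Proof.
move=> fs; apply: (smooth_on_ext (f := partial i (f \o unchart c))) => //.
  by move=> _ [x [cx Dx] <-]; rewrite /pder /= chartK.
exact: smooth_on_partial.
Qed.

Lemma pderC i j f x : smooth_in c D f -> dom c x -> D x ->
  pder c i (pder c j f) x = pder c j (pder c i f) x.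
Proof.
move=> fs cx Dx; have Ux : U (chart c x) by exists x.
have E k l : pder c k (pder c l f) x = partial k (partial l (f \o unchart c)) (chart c x).
  apply: eq_partial; apply: (eq_on_near oU Ux) => _ [z [cz _] <-].
  by rewrite /pder /= chartK.
by rewrite !E; exact: partialC fs Ux.
Qed.

Lemma pderD i f g x : smooth_in c D f -> smooth_in c D g -> dom c x -> D x ->
  pder c i (fun z => f z + g z) x = pder c i f x + pder c i g x.
Proof.
move=> fs gs cx Dx; rewrite /pder /partial.
apply: (@deriveD _ _ _ (f \o unchart c) (g \o unchart c)); apply: diff_derivable;
  exact: smooth_in_differentiable.
Qed.

Lemma pderM i f g x : smooth_in c D f -> smooth_in c D g -> dom c x -> D x ->
  pder c i (fun z => f z * g z) x = f x * pder c i g x + g x * pder c i f x.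
Proof.
move=> fs gs cx Dx; rewrite /pder /partial.
rewrite (@deriveM _ _ (f \o unchart c) (g \o unchart c)) /= ?chartK//; apply: diff_derivable;
  exact: smooth_in_differentiable.
Qed.

End SmoothIn.

Lemma smooth_in_sub c D D' f : D' `<=` D -> smooth_in c D f -> smooth_in c D' f.
Proof.
move=> sub; apply: smooth_on_sub => _ [x [cx Dx] <-].
by exists x => //; split=> //; exact: sub.
Qed.

Lemma smooth_in_local c D f :
  (forall x, dom c x -> D x -> exists2 D', D' x & smooth_in c D' f) -> smooth_in c D f.
Proof.
move=> H s y [x [cx Dx] xy]; have [D' D'x fs] := H x cx Dx.
by apply: fs; exists x.
Qed.

Lemma eq_pder c i f g x : dom c x -> (\forall z \near x, f z = g z) ->
  pder c i f x = pder c i g x.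
Proof. by move=> cx fg; apply: eq_partial; exact: near_unchart fg. Qed.

Lemma pder_cst c i (r : R) x : pder c i (fun=> r) x = 0.
Proof. exact: derive_cst. Qed.

Lemma pder_sum c D i (I : Type) (r : seq I) (F : I -> X -> R) x : open D ->
  (forall k, smooth_in c D (F k)) -> dom c x -> D x ->
  pder c i (fun z => \sum_(k <- r) F k z) x = \sum_(k <- r) pder c i (F k) x.
Proof.
move=> oD Fs cx Dx; elim: r => [|k r IH].
  rewrite big_nil -[RHS](pder_cst c i 0 x); apply: eq_pder => //.
  by apply: nearW => z; rewrite big_nil.
rewrite big_cons -IH -(@pderD c D)//; last exact: smooth_in_sum.
by apply: eq_pder => //; apply: nearW => z; rewrite big_cons.
Qed.

Lemma chart_coord_smooth c d k : smooth_in c (dom d) (fun x => chart d x 0 k).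
Proof. exact: chart_smooth. Qed.

Lemma jacE c d x i j : jac c d x i j = pder c j (fun z => chart d z 0 i) x.
Proof. by rewrite mxE. Qed.

Lemma jac_smooth c d i j : smooth_in c (dom d) (fun x => jac c d x i j).
Proof.
have od := @dom_open _ X d.
apply: (smooth_in_ext od (f := pder c j (fun z => chart d z 0 i))).
  by move=> x _ _; rewrite jacE.
by apply: smooth_in_pder => //; exact: chart_coord_smooth.
Qed.

Lemma smooth_in_change c d D f : open D -> smooth_in c D f -> smooth_in d (D `&` dom c) f.
Proof.
move=> oD fs; have oDc : open (D `&` dom c) by apply: openI => //; exact: dom_open.
pose phi := chart c \o unchart d.
apply: (smooth_on_ext (f := fun y => (f \o unchart c) (phi y))).
- exact: chart_image_open.
- by move=> _ [x [dx [Dx cx]] <-]; rewrite /phi /= !chartK.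
apply: smooth_closureP; first exact: chart_image_open.
apply: (@SmoothClosureComp R _ _ (f \o unchart c) phi (chart_image_open (c := c) oD) fs).
  move=> k; apply: SmoothClosureBase.
  apply: (smooth_on_sub _ (@chart_coord_smooth d c k)) => _ [x [dx [Dx cx]] <-].
  by exists x.
by move=> _ [x [dx [Dx cx]] <-]; exists x => //; rewrite /phi /= chartK.
Qed.

Lemma pder_change c d D j f x : open D -> smooth_in c D f -> D x -> dom c x -> dom d x ->
  pder d j f x = \sum_i pder c i f x * jac d c x i j.
Proof.
move=> oD fs Dx cx dx; pose phi := chart c \o unchart d.
have phix : phi (chart d x) = chart c x by rewrite /phi /= chartK.
transitivity (partial j (fun y => (f \o unchart c) (phi y)) (chart d x)).
  apply: eq_partial; apply: (near_unchart dx (P := fun z => f z = f (unchart c (chart c z)))).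
  by apply: filterS (near_dom cx) => z cz; rewrite chartK.
rewrite (partial_comp (f := f \o unchart c)).
- by rewrite phix; apply: eq_bigr => i _; rewrite jacE.
- by rewrite phix; exact: (smooth_in_differentiable oD).
- by move=> k; exact: (smooth_in_differentiable (dom_open c) (@chart_coord_smooth d c k)).
Qed.

Lemma jac_comp c d e x : dom c x -> dom d x -> dom e x ->
  jac c e x = jac d e x *m jac c d x.
Proof.
move=> cx dx ex; apply/matrixP => i j; rewrite jacE mxE.
rewrite (pder_change j (dom_open e) (@chart_coord_smooth d e i) ex dx cx).
by apply: eq_bigr => k _; rewrite -jacE.
Qed.

Lemma jac_id c x : dom c x -> jac c c x = 1%:M.
Proof.
move=> cx; apply/matrixP => i j; rewrite jacE mxE /pder.
have -> : partial j ((fun z => chart c z 0 i) \o unchart c) (chart c x) =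
    partial j (fun y : 'rV[R]_4 => y 0 i) (chart c x).
  apply: eq_partial; have : \forall y \near chart c x, (chart c @` dom c) y.
    by apply: open_nbhs_nbhs; split; [exact: chart_open|exists x].
  by apply: filterS => _ [z cz <-]; rewrite /= chartK.
rewrite /partial deriveE; last exact: differentiable_coord.
have lin : linear (fun y : 'rV[R]_4 => y 0 i : R) by move=> k u v; rewrite !mxE.
pose LM := GRing.isLinear.Build _ _ _ _ _ lin.
pose L : {linear 'rV[R]_4 -> R} := HB.pack (fun y : 'rV[R]_4 => y 0 i : R) LM.
rewrite (@diff_lin _ _ _ L); last exact: coord_continuous.
by rewrite /L /= mxE eqxx.
Qed.

Lemma jac_inv c d x : dom c x -> dom d x -> jac d c x *m jac c d x = 1%:M.
Proof. by move=> cx dx; rewrite -jac_comp// jac_id. Qed.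

Section SmoothMatrix.
Variables (c : atlas X) (D : set X).
Hypothesis oD : open D.

Definition smooth_mx m n (M : X -> 'M[R]_(m, n)) :=
  forall k l, smooth_in c D (fun x => M x k l).

Lemma smooth_mx_ext m n (M N : X -> 'M[R]_(m, n)) :
  (forall x, dom c x -> D x -> M x = N x) -> smooth_mx M -> smooth_mx N.
Proof. by move=> MN Ms k l; apply: (smooth_in_ext oD _ (Ms k l)) => x cx Dx; rewrite MN. Qed.

Lemma smooth_mulmx m n p (M : X -> 'M[R]_(m, n)) (N : X -> 'M[R]_(n, p)) :
  smooth_mx M -> smooth_mx N -> smooth_mx (fun x => M x *m N x).
Proof.
move=> Ms Ns k l; apply: (smooth_in_ext oD (f := fun x => \sum_j M x k j * N x j l)).
  by move=> x _ _; rewrite mxE.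
by apply: smooth_in_sum => // j; exact: (smooth_inM oD (Ms k j) (Ns j l)).
Qed.

Lemma smooth_addmx m n (M N : X -> 'M[R]_(m, n)) :
  smooth_mx M -> smooth_mx N -> smooth_mx (fun x => M x + N x).
Proof.
move=> Ms Ns k l; apply: (smooth_in_ext oD (f := fun x => M x k l + N x k l)).
  by move=> x _ _; rewrite mxE.
exact: (smooth_inD oD (Ms k l) (Ns k l)).
Qed.

Lemma smooth_scalemx m n (f : X -> R) (N : X -> 'M[R]_(m, n)) :
  smooth_in c D f -> smooth_mx N -> smooth_mx (fun x => f x *: N x).
Proof.
move=> fs Ns k l; apply: (smooth_in_ext oD (f := fun x => f x * N x k l)).
  by move=> x _ _; rewrite mxE.
exact: (smooth_inM oD fs (Ns k l)).
Qed.

Lemma smooth_oppmx m n (N : X -> 'M[R]_(m, n)) : smooth_mx N -> smooth_mx (fun x => - N x).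
Proof.
move=> Ns; apply: (smooth_mx_ext (M := fun x => -1 *: N x)).
  by move=> x _ _; rewrite scaleN1r.
by apply: smooth_scalemx => //; exact: smooth_in_cst.
Qed.

Lemma smooth_submx m n (M N : X -> 'M[R]_(m, n)) :
  smooth_mx M -> smooth_mx N -> smooth_mx (fun x => M x - N x).
Proof. by move=> Ms Ns; exact: (smooth_addmx Ms (smooth_oppmx Ns)). Qed.

Lemma smooth_trmx m n (M : X -> 'M[R]_(m, n)) : smooth_mx M -> smooth_mx (fun x => (M x)^T).
Proof.
move=> Ms k l; apply: (smooth_in_ext oD (f := fun x => M x l k)) => //.
by move=> x _ _; rewrite mxE.
Qed.

Lemma smooth_det n (M : X -> 'M[R]_n) : smooth_mx M -> smooth_in c D (fun x => \det (M x)).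
Proof.
move=> Ms; apply: smooth_in_sum => // s; apply: smooth_inM => //; first exact: smooth_in_cst.
by apply: smooth_in_prod.
Qed.

Lemma smooth_invmx n (M : X -> 'M[R]_n) : smooth_mx M ->
  (forall x, dom c x -> D x -> M x \in unitmx) -> smooth_mx (fun x => invmx (M x)).
Proof.
move=> Ms uM; apply: (smooth_mx_ext (M := fun x => (\det (M x))^-1 *: \adj (M x))).
  by move=> x cx Dx; rewrite /invmx uM.
apply: smooth_scalemx.
  apply: smooth_inV => //; last exact: smooth_det.
  by move=> x cx Dx; have := uM x cx Dx; rewrite unitmxE unitfE.
move=> k l; apply: (smooth_in_ext oD (f := fun x => (-1) ^+ (l + k) * \det (row' l (col' k (M x))))).
  by move=> x _ _; rewrite mxE.
apply: smooth_inM => //; first exact: smooth_in_cst.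
apply: smooth_det => i j; apply: (smooth_in_ext oD _ (Ms (lift l i) (lift k j))).
by move=> x _ _; rewrite !mxE.
Qed.

Lemma smooth_pder_mx m n i (M : X -> 'M[R]_(m, n)) :
  smooth_mx M -> smooth_mx (pder_mx c i M).
Proof.
move=> Ms k l; apply: (smooth_in_ext oD (f := pder c i (fun z => M z k l))).
  by move=> x _ _; rewrite mxE.
exact: smooth_in_pder.
Qed.

Lemma pder_mulmx m n p i (M : X -> 'M[R]_(m, n)) (N : X -> 'M[R]_(n, p)) x :
  smooth_mx M -> smooth_mx N -> dom c x -> D x ->
  pder_mx c i (fun z => M z *m N z) x =
  pder_mx c i M x *m N x + M x *m pder_mx c i N x.
Proof.
move=> Ms Ns cx Dx; apply/matrixP => k l; rewrite !mxE.
transitivity (pder c i (fun z => \sum_j M z k j * N z j l) x).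
  by apply: eq_pder => //; apply: nearW => z; rewrite mxE.
rewrite (@pder_sum c D)//; last by move=> j; exact: smooth_inM.
rewrite -big_split/=; apply: eq_bigr => j _; rewrite !mxE.
by rewrite (@pderM c D)// addrC [N x j l * _]mulrC.
Qed.

Lemma pder_addmx m n i (M N : X -> 'M[R]_(m, n)) x :
  smooth_mx M -> smooth_mx N -> dom c x -> D x ->
  pder_mx c i (fun z => M z + N z) x = pder_mx c i M x + pder_mx c i N x.
Proof.
move=> Ms Ns cx Dx; apply/matrixP => k l; rewrite !mxE -(@pderD c D)//.
by apply: eq_pder => //; apply: nearW => z; rewrite mxE.
Qed.

Lemma pder_scalemx m n i f (N : X -> 'M[R]_(m, n)) x :
  smooth_in c D f -> smooth_mx N -> dom c x -> D x ->
  pder_mx c i (fun z => f z *: N z) x = f x *: pder_mx c i N x + pder c i f x *: N x.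
Proof.
move=> fs Ns cx Dx; apply/matrixP => k l; rewrite !mxE.
rewrite [pder c i f x * _]mulrC -(@pderM c D)//.
by apply: eq_pder => //; apply: nearW => z; rewrite mxE.
Qed.

End SmoothMatrix.

Lemma pder_cstmx c m n i (N : 'M[R]_(m, n)) x : pder_mx c i (fun=> N) x = 0.
Proof. by apply/matrixP => k l; rewrite !mxE pder_cst. Qed.

Lemma pder_trmx c m n i (M : X -> 'M[R]_(m, n)) x : dom c x ->
  pder_mx c i (fun z => (M z)^T) x = (pder_mx c i M x)^T.
Proof.
move=> cx; apply/matrixP => k l; rewrite !mxE.
by apply: eq_pder => //; apply: nearW => z; rewrite mxE.
Qed.

Lemma eq_pder_mx c m n i (M N : X -> 'M[R]_(m, n)) x : dom c x ->
  (\forall z \near x, M z = N z) -> pder_mx c i M x = pder_mx c i N x.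
Proof.
move=> cx MN; apply/matrixP => k l; rewrite !mxE; apply: eq_pder => //.
by apply: filterS MN => z ->.
Qed.

Lemma pder_mx_change c d D m n j (M : X -> 'M[R]_(m, n)) x : open D -> smooth_mx c D M ->
  D x -> dom c x -> dom d x ->
  pder_mx d j M x = \sum_i jac d c x i j *: pder_mx c i M x.
Proof.
move=> oD Ms Dx cx dx; apply/matrixP => k l.
rewrite mxE summxE (pder_change j oD (Ms k l))//.
by apply: eq_bigr => i _; rewrite !mxE mulrC.
Qed.

Lemma smooth_mx_change c d D m n (M : X -> 'M[R]_(m, n)) : open D -> smooth_mx c D M ->
  smooth_mx d (D `&` dom c) M.
Proof. by move=> oD Ms k l; exact: smooth_in_change. Qed.

Lemma smooth_mx_sub c D D' m n (M : X -> 'M[R]_(m, n)) : D' `<=` D -> smooth_mx c D M ->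
  smooth_mx c D' M.
Proof. by move=> sub Ms k l; exact: smooth_in_sub (Ms k l). Qed.

End ManifoldCalculus.

(** * Connections and gauge changes *)

Section MatrixEntries.
Variable R : realType.

Lemma addmxE m n (A B : 'M[R]_(m, n)) i j : (A + B) i j = A i j + B i j.
Proof. by rewrite mxE. Qed.

Lemma oppmxE m n (A : 'M[R]_(m, n)) i j : (- A) i j = - A i j.
Proof. by rewrite mxE. Qed.

Lemma scalemxE m n k (A : 'M[R]_(m, n)) i j : (k *: A) i j = k * A i j.
Proof. by rewrite mxE. Qed.

(* [a], [b] stand for the connection matrices A_i, A_j, [u], [w] for the first
   and [s] for the mixed second derivatives of the gauge transformation [g]. *)
Lemma gauge_curvature (g h a b u w s da db : 'M[R]_3) : h *m g = 1%:M ->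
  let hu := - (h *m u *m h) in let hw := - (h *m w *m h) in
  let Mi := g *m a *m h - u *m h in let Mj := g *m b *m h - w *m h in
  (u *m b *m h + g *m db *m h + g *m b *m hu - (s *m h + w *m hu))
  - (w *m a *m h + g *m da *m h + g *m a *m hw - (s *m h + u *m hw))
  + (Mi *m Mj - Mj *m Mi)
  = g *m (db - da + (a *m b - b *m a)) *m h.
Proof.
move=> hg hu hw Mi Mj.
have MM (a' b' u' w' : 'M[R]_3) :
    (g *m a' *m h - u' *m h) *m (g *m b' *m h - w' *m h) =
    g *m (a' *m b') *m h - g *m a' *m h *m w' *m h - u' *m b' *m h + u' *m h *m w' *m h.
  have E1 : g *m a' *m h *m (g *m b' *m h) = g *m (a' *m b') *m h.
    by rewrite -!mulmxA (mulmxA h g) hg mul1mx.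
  have E2 : u' *m h *m (g *m b' *m h) = u' *m b' *m h.
    by rewrite -!mulmxA (mulmxA h g) hg mul1mx.
  rewrite mulmxBr !mulmxBl E1 E2 !mulmxA.
  by apply/matrixP => k l; rewrite !(addmxE, oppmxE); ring.
rewrite /Mi /Mj !MM /hu /hw !mulmxN !mulmxA !(mulmxDr g) !mulmxDl !mulmxN !mulNmx !mulmxA.
by apply/matrixP => k l; rewrite !(addmxE, oppmxE); ring.
Qed.

Lemma det2E (m : 'M[R]_2) : \det m = m 0 0 * m 1 1 - m 0 1 * m 1 0.
Proof.
have l0 : lift (0 : 'I_2) (0 : 'I_1) = 1 by apply: val_inj.
have l1 : lift (1 : 'I_2) (0 : 'I_1) = 0 by apply: val_inj.
have o1 : lift ord0 (ord0 : 'I_1) = 1 :> 'I_2 by apply: val_inj.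
rewrite (expand_det_row _ 0) big_ord_recl big_ord1 /cofactor !det_mx11 !mxE.
rewrite ?o1 ?l0 ?l1 /= expr0 expr1 mul1r; ring.
Qed.

Lemma det3E (g : 'M[R]_3) : \det g =
  g 0 0 * (g 1 1 * g 2 2 - g 1 2 * g 2 1) - g 0 1 * (g 1 0 * g 2 2 - g 1 2 * g 2 0)
  + g 0 2 * (g 1 0 * g 2 1 - g 1 1 * g 2 0).
Proof.
have l00 : lift (0 : 'I_3) (0 : 'I_2) = 1 by apply: val_inj.
have l01 : lift (0 : 'I_3) (1 : 'I_2) = 2 by apply: val_inj.
have l10 : lift (1 : 'I_3) (0 : 'I_2) = 0 by apply: val_inj.
have l11 : lift (1 : 'I_3) (1 : 'I_2) = 2 by apply: val_inj.
have l20 : lift (2 : 'I_3) (0 : 'I_2) = 0 by apply: val_inj.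
have l21 : lift (2 : 'I_3) (1 : 'I_2) = 1 by apply: val_inj.
rewrite (expand_det_row _ 0) sum3 /cofactor !det2E !mxE.
rewrite ?l00 ?l01 ?l10 ?l11 ?l20 ?l21 /= expr0 expr1 expr2; ring.
Qed.

(** The right-hand side [C] is the cofactor matrix, so [g^T C = det g = 1], while [g] is the inverse
    of [g^T]. *)
Lemma so3_cofactor (g : 'M[R]_3) : g^T *m g = 1%:M -> \det g = 1 ->
  g = \matrix_(i, j) nth 0 (nth [::]
   [:: [:: g 1 1 * g 2 2 - g 1 2 * g 2 1; g 1 2 * g 2 0 - g 1 0 * g 2 2;
           g 1 0 * g 2 1 - g 1 1 * g 2 0];
       [:: g 2 1 * g 0 2 - g 2 2 * g 0 1; g 2 2 * g 0 0 - g 2 0 * g 0 2;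
           g 2 0 * g 0 1 - g 2 1 * g 0 0];
       [:: g 0 1 * g 1 2 - g 0 2 * g 1 1; g 0 2 * g 1 0 - g 0 0 * g 1 2;
           g 0 0 * g 1 1 - g 0 1 * g 1 0]] i) j.
Proof.
move=> gg dg; set C := \matrix_(i, j) _.
suff gC : g^T *m C = 1%:M by rewrite -[RHS]mul1mx -(mulmx1C gg) -mulmxA gC mulmx1.
apply/matrixP => i j; rewrite !mxE sum3 !mxE.
by case: (ord3 i) => ->; case: (ord3 j) => ->; rewrite /= -?dg ?det3E; ring.
Qed.

End MatrixEntries.

(** * The isometry between so(3) and R^3, and its equivariance under rotations *)

Section HatVee.
Variable R : realType.

Lemma hatK (u : 'cV[R]_3) : vee (hat u) = u.
Proof.
have s2 : Num.sqrt 2 != 0 :> R by rewrite sqrtr_eq0 -ltNge.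
by apply/colP => k; rewrite !mxE; case: (ord3 k) => ->; rewrite /= mulrA divff// mul1r;
  congr (u _ _); apply: val_inj.
Qed.

Lemma veeK (M : 'M[R]_3) : skew M -> hat (vee M) = M.
Proof.
move=> sM; have s2 : Num.sqrt 2 != 0 :> R by rewrite sqrtr_eq0 -ltNge.
apply/matrixP => i j; rewrite !mxE.
by case: (ord3 i) => ->; case: (ord3 j) => ->; rewrite /= ?(skew_diag _ sM) ?mulr0//
  ?mulrN mulrA mulVf// mul1r -?(skewE _ _ sM); congr (M _ _); apply: val_inj.
Qed.

Lemma hat_skew (u : 'cV[R]_3) : skew (hat u).
Proof.
apply/matrixP => i j; rewrite !mxE -mulrN; congr (_ * _).
by case: (ord3 i) => ->; case: (ord3 j) => ->; rewrite /= ?opprK ?oppr0//;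
 congr (- u _ _) || congr (u _ _); apply: val_inj.
Qed.

Lemma vee_linear : linear (@vee R).
Proof. by move=> k M N; apply/colP => i; rewrite !mxE; ring. Qed.

Lemma hat_linear : linear (@hat R).
Proof.
move=> k u v; apply/matrixP => i j; rewrite !mxE.
by case: ifP => _; [ring|case: ifP => _; ring].
Qed.

Lemma hatE (u : 'cV[R]_3) i j : hat u i j = (Num.sqrt 2)^-1 * nth 0 (nth [::]
  [:: [:: 0; - u 2 0; u 1 0]; [:: u 2 0; 0; - u 0 0]; [:: - u 1 0; u 0 0; 0]] i) j.
Proof.
rewrite !mxE; congr (_ * _).
by case: (ord3 i) => ->; case: (ord3 j) => ->; rewrite //=;
 congr (- u _ _) || congr (u _ _); apply: val_inj.
Qed.

(** Rotations preserve the cross product. The entries on the left involve 2 x 2 minors of [g], which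
    [so3_cofactor] turns back into entries of [g]. *)
Lemma hat_so3 (g : 'M[R]_3) (u : 'cV[R]_3) : g^T *m g = 1%:M -> \det g = 1 ->
  g *m hat u *m g^T = hat (g *m u).
Proof.
move=> gg dg; have /matrixP gE := so3_cofactor gg dg.
apply/matrixP => i j; rewrite hatE !mxE !sum3 !mxE !sum3 !hatE /=.
have E00 := gE 0 0; have E01 := gE 0 1; have E02 := gE 0 2.
have E10 := gE 1 0; have E11 := gE 1 1; have E12 := gE 1 2.
have E20 := gE 2 0; have E21 := gE 2 1; have E22 := gE 2 2.
move: E00 E01 E02 E10 E11 E12 E20 E21 E22; rewrite !mxE /=.
move=> E00 E01 E02 E10 E11 E12 E20 E21 E22.
case: (ord3 i) => ->; case: (ord3 j) => ->; rewrite /=.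
- by ring.
- by rewrite E20 E21 E22; ring.
- by rewrite E10 E11 E12; ring.
- by rewrite E20 E21 E22; ring.
- by ring.
- by rewrite E00 E01 E02; ring.
- by rewrite E10 E11 E12; ring.
- by rewrite E00 E01 E02; ring.
- by ring.
Qed.

Lemma vee_so3 (g M : 'M[R]_3) : g^T *m g = 1%:M -> \det g = 1 -> skew M ->
  vee (g *m M *m g^T) = g *m vee M.
Proof. by move=> gg dg sM; rewrite -{1}(veeK sM) hat_so3// hatK. Qed.

End HatVee.

(** * Local expressions, transition laws and tensoriality of the curvature *)

Section BundleCalculus.
Variables (R : realType) (X : manifold4 R) (E : so3_bundle X).
Implicit Types (p q : lpatch E) (x : X) (s : X -> 'cV[R]_3) (a : X -> 'M[R]_(3, 4)).

Let tdm p := @tdom_open _ _ E p.2.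

Lemma pdom_at x : pdom (lpatch_at E x) x.
Proof. by split; [exact: dom_at|exact: tdom_at]. Qed.

Lemma near_pdom p x : pdom p x -> \forall z \near x, pdom p z.
Proof.
by move=> px; apply: near_open px; apply: openI; [exact: dom_open|exact: tdom_open].
Qed.

Lemma trans_id (t : trivs E) x : tdom t x -> trans t t x = 1%:M.
Proof.
move=> tx; have o := trans_orthogonal tx tx; have c := trans_cocycle tx tx tx.
by rewrite -[LHS]mul1mx -o -mulmxA c.
Qed.

Lemma trans_mul_tr (t u : trivs E) x : tdom t x -> tdom u x ->
  trans t u x *m (trans t u x)^T = 1%:M.
Proof. by move=> tx ux; apply: mulmx1C; exact: trans_orthogonal. Qed.

Lemma loc0_change p q s x : pdom p x -> pdom q x ->
  loc0 q s x = trans q.2 p.2 x *m loc0 p s x.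
Proof.
by move=> [_ px] [_ qx]; rewrite /loc0 mulmxA trans_cocycle//; exact: tdom_at.
Qed.

Lemma loc1_change p q a x : pdom p x -> pdom q x ->
  loc1 q a x = trans q.2 p.2 x *m loc1 p a x *m jac q.1 p.1 x.
Proof.
move=> [px px'] [qx qx']; have ax := dom_at x; have tx := tdom_at E x.
by rewrite /loc1 -(trans_cocycle qx' px' tx) (jac_comp qx px ax) !mulmxA.
Qed.

Lemma loc0_at s x : loc0 (lpatch_at E x) s x = s x.
Proof. by rewrite /loc0 /= trans_id ?mul1mx//; exact: tdom_at. Qed.

Lemma loc1_at a x : loc1 (lpatch_at E x) a x = a x.
Proof.
by rewrite /loc1 /= trans_id ?jac_id ?mul1mx ?mulmx1//; [exact: dom_at|exact: tdom_at].
Qed.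

Lemma smooth0P s : smooth0 E s <-> forall p, smooth_mx p.1 (tdom p.2) (loc0 p s).
Proof.
by split=> [ss p k l|ss p k]; [rewrite (ord1 l); exact: ss|exact: ss].
Qed.

Lemma smooth1P a : smooth1 E a <-> forall p, smooth_mx p.1 (tdom p.2) (loc1 p a).
Proof. by []. Qed.

Lemma smooth2P (b : X -> 'M[R]_3) : smooth2 E b <-> forall p, smooth_mx p.1 (tdom p.2) (loc2 p b).
Proof. by []. Qed.

Lemma trans_smooth_mx c (t u : trivs E) : smooth_mx c (tdom t `&` tdom u) (trans t u).
Proof. by move=> k l; exact: trans_smooth. Qed.

(** [dA] is computed at each point in the preferred patch there, whereas smoothness is tested in a
    fixed patch; this is its expression in an arbitrary one. *)
Definition dA_loc (A : cform E) p s x : 'M[R]_(3, 4) :=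
  \matrix_(k, i) (pder_mx p.1 i (loc0 p s) x + A p x i *m loc0 p s x) k 0.

(** The derivative of the transition function [g] cancels against the inhomogeneous term in the
    transformation of [A]. *)
Lemma dA_loc_change (A : cform E) (cA : is_connection A) p q s x : smooth0 E s -> pdom p x -> pdom q x ->
  dA_loc A q s x = trans q.2 p.2 x *m dA_loc A p s x *m jac q.1 p.1 x.
Proof.
move=> /smooth0P ss px qx; have [_ _ /(_ p q x)AE] := cA.
set g := trans q.2 p.2; set J := jac q.1 p.1.
pose D := tdom q.2 `&` tdom p.2.
have oD : open D by apply: openI; exact: tdom_open.
have gs : smooth_mx p.1 D g by exact: trans_smooth_mx.
have ls : smooth_mx p.1 D (loc0 p s) by apply: smooth_mx_sub (ss p) => z [].
have Dx : D x by split; [exact: qx.2|exact: px.2].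
have gg : (g x)^T *m g x = 1%:M by apply: trans_orthogonal; [exact: qx.2|exact: px.2].
apply/matrixP => k j.
have colE : pder_mx q.1 j (loc0 q s) x + A q x j *m loc0 q s x =
    \sum_i J x i j *: (g x *m (pder_mx p.1 i (loc0 p s) x + A p x i *m loc0 p s x)).
  have -> : pder_mx q.1 j (loc0 q s) x = pder_mx q.1 j (fun z => g z *m loc0 p s z) x.
    apply: eq_pder_mx; first exact: qx.1.
    apply: filterS2 (near_pdom px) (near_pdom qx) => z pz qz; exact: loc0_change.
  rewrite (pder_mx_change j oD (smooth_mulmx oD gs ls) Dx px.1 qx.1).
  rewrite AE// (loc0_change s px qx) -/g mulmx_suml -big_split/=; apply: eq_bigr => i _.
  rewrite (pder_mulmx oD i gs ls px.1 Dx) -scalemxAl -scalerDr; congr (_ *: _).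
  rewrite mulmxBl !mulmxDr -!mulmxA !(mulmxA (g x)^T) gg !mul1mx.
  by rewrite addrC addrA subrK [RHS]addrC.
rewrite mxE colE !mxE summxE; apply: eq_bigr => i _.
by rewrite [LHS]mxE mulrC !mxE; congr (_ * _); apply: eq_bigr => l _; rewrite !mxE.
Qed.

Lemma loc1_dA (A : cform E) (cA : is_connection A) p s x : smooth0 E s -> pdom p x ->
  loc1 p (dA A s) x = dA_loc A p s x.
Proof. by move=> ss px; rewrite (dA_loc_change cA ss (pdom_at x) px). Qed.

Lemma connection_smooth (A : cform E) (cA : is_connection A) p i :
  smooth_mx p.1 (tdom p.2) (fun x => A p x i).
Proof. by move=> k l; have [_ + _] := cA; apply. Qed.

Lemma dA_smooth (A : cform E) (cA : is_connection A) s : smooth0 E s -> smooth1 E (dA A s).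
Proof.
move=> ss; apply/smooth1P => p; have os := tdm p.
apply: (smooth_mx_ext os (M := dA_loc A p s)) => [x px tx|k i].
  by rewrite loc1_dA.
have /smooth0P/(_ p)ssp := ss.
apply: (smooth_in_ext os (f := fun x => (pder_mx p.1 i (loc0 p s) x + A p x i *m loc0 p s x) k 0)).
  by move=> x _ _; rewrite [RHS]mxE.
apply: (smooth_addmx os); first exact: smooth_pder_mx.
exact: (smooth_mulmx os (@connection_smooth A cA p i)).
Qed.

Lemma curvature_smooth (A : cform E) (cA : is_connection A) p i j :
  smooth_mx p.1 (tdom p.2) (fun x => curvature A p x i j).
Proof.
have os := tdm p; have As k := @connection_smooth A cA p k.
apply: (smooth_addmx os); apply: (smooth_submx os).
- exact: (smooth_pder_mx os).
- exact: (smooth_pder_mx os).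
- exact: (smooth_mulmx os).
- exact: (smooth_mulmx os).
Qed.

(** The second derivatives of the change of chart and of the gauge transformation are symmetric,
    hence drop out of the antisymmetrised derivative; the first-order terms cancel by
    [gauge_curvature]. *)
Lemma curvature_change (A : cform E) (cA : is_connection A) p q x (a b : 'I_4) : pdom p x -> pdom q x ->
  curvature A q x a b = \sum_i \sum_j (jac q.1 p.1 x i a * jac q.1 p.1 x j b) *:
    (trans q.2 p.2 x *m curvature A p x i j *m (trans q.2 p.2 x)^T).
Proof.
move=> px qx; have [_ _ AE] := cA.
set g := trans q.2 p.2; set J := jac q.1 p.1.
pose D := tdom q.2 `&` tdom p.2.
have oD : open D by apply: openI; exact: tdom_open.
have gs : smooth_mx p.1 D g by exact: trans_smooth_mx.
have As i : smooth_mx p.1 D (fun z => A p z i).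
  by apply: smooth_mx_sub (@connection_smooth A cA p i) => z [].
have Dx : D x by split; [exact: qx.2|exact: px.2].
have gTs := smooth_trmx oD gs.
(* [M] is the gauge transform of [A p], still in the chart [p.1]; [A q] is its pullback by the
   change of chart, which separates the two effects. *)
pose M j z := g z *m A p z j *m (g z)^T - pder_mx p.1 j g z *m (g z)^T.
have gAs j : smooth_mx p.1 D (fun z => g z *m A p z j) by exact: smooth_mulmx.
have gAgs j : smooth_mx p.1 D (fun z => g z *m A p z j *m (g z)^T).
  exact: (smooth_mulmx oD (gAs j)).
have dgs j : smooth_mx p.1 D (pder_mx p.1 j g) by exact: smooth_pder_mx.
have dggs j : smooth_mx p.1 D (fun z => pder_mx p.1 j g z *m (g z)^T).
  exact: (smooth_mulmx oD (dgs j)).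
have Ms j : smooth_mx p.1 D (M j) by exact: (smooth_submx oD (gAgs j) (dggs j)).
pose D' := D `&` dom p.1.
have oD' : open D' by apply: openI => //; exact: dom_open.
have D'x : D' x by split=> //; exact: px.1.
have Ms' j : smooth_mx q.1 D' (M j) by exact: smooth_mx_change.
have Js i j : smooth_in q.1 D' (fun z => J z i j).
  by apply: smooth_in_sub (@jac_smooth _ _ q.1 p.1 i j) => z [].
have AqE j : \forall z \near x, A q z j = \sum_i J z i j *: M i z.
  by apply: filterS2 (near_pdom px) (near_pdom qx) => z pz qz; rewrite (AE p q z j pz qz).
have dAq i j : pder_mx q.1 i (fun z => A q z j) x =
    \sum_k (pder q.1 i (fun z => J z k j) x *: M k x) +
    \sum_k \sum_l (J x l i * J x k j) *: pder_mx p.1 l (M k) x.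
  rewrite (eq_pder_mx i qx.1 (AqE j)).
  have -> : pder_mx q.1 i (fun z => \sum_k J z k j *: M k z) x =
      \sum_k pder_mx q.1 i (fun z => J z k j *: M k z) x.
    apply/matrixP => m n; rewrite summxE mxE.
    transitivity (pder q.1 i (fun z => \sum_k (J z k j *: M k z) m n) x).
      by apply: eq_pder; [exact: qx.1|apply: nearW => z; rewrite summxE].
    rewrite (pder_sum (D := D') i _ oD' _ qx.1 D'x).
      by apply: eq_bigr => k _; rewrite [RHS]mxE.
    by move=> k; apply: (smooth_scalemx oD' (Js k j) (Ms' k)).
  rewrite -big_split/=; apply: eq_bigr => k _.
  rewrite (pder_scalemx oD' i (Js k j) (Ms' k) qx.1 D'x) addrC; congr (_ + _).
  rewrite (pder_mx_change i oD (Ms k) Dx px.1 qx.1) scaler_sumr; apply: eq_bigr => l _.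
  by rewrite scalerA mulrC.
(* The second derivatives of the change of chart, symmetric in [i] and [j]. *)
have JC i j k : pder q.1 i (fun z => J z k j) x = pder q.1 j (fun z => J z k i) x.
  have F i' j' : pder q.1 i' (fun z => J z k j') x =
      pder q.1 i' (pder q.1 j' (fun z => chart p.1 z 0 k)) x.
    by apply: eq_pder; [exact: qx.1|apply: nearW => z; rewrite -jacE].
  rewrite !F; apply: pderC (@chart_coord_smooth _ _ q.1 p.1 k) qx.1 px.1.
  exact: dom_open.
have gg : (g x)^T *m g x = 1%:M by apply: trans_orthogonal; [exact: qx.2|exact: px.2].
(* Obtained by differentiating [g g^T = 1] and multiplying by [g^T] on the left. *)
have hder i : pder_mx p.1 i (fun z => (g z)^T) x =
    - ((g x)^T *m pder_mx p.1 i g x *m (g x)^T).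
  have : pder_mx p.1 i (fun z => g z *m (g z)^T) x = 0.
    rewrite -(pder_cstmx p.1 i (1%:M : 'M[R]_3) x); apply: eq_pder_mx; first exact: px.1.
    apply: filterS2 (near_pdom px) (near_pdom qx) => z pz qz.
    by apply: trans_mul_tr; [exact: qz.2|exact: pz.2].
  rewrite (pder_mulmx oD i gs gTs px.1 Dx) => /(congr1 (mulmx (g x)^T)).
  rewrite mulmx0 mulmxDr !mulmxA gg mul1mx => /eqP.
  by rewrite addrC addr_eq0 => /eqP.
have dM l k : pder_mx p.1 l (M k) x =
   pder_mx p.1 l g x *m A p x k *m (g x)^T + g x *m pder_mx p.1 l (fun z => A p z k) x *m (g x)^T
   + g x *m A p x k *m - ((g x)^T *m pder_mx p.1 l g x *m (g x)^T)
   - (pder_mx p.1 l (pder_mx p.1 k g) x *m (g x)^T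
      + pder_mx p.1 k g x *m - ((g x)^T *m pder_mx p.1 l g x *m (g x)^T)).
  have NE : pder_mx p.1 l (fun z => - (pder_mx p.1 k g z *m (g z)^T)) x =
      - pder_mx p.1 l (fun z => pder_mx p.1 k g z *m (g z)^T) x.
    transitivity (pder_mx p.1 l (fun z => -1 *: (pder_mx p.1 k g z *m (g z)^T)) x).
      by apply: eq_pder_mx; [exact: px.1|apply: nearW => z; rewrite scaleN1r].
    rewrite (pder_scalemx oD l (@smooth_in_cst R X p.1 D (-1)) (dggs k) px.1 Dx).
    by rewrite pder_cst scale0r addr0 scaleN1r.
  rewrite (pder_addmx oD l (gAgs k) (smooth_oppmx oD (dggs k)) px.1 Dx) NE.
  rewrite (pder_mulmx oD l (gAs k) gTs px.1 Dx) (pder_mulmx oD l gs (As k) px.1 Dx).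
  by rewrite (pder_mulmx oD l (dgs k) gTs px.1 Dx) hder mulmxDl.
have gC l k : pder_mx p.1 l (pder_mx p.1 k g) x = pder_mx p.1 k (pder_mx p.1 l g) x.
  apply/matrixP => m n; rewrite [LHS]mxE [RHS]mxE.
  have F i j : pder p.1 i (fun z => pder_mx p.1 j g z m n) x =
      pder p.1 i (pder p.1 j (fun z => g z m n)) x.
    by apply: eq_pder; [exact: px.1|apply: nearW => z; rewrite mxE].
  by rewrite !F; exact: (pderC oD _ _ (gs m n) px.1 Dx).
have AqxE j : A q x j = \sum_i J x i j *: M i x by exact: (nbhs_singleton (AqE j)).
have prod i j : A q x i *m A q x j = \sum_k \sum_l (J x k i * J x l j) *: (M k x *m M l x).
  rewrite !AqxE mulmx_suml; apply: eq_bigr => k _; rewrite mulmx_sumr; apply: eq_bigr => l _.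
  by rewrite -scalemxAl -scalemxAr scalerA.
rewrite /curvature !dAq !prod.
have ME k : M k x = g x *m A p x k *m (g x)^T - pder_mx p.1 k g x *m (g x)^T by [].
clearbody M J g.
have -> : \sum_k pder q.1 b (fun z => J z k a) x *: M k x =
    \sum_k pder q.1 a (fun z => J z k b) x *: M k x by apply: eq_bigr => k _; rewrite JC.
have addB (u v w : 'M[R]_3) : (u + v) - (u + w) = v - w.
  by rewrite opprD addrACA subrr add0r.
rewrite addB.
have X1 (f : 'I_4 -> 'I_4 -> 'M[R]_3) : \sum_k \sum_l (J x l a * J x k b) *: f l k =
    \sum_i \sum_j (J x i a * J x j b) *: f i j by rewrite exchange_big.
have X2 (f : 'I_4 -> 'I_4 -> 'M[R]_3) : \sum_k \sum_l (J x l b * J x k a) *: f l k =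
    \sum_i \sum_j (J x i a * J x j b) *: f j i.
  by apply: eq_bigr => i _; apply: eq_bigr => j _; rewrite mulrC.
have X3 (f : 'I_4 -> 'I_4 -> 'M[R]_3) : \sum_k \sum_l (J x k b * J x l a) *: f k l =
    \sum_i \sum_j (J x i a * J x j b) *: f j i.
  by rewrite exchange_big; apply: eq_bigr => i _; apply: eq_bigr => j _; rewrite mulrC.
rewrite (X1 (fun l k => pder_mx p.1 l (M k) x)) (X2 (fun l k => pder_mx p.1 l (M k) x)).
rewrite (X3 (fun k l => M k x *m M l x)) -!sumrB -big_split/=; apply: eq_bigr => i _.
rewrite -!sumrB -big_split/=; apply: eq_bigr => j _.
rewrite -!scalerBr -scalerDr; congr (_ *: _).
by rewrite !dM (gC j i) !ME gauge_curvature.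
Qed.

End BundleCalculus.

(** * The linearisation of Q *)

Section WedgePullback.
Variable R : realType.
Implicit Types (J a b : 'M[R]_4).

Definition pull2 J a : 'M[R]_4 := J^T *m a *m J.

Definition minor2 J (k l i j : 'I_4) : R := J k i * J l j - J l i * J k j.

(* The determinant of [J], as a Laplace expansion along two rows. *)
Definition laplace4 J : R :=
  minor2 J 0 1 0 1 * minor2 J 2 3 2 3 - minor2 J 0 1 0 2 * minor2 J 2 3 1 3
  + minor2 J 0 1 0 3 * minor2 J 2 3 1 2 + minor2 J 0 1 1 2 * minor2 J 2 3 0 3
  - minor2 J 0 1 1 3 * minor2 J 2 3 0 2 + minor2 J 0 1 2 3 * minor2 J 2 3 0 1.

Lemma pull2_skew J a : skew a -> skew (pull2 J a).
Proof. by move=> sa; rewrite /skew /pull2 !trmx_mul trmxK sa mulNmx mulmxN mulmxA. Qed.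

Lemma pull2E J a i j : skew a -> pull2 J a i j =
  a 0 1 * minor2 J 0 1 i j + a 0 2 * minor2 J 0 2 i j + a 0 3 * minor2 J 0 3 i j
  + a 1 2 * minor2 J 1 2 i j + a 1 3 * minor2 J 1 3 i j + a 2 3 * minor2 J 2 3 i j.
Proof.
move=> sa; rewrite !mxE !sum4 !mxE !sum4 !mxE /minor2 !(skew_diag _ sa).
rewrite (skewE 1 0 sa) (skewE 2 0 sa) (skewE 3 0 sa) (skewE 2 1 sa) (skewE 3 1 sa)
  (skewE 3 2 sa); ring.
Qed.

Lemma wedge_pull2 J a b : skew a -> skew b ->
  wedge (pull2 J a) (pull2 J b) = laplace4 J * wedge a b.
Proof.
move=> sa sb; rewrite /wedge !(pull2E _ _ _ sa) !(pull2E _ _ _ sb) /laplace4 /minor2.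
by ring.
Qed.

Lemma pull2M J J' a : pull2 J (pull2 J' a) = pull2 (J' *m J) a.
Proof. by rewrite /pull2 trmx_mul !mulmxA. Qed.

(** Pulling a pair of forms of wedge 1 back by [J] and then by [J'] changes nothing, so the two
    factors multiply to 1. *)
Lemma laplace4_neq0 J J' : J *m J' = 1%:M -> laplace4 J != 0.
Proof.
move=> JJ'; pose e (i j : 'I_4) : 'M[R]_4 := delta_mx i j - delta_mx j i.
have se i j : skew (e i j) by rewrite /skew /e linearB/= !trmx_delta opprB.
have := wedge_pull2 J' (pull2_skew J (se 0 1)) (pull2_skew J (se 2 3)).
have p1 a : pull2 1%:M a = a by rewrite /pull2 trmx1 mul1mx mulmx1.
rewrite !pull2M JJ' !p1 wedge_pull2//.
have -> : wedge (e 0 1) (e 2 3) = 1 by rewrite /wedge !mxE /=; ring.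
by move=> E; apply: contra_eq_neq E => ->; rewrite mul0r mulr0 oner_neq0.
Qed.

Lemma wedge_suml (I : finType) (c : I -> R) (f : I -> 'M[R]_4) b :
  wedge (\sum_i c i *: f i) b = \sum_i c i * wedge (f i) b.
Proof.
have wl : linear (fun a => wedge a b : R^o).
  by move=> k u w; rewrite /wedge !mxE /GRing.scale/=; ring.
pose WM := GRing.isLinear.Build _ _ _ _ _ wl.
pose L : {linear 'M[R]_4 -> R^o} := HB.pack (fun a => wedge a b : R^o) WM.
rewrite -[LHS]/(L _) linear_sum; apply: eq_bigr => i _.
by rewrite linearZ.
Qed.

Definition wedge_mx (F H : 'I_3 -> 'M[R]_4) : 'M[R]_3 := \matrix_(k, l) wedge (F k) (H l).

Definition change2 (g : 'M[R]_3) J (F : 'I_3 -> 'M[R]_4) (k : 'I_3) : 'M[R]_4 :=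
  \sum_l g k l *: pull2 J (F l).

Lemma wedge_mx_change g J F H : (forall k, skew (F k)) -> (forall k, skew (H k)) ->
  wedge_mx (change2 g J F) (change2 g J H) = laplace4 J *: (g *m wedge_mx F H *m g^T).
Proof.
move=> sF sH; apply/matrixP => k l; rewrite [LHS]mxE [RHS]mxE /change2 wedge_suml.
transitivity (\sum_m \sum_n g k m * (g l n * (laplace4 J * wedge (F m) (H n)))).
  apply: eq_bigr => m _; rewrite wedgeC wedge_suml mulr_sumr; apply: eq_bigr => n _.
  by rewrite wedgeC wedge_pull2.
rewrite exchange_big/= [in RHS]mxE mulr_sumr; apply: eq_bigr => n _.
rewrite [(_ *m _) _ _]mxE mulr_suml mulr_sumr; apply: eq_bigr => m _.
by rewrite !mxE; ring.
Qed.

(** The derivative of [W / (tr W / 3)] at [W] in the direction [W']; [Q] is this quotient for the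
    matrix of wedge products. *)
Definition dQ (W W' : 'M[R]_3) : 'M[R]_3 :=
  (3^-1 * \tr W)^-1 *: W' - (3^-1 * \tr W' / (3^-1 * \tr W) ^+ 2) *: W.

(** [W / (tr W / 3)] is homogeneous of degree 0 and equivariant under orthogonal conjugation. The
    factor [d], by which wedge coefficients change with the chart and which may be negative,
    therefore cancels. *)
Lemma dQ_change (d : R) (g W W' : 'M[R]_3) : d != 0 -> g^T *m g = 1%:M ->
  dQ (d *: (g *m W *m g^T)) (d *: (g *m W' *m g^T)) = g *m dQ W W' *m g^T.
Proof.
move=> d0 gg.
have trg (A : 'M[R]_3) : \tr (g *m A *m g^T) = \tr A.
  by rewrite mxtrace_mulC mulmxA gg mul1mx.
rewrite /dQ !mxtraceZ !trg mulmxBr mulmxBl -!scalemxAr -!scalemxAl !scalerA.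
(* When the trace vanishes, the convention [0^-1 = 0] makes both sides zero. *)
have [t0|t0] := eqVneq (\tr W) 0.
  by rewrite t0 !mulr0 invr0 expr0n/= invr0 !mulr0 !mul0r !scale0r.
congr (_ *: _ - _ *: _); field; rewrite ?t0 ?d0//.
Qed.

Lemma tr_dQ (W W' : 'M[R]_3) : \tr W != 0 -> \tr (dQ W W') = 0.
Proof. move=> t0; rewrite /dQ raddfB /= !mxtraceZ. by field. Qed.

Lemma dQ_sym (W W' : 'M[R]_3) : W^T = W -> W'^T = W' -> (dQ W W')^T = dQ W W'.
Proof. by move=> sW sW'; rewrite /dQ linearB !linearZ/= sW sW'. Qed.

Lemma dQ_linear (W W' W'' : 'M[R]_3) k : dQ W (k *: W' + W'') = k *: dQ W W' + dQ W W''.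
Proof.
apply/matrixP => i j; rewrite /dQ mxtraceD mxtraceZ !mxE; ring.
Qed.

Lemma wedge_mx_sym F : (wedge_mx F F)^T = wedge_mx F F.
Proof. by apply/matrixP => k l; rewrite !mxE wedgeC. Qed.

Lemma wedge_mx_tr F H : (wedge_mx F H)^T = wedge_mx H F.
Proof. by apply/matrixP => k l; rewrite !mxE wedgeC. Qed.

Lemma derive1_quotient (f g : R -> R) (f' g' : R) : g 0 != 0 ->
  is_derive (0 : R) (1 : R) f f' -> is_derive (0 : R) (1 : R) g g' ->
  derive1 (fun t => f t / g t) 0 = (g 0)^-1 * f' - g' / (g 0) ^+ 2 * f 0.
Proof.
move=> g0 df dg; have dV := is_deriveV g0 dg.
have := is_deriveM df dV => -[_]; rewrite derive1E => ->.
by rewrite /GRing.scale/=; field.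
Qed.

(* A quadratic perturbation [F + t F' + t^2 F''] of [F]. *)
Lemma is_derive_wedge (a a' a'' b b' b'' : 'M[R]_4) :
  is_derive (0 : R) (1 : R)
    (fun t => wedge (a + t *: a' + t ^+ 2 *: a'') (b + t *: b' + t ^+ 2 *: b''))
    (wedge a' b + wedge a b').
Proof.
pose p : {poly R} := (wedge a b)%:P + (wedge a' b + wedge a b')%:P * 'X
  + 'X^2 * ((wedge a'' b + wedge a' b' + wedge a b'')%:P
      + (wedge a'' b' + wedge a' b'')%:P * 'X + (wedge a'' b'')%:P * 'X^2).
rewrite (_ : (fun _ => _) = horner p); last first.
  apply/funext => t; rewrite /p !(hornerD, hornerM, hornerC, hornerX, hornerXn).
  by rewrite /wedge !mxE; ring.
apply: is_derive_eq; rewrite /p !(derivD, derivM, derivC, derivX, derivXn) /=.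
rewrite !(hornerD, hornerM, hornerC, hornerX, hornerXn, hornerMn, horner0); ring.
Qed.

Lemma derive_Q (F F' F'' : 'I_3 -> 'M[R]_4) (k l : 'I_3) :
  let Ft (t : R) (m : 'I_3) := F m + t *: F' m + t ^+ 2 *: F'' m in
  \tr (wedge_mx F F) != 0 ->
  derive1 (fun t => wedge (Ft t k) (Ft t l) / (3^-1 * \sum_m wedge (Ft t m) (Ft t m))) 0
  = dQ (wedge_mx F F) (wedge_mx F' F + wedge_mx F F') k l.
Proof.
move=> Ft t0.
have F0 m : Ft 0 m = F m by rewrite /Ft scale0r addr0 expr0n/= scale0r addr0.
have trE : \sum_m wedge (Ft 0 m) (Ft 0 m) = \tr (wedge_mx F F).
  by apply: eq_bigr => m _; rewrite !mxE F0.
pose g (t : R) := 3^-1 * \sum_m wedge (Ft t m) (Ft t m).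
have dg : is_derive (0 : R) (1 : R) g (3^-1 * \tr (wedge_mx F' F + wedge_mx F F')).
  have -> : g = 3^-1 \*: (\sum_(m < 3) (fun t => wedge (Ft t m) (Ft t m))).
    by apply/funext => t; rewrite /g /= fct_sumE.
  apply: is_deriveZ.
  rewrite (_ : \tr _ = \sum_m (wedge (F' m) (F m) + wedge (F m) (F' m))); last first.
    by apply: eq_bigr => m _; rewrite !mxE.
  apply: is_derive_sum => m; exact: is_derive_wedge.
have g0 : g 0 != 0 by rewrite /g trE mulf_neq0// invr_neq0// pnatr_eq0.
rewrite (derive1_quotient g0 (is_derive_wedge _ _ _ _ _ _) dg) /g trE.
by rewrite -/(Ft 0 k) -/(Ft 0 l) !F0 /dQ !mxE.
Qed.

End WedgePullback.

(** * First variation of the curvature and of [Q] along [A + t a] *)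

Section CurvatureVariation.
Variables (R : realType) (X : manifold4 R) (E : so3_bundle X).
Implicit Types (p q : lpatch E) (x : X) (a : X -> 'M[R]_(3, 4)).

Let tdm p := @tdom_open _ _ E p.2.

Definition hatcol a p (i : 'I_4) x : 'M[R]_3 := hat (col i (loc1 p a x)).

Lemma hatcol_smooth a p i : smooth1 E a -> smooth_mx p.1 (tdom p.2) (hatcol a p i).
Proof.
move=> sa k l; have os := tdm p.
have su j : smooth_in p.1 (tdom p.2) (fun x => col i (loc1 p a x) j 0).
  by apply: (smooth_in_ext os _ (sa p j i)) => x _ _; rewrite [RHS]mxE.
apply: (smooth_in_ext os (f := fun x => (Num.sqrt 2)^-1 * nth 0 (nth [::]
  [:: [:: 0; - col i (loc1 p a x) 2 0; col i (loc1 p a x) 1 0];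
      [:: col i (loc1 p a x) 2 0; 0; - col i (loc1 p a x) 0 0];
      [:: - col i (loc1 p a x) 1 0; col i (loc1 p a x) 0 0; 0]] k) l)).
  by move=> x _ _; rewrite /hatcol hatE.
apply: (smooth_inM os (@smooth_in_cst _ _ _ _ _)).
case: (ord3 k) => ->; case: (ord3 l) => -> /=.
- exact: smooth_in_cst.
- exact: (smooth_inN os (su 2)).
- exact: (su 1).
- exact: (su 2).
- exact: smooth_in_cst.
- exact: (smooth_inN os (su 0)).
- exact: (smooth_inN os (su 1)).
- exact: (su 0).
- exact: smooth_in_cst.
Qed.

(** By equivariance of [hat], the matrices of [a] change by conjugation, so they can be added to [A]
    without disturbing its inhomogeneous transition law. *)
Lemma cshift_connection (A : cform E) a t : is_connection A -> smooth1 E a ->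
  is_connection (cshift A a t).
Proof.
move=> cA sa; have [sk sm tr] := cA; split.
- move=> p x i px; rewrite /skew /cshift linearD linearZ/= (sk p x i px) hat_skew.
  by rewrite scalerN opprD.
- move=> p i; have os := tdm p.
  apply: (smooth_addmx os (@connection_smooth _ _ _ A cA p i)).
  by apply: (smooth_scalemx os (@smooth_in_cst _ _ _ _ _)); exact: hatcol_smooth.
- move=> p q x j px qx g; rewrite /cshift (tr p q x j px qx) -/g.
  have gg : (g x)^T *m g x = 1%:M by apply: trans_orthogonal; [exact: qx.2|exact: px.2].
  have dg : \det (g x) = 1 by apply: trans_det; [exact: qx.2|exact: px.2].
  have -> : hat (col j (loc1 q a x)) =
      \sum_i jac q.1 p.1 x i j *: (g x *m hat (col i (loc1 p a x)) *m (g x)^T).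
    have -> : col j (loc1 q a x) = \sum_i jac q.1 p.1 x i j *: (g x *m col i (loc1 p a x)).
      rewrite (loc1_change a px qx) -/g; apply/colP => k; rewrite mxE summxE mxE.
      apply: eq_bigr => i _; rewrite mulrC !mxE; congr (_ * _).
      by apply: eq_bigr => l _; rewrite !mxE.
    pose HM := GRing.isLinear.Build _ _ _ _ _ (@hat_linear R).
    pose L : {linear 'cV[R]_3 -> 'M[R]_3} := HB.pack (@hat R) HM.
    rewrite -[LHS]/(L _) linear_sum; apply: eq_bigr => i _.
    by rewrite linearZ/= hat_so3.
  rewrite scaler_sumr -big_split/=; apply: eq_bigr => i _.
  rewrite scalerA mulrC -scalerA -scalerDr; congr (_ *: _).
  by rewrite mulmxDr mulmxDl -(scalemxAr t) -(scalemxAl t) [LHS]addrAC.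
Qed.

Definition Fc (A : cform E) p x (k : 'I_3) : 'M[R]_4 :=
  \matrix_(i, j) vee (curvature A p x i j) k 0.

Lemma Fc_skew A p x k : skew (Fc A p x k).
Proof.
apply/matrixP => i j; rewrite [LHS]mxE [LHS]mxE oppmxE [in RHS]mxE.
have -> : curvature A p x j i = - curvature A p x i j by rewrite /curvature opprD !opprB.
have veeN (M : 'M[R]_3) : vee (- M) = - vee M.
  by apply/colP => l; rewrite [LHS]mxE !oppmxE mulrN [in RHS]mxE.
by rewrite veeN oppmxE.
Qed.

Lemma curvature_skew A p x i j : is_connection A -> pdom p x -> skew (curvature A p x i j).
Proof.
move=> cA px; have [sk _ _] := cA.
have dsk k l : (pder_mx p.1 k (fun z => A p z l) x)^T = - pder_mx p.1 k (fun z => A p z l) x.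
  rewrite -pder_trmx; last exact: px.1.
  transitivity (pder_mx p.1 k (fun z => -1 *: A p z l) x).
    apply: eq_pder_mx; first exact: px.1.
    by apply: filterS (near_pdom px) => z pz; rewrite scaleN1r; exact: sk.
  rewrite (pder_scalemx (tdm p) k (@smooth_in_cst R X p.1 _ (-1)) (@connection_smooth _ _ _ A cA p l) px.1 px.2).
  by rewrite pder_cst scale0r addr0 scaleN1r.
rewrite /skew /curvature linearD linearB/= [X in _ + X]linearB/= !dsk !trmx_mul.
rewrite !(sk p x _ px) !mulNmx !mulmxN !opprK.
by apply/matrixP => k l; rewrite !(addmxE, oppmxE); ring.
Qed.

Lemma vee_sum (I : finType) (c : I -> R) (M : I -> 'M[R]_3) :
  vee (\sum_i c i *: M i) = \sum_i c i *: vee (M i).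
Proof.
pose VM := GRing.isLinear.Build _ _ _ _ _ (@vee_linear R).
pose L : {linear 'M[R]_3 -> 'cV[R]_3} := HB.pack (@vee R) VM.
by rewrite -[LHS]/(L _) linear_sum; apply: eq_bigr => i _; rewrite linearZ.
Qed.

Lemma Fc_change A p q x : is_connection A -> pdom p x -> pdom q x ->
  Fc A q x =1 change2 (trans q.2 p.2 x) (jac q.1 p.1 x) (Fc A p x).
Proof.
move=> cA px qx k; set g := trans _ _ _; set J := jac _ _ _.
have gg : g^T *m g = 1%:M by apply: trans_orthogonal; [exact: qx.2|exact: px.2].
have dg : \det g = 1 by apply: trans_det; [exact: qx.2|exact: px.2].
apply/matrixP => i j; rewrite mxE (curvature_change cA i j px qx) -/g -/J pair_big/=.
rewrite (vee_sum (fun ij : 'I_4 * 'I_4 => J ij.1 i * J ij.2 j)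
   (fun ij => g *m curvature A p x ij.1 ij.2 *m g^T)) summxE.
rewrite /change2 summxE.
transitivity (\sum_(ij : 'I_4 * 'I_4) \sum_l g k l * (J ij.1 i * J ij.2 j * Fc A p x l ij.1 ij.2)).
  apply: eq_bigr => ij _; rewrite scalemxE vee_so3//; last exact: curvature_skew.
  rewrite [(g *m _) k 0]mxE mulr_sumr; apply: eq_bigr => l _.
  by rewrite [Fc _ _ _ _ _ _]mxE mulrCA.
rewrite exchange_big/=; apply: eq_bigr => l _; rewrite -mulr_sumr [RHS]mxE; congr (_ * _).
rewrite [RHS]mxE -(pair_big xpredT xpredT (fun m n => J m i * J n j * Fc A p x l m n))/=.
rewrite exchange_big/=; apply: eq_bigr => n _; rewrite [(_ *m _) i n]mxE mulr_suml; apply: eq_bigr => m _.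
by rewrite [J^T _ _]mxE; ring.
Qed.

(** The components of the exterior covariant derivative of [a]: the coefficient of [t] in the
    curvature of [A + t a]. *)
Definition dcurv (A : cform E) a p x i j : 'M[R]_3 :=
  pder_mx p.1 i (hatcol a p j) x - pder_mx p.1 j (hatcol a p i) x
  + ((A p x i *m hatcol a p j x + hatcol a p i x *m A p x j)
     - (A p x j *m hatcol a p i x + hatcol a p j x *m A p x i)).

Definition dFc (A : cform E) a p x (k : 'I_3) : 'M[R]_4 :=
  \matrix_(i, j) vee (dcurv A a p x i j) k 0.

Definition ddFc a p x (k : 'I_3) : 'M[R]_4 :=
  \matrix_(i, j) vee (hatcol a p i x *m hatcol a p j x - hatcol a p j x *m hatcol a p i x) k 0.

Lemma Fc_cshift A a p x t k : is_connection A -> smooth1 E a -> pdom p x ->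
  Fc (cshift A a t) p x k = Fc A p x k + t *: dFc A a p x k + t ^+ 2 *: ddFc a p x k.
Proof.
move=> cA sa px; apply/matrixP => i j.
have os := tdm p.
have dsh l m : pder_mx p.1 l (fun z => cshift A a t p z m) x =
    pder_mx p.1 l (fun z => A p z m) x + t *: pder_mx p.1 l (hatcol a p m) x.
  have sh := @hatcol_smooth a p m sa.
  have sth : smooth_mx p.1 (tdom p.2) (fun z => t *: hatcol a p m z).
    exact: (smooth_scalemx os (@smooth_in_cst _ _ _ _ _) sh).
  rewrite (pder_addmx os l (@connection_smooth _ _ _ A cA p m) sth px.1 px.2); congr (_ + _).
  rewrite (pder_scalemx os l (@smooth_in_cst R X p.1 _ t) sh px.1 px.2).
  by rewrite pder_cst scale0r addr0.
have cE : curvature (cshift A a t) p x i j = 1 *: curvature A p x i j + t *: dcurv A a p x i j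
   + t ^+ 2 *: (hatcol a p i x *m hatcol a p j x - hatcol a p j x *m hatcol a p i x).
  rewrite /curvature /dcurv !dsh /cshift -/(hatcol a p i x) -/(hatcol a p j x).
  move: (hatcol a p i x) (hatcol a p j x) (A p x i) (A p x j) => Hi Hj Ai Aj.
  move: (pder_mx _ i _ x) (pder_mx _ j _ x) (pder_mx _ i _ x) (pder_mx _ j _ x) => d1 d2 d3 d4.
  rewrite !mulmxDr !mulmxDl -!scalemxAr -!scalemxAl !scalerA.
  by apply/matrixP => m n; rewrite !(addmxE, oppmxE, scalemxE); ring.
rewrite [LHS]mxE cE !(addmxE, scalemxE).
have -> : Fc A p x k i j = vee (curvature A p x i j) k 0 by rewrite [LHS]mxE.
have -> : dFc A a p x k i j = vee (dcurv A a p x i j) k 0 by rewrite [LHS]mxE.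
have -> : ddFc a p x k i j =
    vee (hatcol a p i x *m hatcol a p j x - hatcol a p j x *m hatcol a p i x) k 0.
  by rewrite [LHS]mxE.
move: (curvature A p x i j) (dcurv A a p x i j) (_ *m _ - _ *m _) => M1 M2 M3.
by rewrite !mxE; ring.
Qed.

(** The curvature of [A + t a] is quadratic in [t], so its central difference at [1] and [-1] is
    exactly the linear coefficient. Tensoriality and smoothness of the linearised curvature are
    thereby inherited from the curvatures of the connections [A + a] and [A - a]. *)
Lemma dFcE A a p x k : is_connection A -> smooth1 E a -> pdom p x ->
  dFc A a p x k = 2^-1 *: Fc (cshift A a 1) p x k - 2^-1 *: Fc (cshift A a (-1)) p x k.
Proof.
move=> cA sa px; rewrite !Fc_cshift//.
by apply/matrixP => i j; rewrite !(addmxE, oppmxE, scalemxE); field.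
Qed.

Lemma change2_linear g J (F H : 'I_3 -> 'M[R]_4) (c d : R) k :
  change2 g J (fun l => c *: F l - d *: H l) k = c *: change2 g J F k - d *: change2 g J H k.
Proof.
rewrite /change2 !scaler_sumr -sumrB; apply: eq_bigr => l _.
have -> : pull2 J (c *: F l - d *: H l) = c *: pull2 J (F l) - d *: pull2 J (H l).
  by rewrite /pull2 mulmxBr mulmxBl -!scalemxAr -!scalemxAl.
by rewrite scalerBr !scalerA ![g k l * _]mulrC.
Qed.

Lemma dFc_change A a p q x : is_connection A -> smooth1 E a -> pdom p x -> pdom q x ->
  dFc A a q x =1 change2 (trans q.2 p.2 x) (jac q.1 p.1 x) (dFc A a p x).
Proof.
move=> cA sa px qx k; rewrite dFcE//.
rewrite (Fc_change (cshift_connection 1 cA sa) px qx).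
rewrite (Fc_change (cshift_connection (-1) cA sa) px qx).
rewrite -change2_linear; apply: eq_bigr => l _; congr (_ *: pull2 _ _).
by rewrite dFcE.
Qed.

Lemma dFc_skew A a p x k : is_connection A -> smooth1 E a -> pdom p x -> skew (dFc A a p x k).
Proof.
move=> cA sa px; rewrite dFcE// /skew linearB !linearZ/= !(Fc_skew _ _ _ k).
by rewrite !scalerN opprB opprK addrC.
Qed.

Definition Wc A p x : 'M[R]_3 := wedge_mx (Fc A p x) (Fc A p x).
Definition dWc A a p x : 'M[R]_3 :=
  wedge_mx (dFc A a p x) (Fc A p x) + wedge_mx (Fc A p x) (dFc A a p x).

Lemma wedge_mx_ext (F F' H H' : 'I_3 -> 'M[R]_4) : F =1 F' -> H =1 H' ->
  wedge_mx F H = wedge_mx F' H'.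
Proof. by move=> FF HH; apply/matrixP => k l; rewrite !mxE FF HH. Qed.

Lemma Wc_change A p q x : is_connection A -> pdom p x -> pdom q x ->
  Wc A q x = laplace4 (jac q.1 p.1 x) *:
    (trans q.2 p.2 x *m Wc A p x *m (trans q.2 p.2 x)^T).
Proof.
move=> cA px qx; rewrite /Wc -wedge_mx_change; [|exact: Fc_skew|exact: Fc_skew].
by apply: wedge_mx_ext; exact: Fc_change.
Qed.

Lemma dWc_change A a p q x : is_connection A -> smooth1 E a -> pdom p x -> pdom q x ->
  dWc A a q x = laplace4 (jac q.1 p.1 x) *:
    (trans q.2 p.2 x *m dWc A a p x *m (trans q.2 p.2 x)^T).
Proof.
move=> cA sa px qx; have sF k := Fc_skew A p x k.
have sdF k : skew (dFc A a p x k) by exact: dFc_skew.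
rewrite /dWc mulmxDr mulmxDl scalerDr -(wedge_mx_change _ _ sdF sF) -(wedge_mx_change _ _ sF sdF).
congr (_ + _); apply: wedge_mx_ext; [exact: dFc_change|exact: Fc_change|exact: Fc_change|].
exact: dFc_change.
Qed.

Lemma dWc_sym A a p x : (dWc A a p x)^T = dWc A a p x.
Proof. by rewrite /dWc linearD/= !wedge_mx_tr addrC. Qed.

Lemma deltaQE A a x : is_connection A -> smooth1 E a -> \tr (Wc A (lpatch_at E x) x) != 0 ->
  deltaQ A a x = dQ (Wc A (lpatch_at E x) x) (dWc A a (lpatch_at E x) x).
Proof.
move=> cA sa W0; set p := lpatch_at E x; have px : pdom p x by exact: pdom_at.
apply/matrixP => k l; rewrite mxE.
have := @derive_Q R _ (dFc A a p x) (ddFc a p x) k l W0.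
rewrite -/(Wc A p x) -/(dWc A a p x) => <-; congr (derive1 _ _); apply/funext => t.
rewrite /Q mxE /mu.
have FE m : Fcomp (cshift A a t) x m = Fc A p x m + t *: dFc A a p x m + t ^+ 2 *: ddFc a p x m.
  by rewrite -Fc_cshift.
by rewrite !FE; congr (_ / (_ * _)); apply: eq_bigr => m _; rewrite FE.
Qed.

Lemma laplace4_jac_neq0 p q x : pdom p x -> pdom q x -> laplace4 (jac q.1 p.1 x) != 0.
Proof. by move=> px qx; apply: laplace4_neq0 (jac_inv px.1 qx.1) => //. Qed.

Lemma tr_Wc_neq0 A p q x : is_connection A -> pdom p x -> pdom q x ->
  \tr (Wc A p x) != 0 -> \tr (Wc A q x) != 0.
Proof.
move=> cA px qx W0; rewrite (Wc_change cA px qx) mxtraceZ mxtrace_mulC mulmxA.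
have gg : (trans q.2 p.2 x)^T *m trans q.2 p.2 x = 1%:M.
  by apply: trans_orthogonal; [exact: qx.2|exact: px.2].
by rewrite gg mul1mx mulf_neq0// laplace4_jac_neq0.
Qed.

(** [Wc] and [dWc] acquire the same Jacobian factor when the patch changes, and [dQ_change] removes
    it; so [deltaQ] is a genuine section of the symmetric square of [E]. *)
Lemma loc2_deltaQ A a p x : is_connection A -> smooth1 E a ->
  \tr (Wc A (lpatch_at E x) x) != 0 -> pdom p x ->
  loc2 p (deltaQ A a) x = dQ (Wc A p x) (dWc A a p x).
Proof.
move=> cA sa W0 px; have ax := pdom_at E x.
rewrite (Wc_change cA ax px) (dWc_change cA sa ax px) dQ_change.
- by rewrite /loc2 deltaQE.
- exact: laplace4_jac_neq0.
- by apply: trans_orthogonal; [exact: px.2|exact: ax.2].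
Qed.

Lemma vee_smooth c D (M : X -> 'M[R]_3) : open D -> smooth_mx c D M ->
  smooth_mx c D (fun x => vee (M x)).
Proof.
move=> oD Ms k l; apply: (smooth_in_ext oD (f := fun x => Num.sqrt 2 * M x (k + 2) (k + 1))).
  by move=> x _ _; rewrite mxE.
by apply: (smooth_inM oD (@smooth_in_cst _ _ _ _ _)); exact: Ms.
Qed.

Lemma Fc_smooth A p k : is_connection A -> smooth_mx p.1 (tdom p.2) (fun x => Fc A p x k).
Proof.
move=> cA i j; have os := tdm p.
apply: (smooth_in_ext os (f := fun x => vee (curvature A p x i j) k 0)).
  by move=> x _ _; rewrite [RHS]mxE.
exact: (vee_smooth os (curvature_smooth cA i j)).
Qed.

Lemma dFc_smooth A a p k : is_connection A -> smooth1 E a ->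
  smooth_mx p.1 (tdom p.2) (fun x => dFc A a p x k).
Proof.
move=> cA sa; have os := tdm p.
apply: (smooth_mx_ext os (M := fun x => 2^-1 *: Fc (cshift A a 1) p x k
   - 2^-1 *: Fc (cshift A a (-1)) p x k)).
  by move=> x px tx; rewrite dFcE.
apply: (smooth_submx os); apply: (smooth_scalemx os (@smooth_in_cst _ _ _ _ _));
  by apply: Fc_smooth; exact: cshift_connection.
Qed.

Lemma wedge_smooth c D (M N : X -> 'M[R]_4) : open D -> smooth_mx c D M -> smooth_mx c D N ->
  smooth_in c D (fun x => wedge (M x) (N x)).
Proof.
move=> oD Ms Ns; rewrite /wedge.
have MNs i j k l : smooth_in c D (fun x => M x i j * N x k l) by exact: smooth_inM.
apply: (smooth_inD oD) => //; apply: (smooth_inB oD) => //; apply: (smooth_inD oD) => //.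
by apply: (smooth_inD oD) => //; apply: (smooth_inB oD).
Qed.

Lemma wedge_mx_smooth c D (F H : X -> 'I_3 -> 'M[R]_4) : open D ->
  (forall k, smooth_mx c D (fun x => F x k)) -> (forall k, smooth_mx c D (fun x => H x k)) ->
  smooth_mx c D (fun x => wedge_mx (F x) (H x)).
Proof.
move=> oD Fs Hs k l; apply: (smooth_in_ext oD (f := fun x => wedge (F x k) (H x l))).
  by move=> x _ _; rewrite [RHS]mxE.
exact: wedge_smooth.
Qed.

Lemma deltaQ_smooth A a : is_connection A -> smooth1 E a ->
  (forall x, \tr (Wc A (lpatch_at E x) x) != 0) -> smooth2 E (deltaQ A a).
Proof.
move=> cA sa W0; apply/smooth2P => p; have os := tdm p.
apply: (smooth_mx_ext os (M := fun x => dQ (Wc A p x) (dWc A a p x))).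
  by move=> x px tx; rewrite loc2_deltaQ.
have Ws : smooth_mx p.1 (tdom p.2) (Wc A p).
  by apply: (wedge_mx_smooth os) => k; exact: Fc_smooth.
have dWs : smooth_mx p.1 (tdom p.2) (dWc A a p).
  apply: (smooth_addmx os); apply: (wedge_mx_smooth os) => k.
  - exact: dFc_smooth.
  - exact: Fc_smooth.
  - exact: Fc_smooth.
  - exact: dFc_smooth.
have trs (M : X -> 'M[R]_3) : smooth_mx p.1 (tdom p.2) M ->
    smooth_in p.1 (tdom p.2) (fun x => 3^-1 * \tr (M x)).
  move=> Ms; apply: (smooth_inM os (@smooth_in_cst _ _ _ _ _)).
  by apply: (smooth_in_sum os) => i; exact: Ms.
have t0 x : dom p.1 x -> tdom p.2 x -> 3^-1 * \tr (Wc A p x) != 0.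
  move=> px tx; rewrite mulf_neq0 ?invr_neq0 ?pnatr_eq0//.
  by apply: tr_Wc_neq0 (pdom_at E x) _ (W0 x).
apply: (smooth_submx os); apply: (smooth_scalemx os) => //.
  by apply: (smooth_inV os) => //; exact: trs.
apply: (smooth_inM os); first exact: trs.
apply: (smooth_inV os) => [x px tx|]; first by rewrite expf_neq0// t0.
apply: (smooth_in_ext os (f := fun x => (3^-1 * \tr (Wc A p x)) * (3^-1 * \tr (Wc A p x)))).
  by move=> x _ _; rewrite expr2.
by apply: (smooth_inM os); exact: trs.
Qed.

Lemma loc1_linear p (k : R) a b x :
  loc1 p (fun z => k *: a z + b z) x = k *: loc1 p a x + loc1 p b x.
Proof. by rewrite /loc1 mulmxDr mulmxDl -scalemxAr -scalemxAl. Qed.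

Lemma loc1_scale p (f : X -> R) a x : loc1 p (fun z => f z *: a z) x = f x *: loc1 p a x.
Proof. by rewrite /loc1 -scalemxAr -scalemxAl. Qed.

End CurvatureVariation.

(** * The codifferential *)

Section BumpOnManifold.
Variables (R : realType) (X : manifold4 R).

(** A Euclidean bump read in the chart at [x0] and extended by zero. The compact set [K] is closed
    because [X] is Hausdorff, so the chart domain and the complement of [K] form an open cover, on
    each member of which smoothness is clear. *)
Lemma smooth_bump (x0 : X) : exists (phi : X -> R) (K : set X),
  [/\ smooth phi, forall x, 0 <= phi x, 0 < phi x0 &
      [/\ compact K, K `<=` dom (chart_at x0) & forall x, ~ K x -> phi x = 0]].
Proof.
set c := chart_at x0; set y0 := chart c x0.
have cx0 : dom c x0 by exact: dom_at.
have : \forall y \near y0, (chart c @` dom c) y.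
  by apply: open_nbhs_nbhs; split; [exact: chart_open|exists x0].
(* Halving the radius puts the closed ball inside the chart image. *)
move=> /nbhs_normP[e /= e0 eB]; pose r := e / 2.
have r0 : 0 < r by rewrite divr_gt0.
have rB : closed_ball y0 r `<=` chart c @` dom c.
  move=> y; rewrite closed_ballE//= => ry; apply: eB => /=.
  by apply: le_lt_trans ry _; rewrite /r; lra.
have cB : compact (closed_ball y0 r).
  apply: bounded_closed_compact; last exact: closed_ball_closed.
  exists (`|y0| + r); split; first by rewrite ger0_real// addr_ge0// ltW.
  move=> M rM y; rewrite closed_ballE//= => ry; apply: le_trans (ltW rM).
  rewrite -[y](subrK y0) addrC; apply: (le_trans (ler_normD _ _)).
  by rewrite lerD2l distrC.
pose K := unchart c @` closed_ball y0 r.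
have cK : compact K.
  apply: continuous_compact => //; apply: continuous_in_subspaceT => y /[!inE] yB.
  by apply: unchart_continuous; exact: rB.
have Kdom : K `<=` dom c.
  by move=> _ [y /rB[x cx <-] <-]; rewrite chartK.
pose phi x := if `[< dom c x >] then bump4 y0 r (chart c x) else 0.
have phiK x : ~ K x -> phi x = 0.
  move=> nKx; rewrite /phi; case: asboolP => // cx; apply: bump4_eq0 => //.
  rewrite leNgt; apply/negP => yr; apply: nKx; exists (chart c x); last exact: chartK.
  by rewrite closed_ballE//=; exact: ltW.
exists phi, K; split=> //.
- move=> d; apply: smooth_in_local => x dx _.
  have [cx|ncx] := pselect (dom c x).
    exists (dom c) => //.
    apply: (smooth_in_ext (dom_open c) (f := fun z => bump4 y0 r (chart c z))).
      by move=> z dz cz; rewrite /phi asboolT.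
    apply: (smooth_in_closure (dom_open c)).
    apply: (@SmoothClosureComp R _ setT (bump4 y0 r) (chart c \o unchart d)) => //.
    - exact: openT.
    - exact: smooth_on_bump4.
    - by move=> k; apply: SmoothClosureBase; exact: chart_coord_smooth.
  have oK : open (~` K).
    by apply: closed_openC; apply: compact_closed => //; exact: pt_hausdorff.
  exists (~` K) => [|]; first by move=> /Kdom.
  apply: (smooth_in_ext oK (f := fun=> 0)) => [z _ /phiK//|].
  exact: smooth_in_cst.
- by move=> x; rewrite /phi; case: ifP => // _; exact: bump4_ge0.
- by rewrite /phi asboolT//; exact: bump4_gt0.
Qed.

End BumpOnManifold.

(** * Linearity and positivity of the Riemannian integral in one chart *)

Section VolIntegral.
Variables (R : realType) (X : manifold4 R) (G : X -> 'M[R]_4).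
Hypothesis rG : riemannian G.
Hypothesis detG : forall x, 0 < \det (G x).

Lemma riemannian_unit x : G x \in unitmx.
Proof. by have [_ /(_ x)/posdef_unitmx] := rG. Qed.

Lemma metric_loc_unit c x : dom c x -> metric_loc G c x \in unitmx.
Proof.
move=> cx; have ax := dom_at x.
have [J1 _] := mulmx1_unit (jac_inv ax cx).
by rewrite /metric_loc !unitmx_mul unitmx_tr J1 riemannian_unit.
Qed.

Lemma det_metric_loc c x : dom c x -> 0 < \det (metric_loc G c x).
Proof.
move=> cx; have := metric_loc_unit cx; rewrite unitmxE unitfE /metric_loc !det_mulmx det_tr.
rewrite mulrAC -expr2 => d0; rewrite pmulr_lgt0// exprn_even_gt0//=.
by apply: contraNneq d0 => ->; rewrite expr0n/= mul0r.
Qed.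

Lemma metric_loc_smooth c : smooth_mx c setT (metric_loc G c).
Proof. by have [_ _ sG] := rG; move=> i j; exact: sG. Qed.

Let integrand c (u : X -> R) : 'rV[R]_4 -> R :=
  (fun y => u (unchart c y) * Num.sqrt (\det (metric_loc G c (unchart c y))))
     \_ (chart c @` dom c).

(** The bound [N] depends on [K] alone, so that one bound serves all the integrands of a linear
    combination. Extension by zero is continuous because the image of [K] is compact, hence
    closed. *)
Lemma integrand_supp c (K : set X) : compact K -> K `<=` dom c ->
  exists N, forall u, smooth u -> (forall x, ~ K x -> u x = 0) -> cont_supp N (integrand c u).
Proof.
move=> cK Kc; pose L := chart c @` K.
have cL : compact L.
  apply: continuous_compact => //; apply: continuous_in_subspaceT => x /[!inE] Kx.
  exact/chart_continuous/Kc.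
have clL : closed L by apply: compact_closed => //; exact: norm_hausdorff.
have [M [_ ML]] := compact_bounded cL.
exists (M + 1) => u su u0.
have out y : ~ L y -> integrand c u y = 0.
  move=> nL; rewrite /integrand patchE; case: ifPn => // /[!inE] -[x cx xy].
  rewrite -xy chartK// u0 ?mul0r// => Kx; apply: nL.
  by rewrite -xy; exists x.
split; last first.
  move=> y j Ny; apply: out => Ly; move: Ny; apply/negP; rewrite -leNgt.
  by apply: (le_trans (ler_mx_norm_coord y 0 j)); apply: (ML (M + 1)) => //; rewrite ltrDl.
move=> y; have [Ly|nLy] := pselect (L y).
  have [x Kx xy] := Ly; have cx := Kc _ Kx; subst y.
  pose w z := u z * Num.sqrt (\det (metric_loc G c z)).
  have cw : {for x, continuous w}.
    have cu : {for x, continuous u}.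
      exact: (smooth_in_continuous (su c) cx I).
    have cd : {for x, continuous (fun z => \det (metric_loc G c z))}.
      exact: (smooth_in_continuous (smooth_det openT (@metric_loc_smooth c)) cx I).
    apply: (@cvgM _ _ (nbhs x)) => //.
    by apply: (cvg_comp _ (@Num.sqrt R) cd); exact: sqrt_continuous.
  apply: (@near_eq_continuous _ _ _ (w \o unchart c)).
    have : \forall y \near chart c x, (chart c @` dom c) y.
      by apply: open_nbhs_nbhs; split; [exact: chart_open|exists x].
    by apply: filterS => z cz; rewrite /integrand patchE mem_set.
  apply: continuous_comp; first by apply: unchart_continuous; exists x.
  by rewrite chartK.
apply: (@near_eq_continuous _ _ _ (fun=> 0)); last exact: cst_continuous.
have : \forall z \near y, (~` L) z by apply: open_nbhs_nbhs; split => //; exact: closed_openC.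
by apply: filterS => z; exact: out.
Qed.

Lemma vol_integral_linear c (K : set X) (k : R) (u v : X -> R) :
  compact K -> K `<=` dom c -> smooth u -> smooth v ->
  (forall x, ~ K x -> u x = 0) -> (forall x, ~ K x -> v x = 0) ->
  vol_integral G c (fun x => k * u x + v x) = k * vol_integral G c u + vol_integral G c v.
Proof.
move=> cK Kc su sv u0 v0; have [N NP] := integrand_supp cK Kc.
rewrite -(integral4_linear k (NP u su u0) (NP v sv v0)) /vol_integral; congr integral4.
apply/funext => y; rewrite /integrand !patchE; case: ifP => _; first by rewrite mulrDl mulrA.
by rewrite mulr0 addr0.
Qed.

Lemma vol_integral_gt0 c (K : set X) (u : X -> R) x :
  compact K -> K `<=` dom c -> smooth u -> (forall x, ~ K x -> u x = 0) ->
  (forall x, 0 <= u x) -> dom c x -> 0 < u x -> 0 < vol_integral G c u.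
Proof.
move=> cK Kc su u0 up cx ux; have [N NP] := integrand_supp cK Kc.
apply: (integral4_gt0 (y := chart c x) (NP u su u0)).
  by move=> z; rewrite /integrand patchE; case: ifP => // _; rewrite mulr_ge0// sqrtr_ge0.
rewrite /integrand patchE mem_set; last by exists x.
by rewrite chartK// mulr_gt0// sqrtr_gt0; exact: det_metric_loc.
Qed.

End VolIntegral.

(** * Uniqueness, linearity and Leibniz rule of the adjoint of [dA] *)

Section Codifferential.
Variables (R : realType) (X : manifold4 R) (E : so3_bundle X).
Variables (A : cform E) (G : X -> 'M[R]_4).
Hypothesis cA : is_connection A.
Hypothesis rG : riemannian G.
Hypothesis detG : forall x, 0 < \det (G x).
Implicit Types (p q : lpatch E) (x : X) (s h : X -> 'cV[R]_3) (a b : X -> 'M[R]_(3, 4)).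

Lemma smooth_patches (u : X -> R) : (forall p, smooth_in p.1 (tdom p.2) u) -> smooth u.
Proof.
move=> su c; apply: smooth_in_local => x cx _.
by exists (tdom (triv_at E x)); [exact: tdom_at|exact: (su (c, triv_at E x))].
Qed.

Lemma trans_at_orthogonal p x : pdom p x ->
  (trans p.2 (triv_at E x) x)^T *m trans p.2 (triv_at E x) x = 1%:M.
Proof. by move=> px; apply: trans_orthogonal; [exact: px.2|exact: tdom_at]. Qed.

Lemma invmx_metric_loc c x : dom c x -> invmx (metric_loc G c x) =
  jac (chart_at x) c x *m invmx (G x) *m (jac (chart_at x) c x)^T.
Proof.
move=> cx; have ax := dom_at x; have uG := riemannian_unit rG x.
have uM := metric_loc_unit rG cx.
set J := jac c (chart_at x) x; set J' := jac (chart_at x) c x.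
have JJ' : J *m J' = 1%:M by exact: jac_inv.
have J'J : J' *m J = 1%:M by exact: jac_inv.
have inv : metric_loc G c x *m (J' *m invmx (G x) *m J'^T) = 1%:M.
  rewrite /metric_loc -/J -!mulmxA (mulmxA J J') JJ' mul1mx (mulmxA (G x)) mulmxV// mul1mx.
  by rewrite -trmx_mul J'J trmx1.
by rewrite -[LHS]mulmx1 -inv (mulmxA (invmx (metric_loc G c x))) (mulVmx uM) mul1mx.
Qed.

Lemma ip1_loc p (v w : X -> 'M[R]_(3, 4)) x : pdom p x ->
  ip1 (G x) (v x) (w x) =
  \tr (loc1 p v x *m invmx (metric_loc G p.1 x) *m (loc1 p w x)^T).
Proof.
move=> px; have ax := dom_at x; rewrite invmx_metric_loc; last exact: px.1.
have aux (g : 'M[R]_3) (J J' K : 'M[R]_4) (a b : 'M[R]_(3, 4)) : g^T *m g = 1%:M ->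
    J *m J' = 1%:M -> \tr (g *m a *m J *m (J' *m K *m J'^T) *m (g *m b *m J)^T) =
    \tr (a *m K *m b^T).
  move=> gg JJ'; have E1 n (Z : 'M[R]_(4, n)) : J *m (J' *m Z) = Z by rewrite mulmxA JJ' mul1mx.
  have E2 n (Z : 'M[R]_(4, n)) : J'^T *m (J^T *m Z) = Z.
    by rewrite mulmxA -trmx_mul JJ' trmx1 mul1mx.
  rewrite !trmx_mul -!mulmxA E1 E2.
  by rewrite [LHS]mxtrace_mulC -!mulmxA gg mulmx1.
by rewrite /loc1 /ip1 aux//; [exact: trans_at_orthogonal|apply: jac_inv => //; exact: px.1].
Qed.

Lemma invmx_metric_smooth c : smooth_mx c setT (fun x => invmx (metric_loc G c x)).
Proof.
apply: (smooth_invmx openT (metric_loc_smooth rG (c := c))) => x cx _.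
exact: metric_loc_unit.
Qed.

Lemma ip1_smooth a b : smooth1 E a -> smooth1 E b -> smooth (fun x => ip1 (G x) (a x) (b x)).
Proof.
move=> sa sb; apply: smooth_patches => p; have os := @tdom_open _ _ E p.2.
apply: (smooth_in_ext os (f := fun x => \sum_i
   (loc1 p a x *m invmx (metric_loc G p.1 x) *m (loc1 p b x)^T) i i)).
  by move=> x px tx; rewrite -[LHS]/(mxtrace _) -ip1_loc.
apply: (smooth_in_sum os) => i.
have sK : smooth_mx p.1 (tdom p.2) (fun x => invmx (metric_loc G p.1 x)).
  exact: smooth_mx_sub (@invmx_metric_smooth p.1).
have sbT := smooth_trmx os (sb p).
exact: (smooth_mulmx os (smooth_mulmx os (sa p) sK) sbT).
Qed.

Lemma ip0_smooth s h : smooth0 E s -> smooth0 E h -> smooth (fun x => ip0 (s x) (h x)).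
Proof.
move=> /smooth0P ss /smooth0P sh; apply: smooth_patches => p; have os := @tdom_open _ _ E p.2.
apply: (smooth_in_ext os (f := fun x => ((loc0 p s x)^T *m loc0 p h x) 0 0)).
  move=> x px tx; rewrite /ip0 /loc0 trmx_mul -mulmxA.
  by rewrite [(trans _ _ _)^T *m _]mulmxA trans_at_orthogonal ?mul1mx.
exact: (smooth_mulmx os (smooth_trmx os (ss p)) (sh p)).
Qed.

Lemma smooth0_lin (k : R) s h : smooth0 E s -> smooth0 E h ->
  smooth0 E (fun x => k *: s x + h x).
Proof.
move=> /smooth0P ss /smooth0P sh; apply/smooth0P => p; have os := @tdom_open _ _ E p.2.
apply: (smooth_mx_ext os (M := fun x => k *: loc0 p s x + loc0 p h x)).
  by move=> x _ _; rewrite /loc0 mulmxDr -scalemxAr.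
apply: (smooth_addmx os _ (sh p)); apply: (smooth_scalemx os _ (ss p)).
exact: smooth_in_cst.
Qed.

Lemma smooth_sub_patch (f : X -> R) p : smooth f -> smooth_in p.1 (tdom p.2) f.
Proof. by move=> sf; exact: smooth_in_sub (sf p.1). Qed.

Lemma smooth0_scale (f : X -> R) s : smooth f -> smooth0 E s ->
  smooth0 E (fun x => f x *: s x).
Proof.
move=> sf /smooth0P ss; apply/smooth0P => p; have os := @tdom_open _ _ E p.2.
apply: (smooth_mx_ext os (M := fun x => f x *: loc0 p s x)).
  by move=> x _ _; rewrite /loc0 -scalemxAr.
exact: (smooth_scalemx os (smooth_sub_patch (p := p) sf) (ss p)).
Qed.

Lemma smooth1_scale (f : X -> R) a : smooth f -> smooth1 E a ->
  smooth1 E (fun x => f x *: a x).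
Proof.
move=> sf sa; apply/smooth1P => p; have os := @tdom_open _ _ E p.2.
apply: (smooth_mx_ext os (M := fun x => f x *: loc1 p a x)).
  by move=> x _ _; rewrite loc1_scale.
exact: (smooth_scalemx os (smooth_sub_patch (p := p) sf) (sa p)).
Qed.

Lemma smooth1_lin (k : R) a b : smooth1 E a -> smooth1 E b ->
  smooth1 E (fun x => k *: a x + b x).
Proof.
move=> sa sb; apply/smooth1P => p; have os := @tdom_open _ _ E p.2.
apply: (smooth_mx_ext os (M := fun x => k *: loc1 p a x + loc1 p b x)).
  by move=> x _ _; rewrite loc1_linear.
apply: (smooth_addmx os _ (sb p)); apply: (smooth_scalemx os _ (sa p)).
exact: smooth_in_cst.
Qed.

Definition supp s : set X := closure [set x | s x != 0].

Lemma notin_supp s x : ~ supp s x -> s x = 0.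
Proof.
by move=> nx; apply/eqP/negPn/negP => sx; apply: nx; exact: subset_closure.
Qed.

Lemma dA_notin_supp s x : ~ supp s x -> dA A s x = 0.
Proof.
move=> nx; set p := lpatch_at E x.
have z0 : \forall z \near x, s z = 0.
  have : \forall z \near x, ~ supp s z.
    apply: open_nbhs_nbhs; split=> //; apply: closed_openC; exact: closed_closure.
  by apply: filterS => z; exact: notin_supp.
apply/matrixP => k i; rewrite [LHS]mxE [RHS]mxE -/p.
have -> : pder_mx p.1 i (loc0 p s) x = 0.
  rewrite -(pder_cstmx p.1 i (0 : 'cV[R]_3) x); apply: eq_pder_mx; first exact: dom_at.
  by apply: filterS z0 => z sz; rewrite /loc0 sz mulmx0.
by rewrite loc0_at (nbhs_singleton z0) mulmx0 addr0 mxE.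
Qed.

(* The test section is [phi h] for a bump function [phi]. *)
Lemma fundamental_lemma h : smooth0 E h ->
  (forall c s, smooth0 E s -> compactly_supported_in s (dom c) ->
    vol_integral G c (fun x => ip0 (s x) (h x)) = 0) -> forall x, h x = 0.
Proof.
move=> sh H x0; apply/eqP/negPn/negP => hx0.
have [phi [K [sphi phi0 phix [cK Kc phiK]]]] := smooth_bump x0.
pose s x := phi x *: h x.
have ss : smooth0 E s by exact: smooth0_scale.
have clK : closed K by apply: compact_closed => //; exact: pt_hausdorff.
have sK : supp s `<=` K.
  have -> : K = closure K by apply/closure_id.
  apply: closure_subset => x /= sx; apply: contrapT => /phiK phi_x.
  by move: sx; rewrite /s phi_x scale0r eqxx.
have cs : compactly_supported_in s (dom (chart_at x0)).
  split; last by move=> x /sK; exact: Kc.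
  by apply: subclosed_compact sK => //; exact: closed_closure.
have ipE x : ip0 (s x) (h x) = phi x * \sum_i h x i 0 ^+ 2.
  rewrite /ip0 /s linearZ/= -scalemxAl mxE; congr (_ * _); rewrite mxE.
  by apply: eq_bigr => i _; rewrite mxE expr2.
have sq x : 0 <= \sum_i h x i 0 ^+ 2 by apply: sumr_ge0 => i _; rewrite sqr_ge0.
have := @vol_integral_gt0 _ _ G rG detG (chart_at x0) K (fun x => ip0 (s x) (h x)) x0 cK Kc
  (ip0_smooth ss sh).
rewrite H// ltxx => F; suff : false by []. apply: F => [x /phiK phi_x|x||].
- by rewrite ipE phi_x mul0r.
- by rewrite ipE mulr_ge0.
- exact: dom_at.
- rewrite ipE mulr_gt0// lt_neqAle sq andbT eq_sym; apply: contra_neq hx0.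
  move=> /psumr_eq0P z; apply/colP => i; rewrite mxE; apply/eqP; rewrite -sqrf_eq0.
  by rewrite z// => j _; rewrite sqr_ge0.
Qed.

Variable dstar : (X -> 'M[R]_(3, 4)) -> X -> 'cV[R]_3.
Hypothesis ds : is_L2_adjoint A G dstar.

Lemma dstar_smooth a : smooth1 E a -> smooth0 E (dstar a).
Proof. by move=> /ds[]. Qed.

Lemma ip0_lin s (k : R) (u v : 'cV[R]_3) x :
  ip0 (s x) (k *: u + v) = k * ip0 (s x) u + ip0 (s x) v.
Proof. by rewrite /ip0 mulmxDr -scalemxAr !mxE. Qed.

Lemma ip1_lin (g : 'M[R]_4) (k : R) (v u w : 'M[R]_(3, 4)) :
  ip1 g v (k *: u + w) = k * ip1 g v u + ip1 g v w.
Proof. by rewrite /ip1 linearD linearZ/= mulmxDr -scalemxAr linearD linearZ. Qed.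

(** The adjunction determines [dstar] pointwise: the difference of the two sides integrates to zero
    against every test section, and [fundamental_lemma] applies. *)
Lemma dstar_linear (k : R) a b x : smooth1 E a -> smooth1 E b ->
  dstar (fun z => k *: a z + b z) x = k *: dstar a x + dstar b x.
Proof.
move=> sa sb; pose ab z := k *: a z + b z.
have sab : smooth1 E ab by exact: smooth1_lin.
have [[da db] dab] := (dstar_smooth sa, dstar_smooth sb, dstar_smooth sab).
pose m z := k *: dstar a z + dstar b z.
have sm : smooth0 E m by exact: smooth0_lin.
suff H : forall z, -1 *: m z + dstar ab z = 0.
  by have /eqP := H x; rewrite scaleN1r addrC subr_eq0 => /eqP.
apply: fundamental_lemma; first exact: smooth0_lin.
move=> c s ss [cs sc].
have v0 (u : X -> 'cV[R]_3) z : ~ supp s z -> ip0 (s z) (u z) = 0.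
  by move=> /notin_supp ->; rewrite /ip0 trmx0 mul0mx mxE.
have v1 (u : X -> 'M[R]_(3, 4)) z : ~ supp s z -> ip1 (G z) (dA A s z) (u z) = 0.
  by move=> /dA_notin_supp ->; rewrite /ip1 !mul0mx mxtrace0.
have VL := vol_integral_linear rG _ cs sc.
have i0 u : smooth0 E u -> smooth (fun z => ip0 (s z) (u z)) by exact: ip0_smooth.
have i1 u : smooth1 E u -> smooth (fun z => ip1 (G z) (dA A s z) (u z)).
  by apply: ip1_smooth; exact: dA_smooth.
have -> : (fun z => ip0 (s z) (-1 *: m z + dstar ab z)) =
    (fun z => -1 * ip0 (s z) (m z) + ip0 (s z) (dstar ab z)).
  by apply/funext => z; rewrite ip0_lin.
rewrite (VL (-1) _ _ (i0 _ sm) (i0 _ dab) (v0 m) (v0 (dstar ab))).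
have -> : (fun z => ip0 (s z) (m z)) =
    (fun z => k * ip0 (s z) (dstar a z) + ip0 (s z) (dstar b z)).
  by apply/funext => z; rewrite ip0_lin.
rewrite (VL k _ _ (i0 _ da) (i0 _ db) (v0 _) (v0 _)).
rewrite -(ds sab).2// -(ds sa).2// -(ds sb).2//.
have -> : (fun z => ip1 (G z) (dA A s z) (ab z)) =
    (fun z => k * ip1 (G z) (dA A s z) (a z) + ip1 (G z) (dA A s z) (b z)).
  by apply/funext => z; rewrite ip1_lin.
by rewrite (VL k _ _ (i1 _ sa) (i1 _ sb) (v1 _) (v1 _)) mulN1r addNr.
Qed.

Lemma differential_loc (f : X -> R) c x : smooth f -> dom c x ->
  (\row_i pder c i f x) = differential f x *m jac c (chart_at x) x.
Proof.
move=> sf cx; apply/rowP => j; rewrite !mxE.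
rewrite (pder_change j openT (sf (chart_at x)) I (dom_at x) cx).
by apply: eq_bigr => i _; rewrite [differential f x 0 i]mxE.
Qed.

(** The value of [a] on the gradient of [f]; its negative is the zeroth-order term in the Leibniz
    rule for [dstar]. *)
Definition sharp_contract (f : X -> R) a x : 'cV[R]_3 :=
  a x *m invmx (G x) *m (differential f x)^T.

Lemma sharp_contract_smooth (f : X -> R) a : smooth f -> smooth1 E a -> smooth0 E (sharp_contract f a).
Proof.
move=> sf sa; apply/smooth0P => p; have os := @tdom_open _ _ E p.2.
apply: (smooth_mx_ext os (M := fun x => loc1 p a x *m invmx (metric_loc G p.1 x) *m
    (\row_i pder p.1 i f x)^T)).
  move=> x px tx; have ax := dom_at x; rewrite differential_loc// invmx_metric_loc//.
  have aux (g : 'M[R]_3) (J J' K : 'M[R]_4) (v : 'M[R]_(3, 4)) (d : 'rV[R]_4) :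
      J *m J' = 1%:M -> g *m v *m J *m (J' *m K *m J'^T) *m (d *m J)^T = g *m (v *m K *m d^T).
    move=> JJ'; have E1 n (Z : 'M[R]_(4, n)) : J *m (J' *m Z) = Z by rewrite mulmxA JJ' mul1mx.
    have E2 n (Z : 'M[R]_(4, n)) : J'^T *m (J^T *m Z) = Z.
      by rewrite mulmxA -trmx_mul JJ' trmx1 mul1mx.
    by rewrite !trmx_mul -!mulmxA E1 E2.
  by rewrite /loc0 /loc1 /sharp_contract aux//; exact: jac_inv.
have sK : smooth_mx p.1 (tdom p.2) (fun x => invmx (metric_loc G p.1 x)).
  exact: smooth_mx_sub (@invmx_metric_smooth p.1).
apply: (smooth_mulmx os (smooth_mulmx os (sa p) sK)); apply: (smooth_trmx os) => k i.
apply: (smooth_in_ext os (f := pder p.1 i f)); first by move=> x _ _; rewrite mxE.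
exact: (smooth_in_pder os i (smooth_sub_patch (p := p) sf)).
Qed.

Lemma dA_scale (f : X -> R) s x : smooth f -> smooth0 E s ->
  dA A (fun z => f z *: s z) x = f x *: dA A s x + s x *m differential f x.
Proof.
move=> sf /smooth0P ss; set p := lpatch_at E x; have px : pdom p x by exact: pdom_at.
have os := @tdom_open _ _ E p.2.
apply/matrixP => k i; rewrite [LHS]mxE -/p.
have lE z : loc0 p (fun z => f z *: s z) z = f z *: loc0 p s z.
  by rewrite /loc0 -scalemxAr.
have -> : pder_mx p.1 i (loc0 p (fun z => f z *: s z)) x =
    f x *: pder_mx p.1 i (loc0 p s) x + pder p.1 i f x *: loc0 p s x.
  rewrite -(pder_scalemx os i (smooth_sub_patch (p := p) sf) (ss p) px.1 px.2).
  by apply: eq_pder_mx; [exact: px.1|apply: nearW => z; exact: lE].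
rewrite lE -scalemxAr addrAC -scalerDr !(addmxE, scalemxE) [dA _ _ _ _ _]mxE -/p.
congr (_ + _); first by rewrite addmxE.
by rewrite loc0_at [RHS]mxE big_ord1 [differential f x 0 i]mxE mulrC.
Qed.

Lemma ip0_contract (v : 'cV[R]_3) (d : 'rV[R]_4) (K : 'M[R]_4) (w : 'M[R]_(3, 4)) :
  K^T = K -> \tr (v *m d *m K *m w^T) = ip0 v (w *m K *m d^T).
Proof.
move=> sK; rewrite /ip0 -[RHS]trace_mx11 -[in RHS]mxtrace_tr.
have -> : (v^T *m (w *m K *m d^T))^T = d *m K *m w^T *m v.
  by rewrite !trmx_mul !trmxK sK !mulmxA.
by rewrite [RHS]mxtrace_mulC !mulmxA.
Qed.

(* No integration by parts: [dstar] is already known to be the adjoint, and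
   [<dA s, f a> = <dA (f s), a> - <s, a (df)^#>] pointwise. *)
Lemma dstar_scale (f : X -> R) a x : smooth f -> smooth1 E a ->
  dstar (fun z => f z *: a z) x = f x *: dstar a x - sharp_contract f a x.
Proof.
move=> sf sa; pose fa z := f z *: a z.
have sfa : smooth1 E fa by exact: smooth1_scale.
have [da dfa] := (dstar_smooth sa, dstar_smooth sfa).
have sw := sharp_contract_smooth sf sa.
have sfd : smooth0 E (fun z => f z *: dstar a z) by exact: smooth0_scale.
pose m z := -1 *: sharp_contract f a z + f z *: dstar a z.
have sm : smooth0 E m by exact: smooth0_lin.
suff H : forall z, -1 *: m z + dstar fa z = 0.
  have /eqP := H x; rewrite scaleN1r addrC subr_eq0 => /eqP ->.
  by rewrite /m scaleN1r addrC.
apply: fundamental_lemma; first exact: smooth0_lin.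
move=> c s ss [cs sc].
have v0 (u : X -> 'cV[R]_3) z : ~ supp s z -> ip0 (s z) (u z) = 0.
  by move=> /notin_supp ->; rewrite /ip0 trmx0 mul0mx mxE.
have VL := vol_integral_linear rG _ cs sc.
have i0 u : smooth0 E u -> smooth (fun z => ip0 (s z) (u z)) by exact: ip0_smooth.
have -> : (fun z => ip0 (s z) (-1 *: m z + dstar fa z)) =
    (fun z => -1 * ip0 (s z) (m z) + ip0 (s z) (dstar fa z)).
  by apply/funext => z; rewrite ip0_lin.
rewrite (VL (-1) _ _ (i0 _ sm) (i0 _ dfa) (v0 m) (v0 (dstar fa))).
have -> : (fun z => ip0 (s z) (m z)) =
    (fun z => -1 * ip0 (s z) (sharp_contract f a z) + ip0 (s z) (f z *: dstar a z)).
  by apply/funext => z; rewrite ip0_lin.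
rewrite (VL (-1) _ _ (i0 _ sw) (i0 _ sfd) (v0 _) (v0 (fun z => f z *: dstar a z))).
pose fs z := f z *: s z.
have sfs : smooth0 E fs by exact: smooth0_scale.
(* The factor [f] is moved from the form to the test section, which remains admissible since its
   support does not grow. *)
have fsub : supp fs `<=` supp s.
  apply: closure_subset => z /=; apply: contraNN => /eqP sz.
  by rewrite /fs sz scaler0.
have cfs : compactly_supported_in fs (dom c).
  split; last by move=> z /fsub; exact: sc.
  by apply: subclosed_compact fsub => //; exact: closed_closure.
have fE : (fun z => ip0 (s z) (f z *: dstar a z)) = (fun z => ip0 (fs z) (dstar a z)).
  by apply/funext => z; rewrite /ip0 /fs [in RHS]linearZ/= -scalemxAl -scalemxAr.
rewrite -(ds sfa).2// fE -(ds sa).2//.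
have -> : (fun z => ip1 (G z) (dA A s z) (fa z)) =
    (fun z => -1 * ip0 (s z) (sharp_contract f a z) + ip1 (G z) (dA A fs z) (a z)).
  apply/funext => z; rewrite dA_scale// /ip1 /fa linearZ/= -scalemxAr !mulmxDl.
  rewrite -!scalemxAl linearZ/= linearD linearZ/=.
  rewrite [X in _ = _ + (_ + X)](_ : _ = ip0 (s z) (sharp_contract f a z)).
    by rewrite mulN1r addrC addrK.
  have [sG _ _] := rG.
  have sK : (invmx (G z))^T = invmx (G z) by rewrite trmx_inv sG.
  exact: ip0_contract.
have sdfs : smooth (fun z => ip1 (G z) (dA A fs z) (a z)).
  exact: (ip1_smooth (dA_smooth cA sfs) sa).
rewrite (VL (-1) _ _ (i0 _ sw) sdfs (v0 _)).
  by rewrite mulN1r addNr.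
move=> z nz; rewrite dA_notin_supp ?/ip1 ?mul0mx ?mxtrace0// => /fsub; exact: nz.
Qed.

End Codifferential.

(** * Ellipticity *)

Section PointwiseSymbol.
Variable R : realType.

(** With volume coefficient [0], self-duality says that [b] wedges to zero with every 2-form, and
    the wedge pairing is nondegenerate. *)
Lemma self_dual0 (G b : 'M[R]_4) : skew b -> self_dual G 0 b -> b = 0.
Proof.
move=> sb sd.
have d0 i j : dual2 b i j = 0.
  rewrite -wedge_delta// sd ?mul0r//.
  by rewrite /skew linearB/= !trmx_delta opprB.
have := (d0 0 1, d0 0 2, d0 0 3, d0 1 2, d0 1 3, d0 2 3); rewrite !mxE /=.
move=> [[[[[b23 b13] b12] b03] b02] b01].
have e23 : b 2 3 = 0 by []. have e13 : b 1 3 = 0 by lra.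
have e12 : b 1 2 = 0 by []. have e03 : b 0 3 = 0 by [].
have e02 : b 0 2 = 0 by lra. have e01 : b 0 1 = 0 by [].
apply/matrixP => i j; rewrite [RHS]mxE.
by case: (ord4 i) => ->; case: (ord4 j) => ->; rewrite ?(skew_diag _ sb)// ?e23 ?e13 ?e12
  ?e03 ?e02 ?e01// (skewE _ _ sb) ?e23 ?e13 ?e12 ?e03 ?e02 ?e01 oppr0.
Qed.

(** Self-duality turns the wedge with [b] into [v] times an inner product, and that of xi /\ r with
    [b] is that of [r] with the contraction of [b] by the metric dual of [xi]. The two halves of xi
    /\ r agree, which cancels [2^-1]. *)
Lemma wedge_symbol (G b : 'M[R]_4) (v : R) (xi r : 'rV[R]_4) : G^T = G -> skew b ->
  self_dual G v b ->
  wedge (xi^T *m r - r^T *m xi) b =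
  v * (r *m invmx G *m ((invmx G *m xi^T)^T *m b)^T) 0 0.
Proof.
move=> sG sb sd; have sK : (invmx G)^T = invmx G by rewrite trmx_inv sG.
rewrite sd; last by rewrite /skew linearB/= !trmx_mul !trmxK opprB.
congr (_ * _); rewrite /ip2; set K := invmx G.
set t := (_ *m _) 0 0.
have t1 : \tr (K *m (xi^T *m r) *m K *m b^T) = t.
  rewrite /t !trmx_mul !trmxK -/K -!mulmxA mxtrace_mulC -trace_mx11 -!mulmxA.
  by rewrite mxtrace_mulC -!mulmxA.
have t2 : \tr (K *m (r^T *m xi) *m K *m b^T) = - t.
  rewrite -t1 -[in RHS]mxtrace_tr !trmx_mul !trmxK -/K sK sb.
  rewrite mulmxN linearN/= mxtrace_mulC.
  by rewrite -!mulmxA; congr (- \tr _); rewrite mxtrace_mulC.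
by rewrite mulmxBr !mulmxBl linearB/= t1 t2; field.
Qed.

Lemma wedge_linl (k : R) (a b c : 'M[R]_4) : wedge (k *: a + b) c = k * wedge a c + wedge b c.
Proof. by rewrite /wedge !mxE; ring. Qed.

Lemma wedge_linr (k : R) (a b c : 'M[R]_4) : wedge c (k *: a + b) = k * wedge c a + wedge c b.
Proof. by rewrite wedgeC wedge_linl ![wedge c _]wedgeC. Qed.

Lemma iotaW_linear (F : 'I_3 -> 'M[R]_4) (k : R) (n m : 'cV[R]_4) :
  iotaW F (k *: n + m) = k *: iotaW F n + iotaW F m.
Proof.
apply/matrixP => i j; rewrite !mxE mulr_sumr -big_split/=; apply: eq_bigr => l _.
by rewrite !mxE; ring.
Qed.

Lemma symQ_linear_covector (F : 'I_3 -> 'M[R]_4) (G : 'M[R]_4) (v k : R) (n m : 'cV[R]_4) w :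
  symQ F G v (k *: n + m) w = k *: symQ F G v n w + symQ F G v m w.
Proof.
have PE : symP F G (k *: n + m) w = k *: symP F G n w + symP F G m w.
  by rewrite /symP iotaW_linear linearD linearZ/= mulmxDr -scalemxAr.
rewrite /symQ PE !linearD !linearZ/=; move: (symP F G n w) (symP F G m w) => P1 P2.
by apply/matrixP => i j; rewrite !mxE; ring.
Qed.

Lemma wedge_mx_sym_lin (k : R) (F H H1 H2 : 'I_3 -> 'M[R]_4) :
  (forall i, H i = k *: H1 i + H2 i) ->
  wedge_mx H F + wedge_mx F H =
  k *: (wedge_mx H1 F + wedge_mx F H1) + (wedge_mx H2 F + wedge_mx F H2).
Proof.
move=> HE; apply/matrixP => i j.
by rewrite !(addmxE, scalemxE) !mxE !HE wedge_linl wedge_linr; ring.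
Qed.

End PointwiseSymbol.

(** * Leibniz rules for the linearised operator and its symbol *)

Section Ellipticity.
Variables (R : realType) (X : manifold4 R) (E : so3_bundle X) (A : cform E).
Variable G : X -> 'M[R]_4.
Hypothesis cA : is_connection A.
Hypothesis hA : definite A.
Hypothesis hG : is_metric_of A G.
Implicit Types (x : X) (a b : X -> 'M[R]_(3, 4)).

Let rG : riemannian G. Proof. by have [] := hG. Qed.

Lemma Fcomp_skew x k : skew (Fcomp A x k).
Proof. exact: Fc_skew. Qed.

Lemma self_dual_Fcomp x k : self_dual (G x) (mu A x) (Fcomp A x k).
Proof.
have [_ /(_ x)[vE /(_ _ (Fcomp_skew x k))[_]]] := hG; rewrite vE; apply.
exists (fun l => (l == k)%:R); rewrite (bigD1 k)//= big1 => [|l lk].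
  by rewrite eqxx scale1r addr0.
by rewrite (negbTE lk) scale0r.
Qed.

(** If [mu A x] vanished, the self-dual forms [Fcomp A x k] would vanish by [self_dual0],
    contradicting definiteness on any independent pair of vectors. *)
Lemma mu_neq0 x : mu A x != 0.
Proof.
apply/negP => /eqP mu0.
have F0 k : Fcomp A x k = 0.
  apply: self_dual0 (Fcomp_skew x k) _; rewrite -mu0; exact: self_dual_Fcomp.
pose e (i : 'I_4) : 'cV[R]_4 := delta_mx i 0.
have r2 : \rank (row_mx (e 0) (e 1)) = 2%N.
  have -> : row_mx (e 0) (e 1) = pid_mx 2.
    apply/matrixP => i j; rewrite !mxE.
    case: splitP => j' jj; rewrite !mxE (ord1 j') in jj *.
      have -> : (j : nat) = 0%N by [].
      by case: (ord4 i) => ->.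
    have -> : (j : nat) = 1%N by [].
    by case: (ord4 i) => ->.
  by rewrite rank_pid_mx.
have /negP := hA x r2; apply; apply/eqP.
have -> : iotaF A x (e 0) = 0; last by rewrite mul0mx.
by apply/matrixP => k j; rewrite !mxE F0 big1// => l _; rewrite !mxE mulr0.
Qed.

(** [Num.sqrt] is zero on nonpositive numbers, so a nonpositive determinant would make the volume
    coefficient, hence [mu A x], vanish. *)
Lemma detG_gt0 x : 0 < \det (G x).
Proof.
have [_ /(_ x)[vE _]] := hG; rewrite ltNge; apply/negP => d0.
by have := mu_neq0 x; rewrite -vE ler0_sqrtr// mulr0 eqxx.
Qed.

Let tr_Wc x : \tr (Wc A (lpatch_at E x) x) = 3 * mu A x.
Proof.
rewrite /mu mulrA mulfV// mul1r; apply: eq_bigr => k _.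
by rewrite mxE.
Qed.

Let tr_Wc0 x : \tr (Wc A (lpatch_at E x) x) != 0.
Proof. by rewrite tr_Wc mulf_neq0// ?pnatr_eq0// mu_neq0. Qed.

Let hatcol_scale (f : X -> R) a p i z :
  hatcol (fun y => f y *: a y) p i z = f z *: hatcol (E := E) a p i z.
Proof.
rewrite /hatcol loc1_scale.
have -> : col i (f z *: loc1 p a z) = f z *: col i (loc1 p a z).
  by apply/colP => k; rewrite !mxE.
by have := @hat_linear R (f z) (col i (loc1 p a z)) 0; rewrite !addr0 => ->;
  rewrite (_ : hat 0 = 0) ?addr0//; apply/matrixP => k l; rewrite hatE !mxE oppr0;
  case: (ord3 k) => ->; case: (ord3 l) => -> /=; rewrite mulr0.
Qed.

Let hatcol_lin (k : R) a b p i z :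
  hatcol (fun y => k *: a y + b y) p i z = k *: hatcol (E := E) a p i z + hatcol b p i z.
Proof.
rewrite /hatcol loc1_linear -hat_linear; congr hat.
by apply/colP => l; rewrite !mxE.
Qed.

Let vee_lin (k : R) (M N : 'M[R]_3) l : vee (k *: M + N) l 0 = k * vee M l 0 + vee N l 0.
Proof. by rewrite vee_linear !(addmxE, scalemxE). Qed.

Let dFc_lin (k : R) a b x m : smooth1 E a -> smooth1 E b ->
  dFc A (fun y => k *: a y + b y) (lpatch_at E x) x m =
  k *: dFc A a (lpatch_at E x) x m + dFc A b (lpatch_at E x) x m.
Proof.
move=> sa sb; set p := lpatch_at E x; have px : pdom p x by exact: pdom_at.
have os := @tdom_open _ _ E p.2.
have dh l n : pder_mx p.1 l (hatcol (fun y => k *: a y + b y) p n) x =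
    k *: pder_mx p.1 l (hatcol a p n) x + pder_mx p.1 l (hatcol b p n) x.
  have ha := @hatcol_smooth _ _ _ a p n sa; have hb := @hatcol_smooth _ _ _ b p n sb.
  have ck : smooth_in p.1 (tdom p.2) (fun=> k) by exact: smooth_in_cst.
  rewrite -(_ : pder_mx p.1 l (fun z => k *: hatcol a p n z) x = k *: pder_mx p.1 l (hatcol a p n) x).
    rewrite -(pder_addmx os l (smooth_scalemx os ck ha) hb px.1 px.2).
    by apply: eq_pder_mx; [exact: px.1|apply: nearW => z; exact: hatcol_lin].
  by rewrite (pder_scalemx os l ck ha px.1 px.2) pder_cst scale0r addr0.
have dcE i j : dcurv A (fun y => k *: a y + b y) p x i j =
    k *: dcurv A a p x i j + dcurv A b p x i j.
  rewrite /dcurv (dh i j) (dh j i) (hatcol_lin k a b p i x) (hatcol_lin k a b p j x).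
  move: (hatcol a p i x) (hatcol a p j x) (hatcol b p i x) (hatcol b p j x) (A p x i) (A p x j).
  move: (pder_mx _ i _ x) (pder_mx _ j _ x) (pder_mx _ i _ x) (pder_mx _ j _ x).
  move=> d1 d2 d3 d4 h1 h2 h3 h4 Ai Aj; rewrite !mulmxDr !mulmxDl -!scalemxAr -!scalemxAl.
  by apply/matrixP => r s; rewrite !(addmxE, oppmxE, scalemxE); ring.
apply/matrixP => i j; rewrite [LHS]mxE dcE (vee_lin k (dcurv A a p x i j) (dcurv A b p x i j) m) [RHS]mxE.
congr (_ + _); last by rewrite [RHS]mxE.
by rewrite [RHS]mxE; congr (_ * _); rewrite [RHS]mxE.
Qed.

(** The Leibniz rule d_A (f a) = f d_A a + df /\ a, component by component; the terms containing [A]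
    are of order zero and only contribute to the first summand. *)
Let dFc_scale (f : X -> R) a x m : smooth f -> smooth1 E a ->
  dFc A (fun y => f y *: a y) (lpatch_at E x) x m = f x *: dFc A a (lpatch_at E x) x m +
    ((differential f x)^T *m row m (a x) - (row m (a x))^T *m differential f x).
Proof.
move=> sf sa; set p := lpatch_at E x; have px : pdom p x by exact: pdom_at.
have os := @tdom_open _ _ E p.2.
have sfp : smooth_in p.1 (tdom p.2) f by exact: smooth_in_sub (sf p.1).
have dh l n : pder_mx p.1 l (hatcol (fun y => f y *: a y) p n) x =
    f x *: pder_mx p.1 l (hatcol a p n) x + pder p.1 l f x *: hatcol a p n x.
  have ha := @hatcol_smooth _ _ _ a p n sa.
  rewrite -(pder_scalemx os l sfp ha px.1 px.2).
  by apply: eq_pder_mx; [exact: px.1|apply: nearW => z; exact: hatcol_scale].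
have dcE i j : dcurv A (fun y => f y *: a y) p x i j = f x *: dcurv A a p x i j +
    (pder p.1 i f x *: hatcol a p j x + (- pder p.1 j f x) *: hatcol a p i x).
  rewrite /dcurv (dh i j) (dh j i) (hatcol_scale f a p i x) (hatcol_scale f a p j x).
  move: (hatcol a p i x) (hatcol a p j x) (A p x i) (A p x j) (pder_mx _ i _ x) (pder_mx _ j _ x).
  move=> h1 h2 Ai Aj d1 d2; rewrite -!scalemxAr -!scalemxAl.
  by apply/matrixP => r s; rewrite !(addmxE, oppmxE, scalemxE); ring.
have hv n : vee (hatcol a p n x) m 0 = a x m n.
  by rewrite /hatcol hatK loc1_at mxE.
have dfE l : differential f x 0 l = pder p.1 l f x by rewrite mxE.
have outer (d : 'rV[R]_4) (r : 'rV[R]_4) i j :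
    (d^T *m r - r^T *m d) i j = d 0 i * r 0 j - d 0 j * r 0 i.
  by rewrite !mxE !big_ord1 !mxE [r 0 i * _]mulrC.
apply/matrixP => i j; rewrite [LHS]mxE dcE.
rewrite (vee_lin (f x) (dcurv A a p x i j) (_ + _) m).
rewrite (vee_lin (pder p.1 i f x) (hatcol a p j x) _ m) [RHS]mxE; congr (_ + _).
  by rewrite [RHS]mxE; congr (_ * _); rewrite [RHS]mxE.
have -> : vee (- pder p.1 j f x *: hatcol a p i x) m 0 = - pder p.1 j f x * a x m i.
  by rewrite -hv [LHS]mxE scalemxE [in RHS]mxE mulrCA.
by rewrite outer !dfE hv [row m (a x) 0 j]mxE [row m (a x) 0 i]mxE mulNr.
Qed.

Lemma deltaQ_linear (k : R) a b x : smooth1 E a -> smooth1 E b ->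
  deltaQ A (fun y => k *: a y + b y) x = k *: deltaQ A a x + deltaQ A b x.
Proof.
move=> sa sb; rewrite (deltaQE cA (smooth1_lin k sa sb) (tr_Wc0 x)).
rewrite (deltaQE cA sa (tr_Wc0 x)) (deltaQE cA sb (tr_Wc0 x)).
have -> : dWc A (fun y => k *: a y + b y) (lpatch_at E x) x =
    k *: dWc A a (lpatch_at E x) x + dWc A b (lpatch_at E x) x.
  by apply: wedge_mx_sym_lin => i; exact: dFc_lin.
exact: dQ_linear.
Qed.

Lemma deltaQ_scale (f : X -> R) a x : smooth f -> smooth1 E a ->
  deltaQ A (fun y => f y *: a y) x = f x *: deltaQ A a x +
    symQ (Fcomp A x) (G x) (mu A x) (invmx (G x) *m (differential f x)^T) (a x).
Proof.
move=> sf sa; rewrite (deltaQE cA (smooth1_scale sf sa) (tr_Wc0 x)) (deltaQE cA sa (tr_Wc0 x)).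
set p := lpatch_at E x; set n := invmx (G x) *m _; set P := symP (Fcomp A x) (G x) n (a x).
have [sG _ _] := rG.
(* The wedge of the new term df /\ a with the curvature forms is [mu] times [symP]; this is where
   self-duality of the curvature enters the symbol. *)
have wP k l : wedge ((differential f x)^T *m row k (a x) - (row k (a x))^T *m differential f x)
     (Fc A p x l) = mu A x * P k l.
  rewrite (wedge_symbol _ _ (sG x) (Fcomp_skew x l) (self_dual_Fcomp x l)) -/n.
  congr (_ * _); rewrite -row_mul [LHS]mxE [RHS]mxE; apply: eq_bigr => i _.
  by rewrite [row k _ 0 i]mxE; congr (_ * _); rewrite !mxE.
have -> : dWc A (fun y => f y *: a y) p x = f x *: dWc A a p x + mu A x *: (P + P^T).
  pose w k := (differential f x)^T *m row k (a x) - (row k (a x))^T *m differential f x.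
  have -> : mu A x *: (P + P^T) = wedge_mx w (Fc A p x) + wedge_mx (Fc A p x) w.
    apply/matrixP => i j; rewrite scalemxE addmxE [P^T i j]mxE [RHS]addmxE.
    rewrite [wedge_mx w _ i j]mxE [wedge_mx _ w i j]mxE [wedge _ (w j)]wedgeC.
    by rewrite (wP i j) (wP j i) mulrDr.
  by apply: wedge_mx_sym_lin => i; exact: dFc_scale.
rewrite dQ_linear; congr (_ + _).
rewrite /dQ tr_Wc mxtraceZ mxtraceD mxtrace_tr mulrA mulVf// mul1r scalerA mulVf ?mu_neq0//.
rewrite scale1r /symQ -/P; congr (_ - _).
have -> : Wc A p x = mu A x *: gramW (Fcomp A x) (mu A x).
  apply/matrixP => i j; rewrite [RHS]mxE [LHS]mxE [X in _ = _ * X]mxE.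
  by rewrite mulrC divfK// mu_neq0.
by rewrite scalerA; congr (_ *: _); have := mu_neq0 x => m0; field.
Qed.

Variable dstar : (X -> 'M[R]_(3, 4)) -> X -> 'cV[R]_3.
Hypothesis hd : is_L2_adjoint A G dstar.

Lemma D_op_elliptic :
  elliptic (V_sections A G) (V A G) (@W_sections R X E) (@W R X) (D_op A dstar).
Proof.
split; first split.
- move=> a [sa _]; split => [||x].
  + exact: (deltaQ_smooth cA sa tr_Wc0).
  + exact: (dstar_smooth hd sa).
  + have sym : (deltaQ A a x)^T = deltaQ A a x.
      rewrite (deltaQE cA sa (tr_Wc0 x)).
      exact: (dQ_sym (wedge_mx_sym _) (dWc_sym A a (lpatch_at E x) x)).
    have tr0 : \tr (deltaQ A a x) = 0.
      by rewrite (deltaQE cA sa (tr_Wc0 x)); exact: (tr_dQ _ (tr_Wc0 x)).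
    exact: (conj sym tr0).
- move=> k a b [sa _] [sb _] x.
  exact: (f_equal2 pair (deltaQ_linear k x sa sb) (dstar_linear cA rG detG_gt0 hd k x sa sb)).
(* The factor [mu] of the wedge products has cancelled in the quotient defining [Q]. The minus sign
   in the second component is that of [dstar_scale]. *)
exists (fun x xi w => (symQ (Fcomp A x) (G x) (mu A x) (invmx (G x) *m xi^T) w,
                       - (w *m (invmx (G x) *m xi^T)))); split; first split.
- move=> x xi k v w _ _; rewrite symQ_linear mulmxDl -scalemxAl opprD -scalerN.
  by [].
- move=> x xi eta k v _.
  rewrite linearD linearZ/= mulmxDr -scalemxAr symQ_linear_covector mulmxDr -scalemxAr.
  by rewrite opprD -scalerN.
- move=> f a sf [sa _] x;
  have := dstar_scale cA rG detG_gt0 hd x sf sa; rewrite /sharp_contract -mulmxA.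
  exact: (f_equal2 pair (deltaQ_scale x sf sa)).
move=> x xi; have [sG pG _] := rG.
exact: (symbol_bij (Fcomp_skew x) (sG x) (pG x) (mu_neq0 x) erefl (self_dual_Fcomp x) (hA x)).
Qed.

End Ellipticity.

Theorem proposition3p6 (R : realType) (X : manifold4 R) (E : so3_bundle X)
    (A : connection E) (hA : definite A)
    (gA : X -> 'M[R]_4) (hgA : is_metric_of A gA)
    (dstar : (X -> 'M[R]_(3, 4)) -> X -> 'cV[R]_3)
    (hdstar : is_L2_adjoint A gA dstar) :
  elliptic (V_sections A gA) (V A gA) (@W_sections R X E) (@W R X)
           (D_op A dstar).
Proof. exact: (D_op_elliptic (connectionP A) hA hgA hdstar). Qed.
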